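(* There exists a constant $C=C(\rho)>0$ such that, for every $n\in\mathbb N$, every $L\in\mathbb N$, every $t>0$ and every function $v\in\ell^2(\mathbb Z)$, $$\mathbb E^n_\rho\Big[\Big(\int_0^t\sum_{x\in\mathbb Z}v(x)\Big\{\bar\eta_{sn^a}(x-1)\,\bar\eta_{sn^a}(x)\,\bar\eta_{sn^a}(x+1)-\big(\overrightarrow{\eta}^{L}_{sn^a}(x)\big)^3+\frac{\xi(\rho)}{L^2}\Big\}ds\Big)^2\Big]\le Ct\Big\{\frac{L}{n^{a-1}}+\frac{tn}{L^2}\Big\}\|v\|_{2,n}^2,$$ where $\xi(\rho)=\int_\Omega(\eta(x)-\rho)^3\,\nu_\rho(d\eta)$.
   Context: Setting. Fix $a>0$. For each scaling parameter $n\in\mathbb N$, $\{\eta^n_{tn^a}(x)\,;\,x\in\mathbb Z,\,t\ge0\}$ (written simply $\eta_{tn^a}$) is a Markov process with generator $n^a\mathcal L_n$ on $\Omega=\mathcal X^{\mathbb Z}$, where $\mathcal X$ is the space of values of the (real) variables $\eta(x)$ (e.g. $\{0,1\}$ or $\mathbb R$). It is a conservative one-dimensional interacting particle system, the conserved quantity being $\sum_x\eta(x)$. For $x\in\mathbb Z$, $(\tau_x\eta)(y)=\eta(x+y)$ and $(\tau_xh)(\eta)=h(\tau_x\eta)$ for $h:\Omega\to\mathbb R$; $\eta^{z,z+1}$ is $\eta$ with the values at $z$ and $z+1$ exchanged; $\nabla_{z,z+1}f(\eta)=f(\eta^{z,z+1})-f(\eta)$. (A1) There is a family of probability measures $\{\nu_\rho;\rho\in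 I\}$ invariant for the process; each $\nu_\rho$ is a product measure on $\Omega$, translation invariant, with $\int\eta(x)\,d\nu_\rho=\rho$ for all $x$, and $\int|\eta(x)|^k\,d\nu_\rho<\infty$ for $k=2,\dots,6$. A value $\rho\in I$ is fixed. $\bar\eta(x)=\eta(x)-\rho$, and $\bar\psi=\psi-\int\psi\,d\nu_\rho$ for $\psi:\Omega\to\mathbb R$. $\mathcal L_n=\mathcal S_n+\mathcal A_n$ with $\mathcal S_n=(\mathcal L_n+\mathcal L_n^* )/2$, $\mathcal A_n=(\mathcal L_n-\mathcal L_n^* )/2$ (adjoint in $\mathbb L^2(\nu_\rho)$). Dirichlet form: $D_n(f)=-\int f\mathcal L_nf\,d\nu_\rho=-\int f\mathcal S_nf\,d\nu_\rho$ for local $f\in\mathbb L^2(\nu_\rho)$. Currents: $\mathcal S_n\eta(x)=j^{n,s}_{x-1,x}-j^{n,s}_{x,x+1}$ and $\mathcal A_n\eta(x)=j^{n,a}_{x-1,x}-j^{n,a}_{x,x+1}$. (A2) There are $\delta>0$ and functions $\zeta^n_{0,1}:\Omega\to[\delta,\delta^{-1}]$ such that $D_n(f)=\sum_{z\in\mathbb Z}I^n_{z,z+1}(f)$, $I^n_{z,z+1}(f)=\int\zeta^n_{z,z+1}(\eta)(\nabla_{z,z+1}f(\eta))^2\,\nu_\rho(d\eta)$, where $\zeta^n_{z,z+1}=\tau_z\zeta^n_{0,1}$. (A3) There are local functions $h=h(n),\,g=g(n):\Omega\to\mathbb R$ and a constant $c=c(n)$ such that for all $x$: $\bar j^{n,s}_{x,x+1}=\tau_xh-\tau_{x+1}h$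 and $\bar j^{n,a}_{x,x+1}=c\,\bar\eta(x)\bar\eta(x+1)+\tau_xg$, and for every Schwartz function $H$, $\lim_{n\to\infty}\mathbb E^n_\rho\big[\big(\int_0^t\frac{n^{a-1}}{\sqrt n}\sum_x\nabla_nH(\tfrac xn)\,\tau_xg(\eta_{sn^a})ds\big)^2\big]=0$, where $\nabla_nH(\frac xn)=n[H(\frac{x+1}n)-H(\frac xn)]$. $\mathbb P^n_\rho$, $\mathbb E^n_\rho$: law and expectation of the process $\{\eta_{tn^a}\}_{t\ge0}$ started from $\nu_\rho$. Notation: $\|v\|_{2,n}^2=n^{-1}\sum_{x\in\mathbb Z}v^2(x)$ and $\overrightarrow{\eta}^{L}(x)=\frac1L\sum_{y=x+1}^{x+L}\bar\eta(y)$. *)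

(* Defs.v *)
From HB Require Import structures.
From mathcomp Require Import all_boot all_order all_algebra.
From mathcomp Require Import all_classical all_reals all_analysis.

Set Implicit Arguments.
Unset Strict Implicit.
Unset Printing Implicit Defensive.

Import Order.TTheory GRing.Theory Num.Theory.
Import numFieldNormedType.Exports.

Local Open Scope classical_set_scope.
Local Open Scope ring_scope.

Section configurations.
Context {d : measure_display} (X : measurableType d).

Definition one_site_cylinders : set (set (int -> X)) :=
  [set A | exists x : int, exists2 B : set X,
     measurable B & A = [set eta | B (eta x)]].

(* X^Z with the product sigma-algebra. *)
Definition config : Type := g_sigma_algebraType one_site_cylinders.

HB.instance Definition _ := Measurable.on config.

Definition shift (x : int) (eta : config) : config := fun y => eta (x + y).

Definition exchange (y z : int) (eta : config) : config :=
  fun x => if x == y then eta z else if x == z then eta y else eta x.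

End configurations.

(* A time-homogeneous Markov process, given with all its initial laws: law x
   is the law on the path space when the process starts from x. *)
Record markov_process (R : realType) (d : measure_display)
    (S : measurableType d) := MarkovProcess {
  path_display : measure_display ;
  path : measurableType path_display ;
  law : R.-pker S ~> path ;
  traj : R -> path -> S ;
  traj_measurable :
    measurable_fun (`[0 : R, +oo[%classic `*` [set: path])
      (fun p : R * path => traj p.1 p.2) ;
  law_initial : forall (x : S) (B : set S), measurable B ->
    law x (traj 0 @^-1` B) = \d_x B ;
  law_markov : forall (x : S) (s t : R) (A : set path) (B : set S),
    0 <= s -> 0 <= t -> measurable B ->
    <<s [set E | exists2 u : R, 0 <= u <= s &
           exists2 B' : set S, measurable B' & E = traj u @^-1` B'] >> A ->
    law x (A `&` traj (s + t) @^-1` B) =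
    (\int[law x]_(w in A) law (traj s w) (traj t @^-1` B))%E }.

Arguments traj {R d S} m _ _.
Arguments law {R d S} m.

Section markov_processes.
Context {R : realType} {d : measure_display} {S : measurableType d}.
Implicit Types (Y : markov_process R S) (nu : probability S R).

(* Expectation for the process started from nu; the integrand is nonnegative
   wherever this is used. *)
Definition expectation_from nu Y (Z : path Y -> \bar R) : \bar R :=
  (\int[nu]_x \int[law Y x]_w Z w)%E.

Definition invariant nu Y :=
  forall (t : R) (B : set S), 0 <= t -> measurable B ->
    (\int[nu]_x law Y x (traj Y t @^-1` B) = nu B)%E.

Definition semigroup Y (t : R) (f : S -> R) : S -> R :=
  fun x => \int[law Y x]_w f (traj Y t w).

End markov_processes.

Section L2.
Context {R : realType} {d : measure_display} {S : measurableType d}.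
Variable nu : probability S R.

Definition L2 (f : S -> R) : Prop := f \in Lfun nu 2%:E.

Definition L2dist (f g : S -> R) : \bar R :=
  'N[nu]_2%:E [EFin \o (fun x => f x - g x)].

(* The sum of F over Z in L^2(nu): a fixed version of the limit of the
   symmetric partial sums, and 0 if the series diverges. An infinite sum over
   the sites of a random field need not converge at every configuration. *)
Definition L2_sumZ (F : int -> S -> R) : S -> R :=
  xget (cst 0) [set G | L2 G /\
    L2dist G (fun x => \sum_(k < N.*2.+1) F (k%:Z - N%:Z) x)
      @[N --> \oo] --> 0%E].

Definition infinitesimal_generator (T : R -> (S -> R) -> S -> R)
    (f g : S -> R) : Prop :=
  [/\ L2 f, L2 g &
    L2dist (fun x => t^-1 * (T t f x - f x)) g @[t --> 0^'+] --> 0%E].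

(* L, given on Dom, generates T: the semigroup T is strongly continuous on
   L^2(nu) and its infinitesimal generator is the closure of L, i.e. Dom is a
   core. *)
Definition generated_by (T : R -> (S -> R) -> S -> R)
    (Dom : set (S -> R)) (L : (S -> R) -> S -> R) : Prop :=
  [/\ forall f, L2 f -> L2dist (T t f) f @[t --> 0^'+] --> 0%E,
      forall f, Dom f -> infinitesimal_generator T f (L f) &
      forall f g, infinitesimal_generator T f g ->
        forall e : R, 0 < e -> exists2 h, Dom h &
          (L2dist f h < e%:E)%E /\ (L2dist g (L h) < e%:E)%E].

Definition adjoint_on (Dom : set (S -> R)) (L Lstar : (S -> R) -> S -> R) :
    Prop :=
  forall f, Dom f -> L2 (Lstar f) /\
    forall h, Dom h ->
      \int[nu]_x (h x * Lstar f x) = \int[nu]_x (L h x * f x).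

Definition dirichlet_form (L : (S -> R) -> S -> R) (f : S -> R) : R :=
  - \int[nu]_x (f x * L f x).

Definition center (f : S -> R) : S -> R := fun x => f x - \int[nu]_y f y.

End L2.

Definition sym_part {R : realType} {S : Type} (L Lstar : (S -> R) -> S -> R)
  (f : S -> R) : S -> R := fun x => (L f x + Lstar f x) / 2.

Definition asym_part {R : realType} {S : Type} (L Lstar : (S -> R) -> S -> R)
  (f : S -> R) : S -> R := fun x => (L f x - Lstar f x) / 2.

Definition schwartz {R : realType} (H : R -> R) : Prop :=
  (forall (k : nat) (u : R), derivable (derive1n k H) u 1) /\
  (forall m k : nat, exists C : R, forall u, `|u ^+ m * derive1n k H u| <= C).

Definition discrete_gradient {R : realType} (n : nat) (H : R -> R) (x : int) :
    R :=
  n%:R * (H ((x + 1)%:~R / n%:R) - H (x%:~R / n%:R)).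

Definition ell2 {R : realType} (v : int -> R) : Prop :=
  (\esum_(x in [set: int]) ((v x) ^+ 2)%:E < +oo)%E.

Definition sqnorm2n {R : realType} (n : nat) (v : int -> R) : R :=
  n%:R^-1 * fine (\esum_(x in [set: int]) ((v x) ^+ 2)%:E)%E.

Section particle_systems.
Context {R : realType} {d : measure_display} {X : measurableType d}.
(* X is identified with a set of real numbers through an injection ev. *)
Variable ev : X -> R.
Notation Omega := (config X).
Implicit Types (nu : probability Omega R) (f g h : Omega -> R).

Definition spin (x : int) : Omega -> R := fun eta => ev (eta x).

Definition local f : Prop :=
  measurable_fun setT f /\
  exists s : seq int, forall eta xi : Omega,
    (forall x, x \in s -> eta x = xi x) -> f eta = f xi.

Definition product_measure nu : Prop :=
  forall (s : seq int) (B : int -> set X), uniq s ->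
    (forall x, measurable (B x)) ->
    nu [set eta | forall x, x \in s -> B x (eta x)] =
    \big[mule/1%E]_(x <- s) nu [set eta | B x (eta x)].

Definition translation_invariant nu : Prop :=
  forall (x : int) (B : set Omega), measurable B ->
    nu (shift x @^-1` B) = nu B.

Definition local_domain nu (Dom : set (Omega -> R)) : Prop :=
  [/\ forall f, Dom f -> local f /\ L2 nu f,
      Dom (cst 0) &
      forall (b : R) f g, Dom f -> Dom g -> Dom (fun eta => b * f eta + g eta)].

Definition bond_form nu (zeta : Omega -> R) (z : int) f : \bar R :=
  (\int[nu]_eta (zeta (shift z eta)
                 * (f (exchange z (z + 1) eta) - f eta) ^+ 2)%:E)%E.

Definition spin_bar (rho : R) (x : int) : Omega -> R :=
  fun eta => spin x eta - rho.

Definition right_average (rho : R) (L : nat) (x : int) : Omega -> R :=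
  fun eta => L%:R^-1 * \sum_(1 <= k < L.+1) spin_bar rho (x + k%:Z) eta.

(* By translation invariance the site 0 may be replaced by any other. *)
Definition third_moment nu (rho : R) : R :=
  \int[nu]_eta (spin_bar rho 0 eta ^+ 3).

Definition assumption_A1 (I : set R) (nu : R -> probability Omega R)
    (eta : nat -> markov_process R Omega) : Prop :=
  forall r, I r ->
    [/\ forall n, (0 < n)%N -> invariant (nu r) (eta n),
        product_measure (nu r),
        translation_invariant (nu r),
        forall x, (\int[nu r]_e (spin x e)%:E = r%:E)%E &
        forall (x : int) (k : nat), (2 <= k <= 6)%N ->
          (\int[nu r]_e (`|spin x e| ^+ k)%:E < +oo)%E].

(* In what follows Dom n is the domain, made of local functions, on which the
   operator L n is given, Lstar n is its adjoint in L^2(nu), and js n x,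
   ja n x are the symmetric and antisymmetric currents through the bond
   {x, x+1}. The process eta n is not accelerated: the one with generator
   n^a * L n is t |-> eta n (t * n^a). *)

Definition markov_dynamics (a : R) nu (eta : nat -> markov_process R Omega)
    (Dom : nat -> set (Omega -> R))
    (L Lstar : nat -> (Omega -> R) -> Omega -> R) : Prop :=
  forall n, (0 < n)%N ->
    [/\ local_domain nu (Dom n),
        generated_by nu (fun t => semigroup (eta n) (t * n%:R `^ a)) (Dom n)
          (fun f e => n%:R `^ a * L n f e) &
        adjoint_on nu (Dom n) (L n) (Lstar n)].

Definition are_currents nu (Dom : nat -> set (Omega -> R))
    (L Lstar : nat -> (Omega -> R) -> Omega -> R)
    (js ja : nat -> int -> Omega -> R) : Prop :=
  forall n (x : int), (0 < n)%N ->
    [/\ Dom n (spin x), L2 nu (js n x), L2 nu (ja n x),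
        {ae nu, forall e,
          sym_part (L n) (Lstar n) (spin x) e = js n (x - 1) e - js n x e} &
        {ae nu, forall e,
          asym_part (L n) (Lstar n) (spin x) e = ja n (x - 1) e - ja n x e}].

Definition assumption_A2 nu (Dom : nat -> set (Omega -> R))
    (L : nat -> (Omega -> R) -> Omega -> R) : Prop :=
  exists2 delta : R, 0 < delta & exists zeta : nat -> Omega -> R,
  forall n, (0 < n)%N ->
    [/\ measurable_fun setT (zeta n),
        forall e, delta <= zeta n e <= delta^-1 &
        forall f, Dom n f ->
          (dirichlet_form nu (L n) f)%:E =
          (\esum_(z in [set: int]) bond_form nu (zeta n) z f)%E].

Definition assumption_A3 (a rho : R) nu (eta : nat -> markov_process R Omega)
    (js ja : nat -> int -> Omega -> R) : Prop :=
  exists (h g : nat -> Omega -> R) (c : nat -> R),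
  [/\ forall n, (0 < n)%N -> local (h n) /\ local (g n),
      forall n (x : int), (0 < n)%N -> {ae nu, forall e,
        center nu (js n x) e = h n (shift x e) - h n (shift (x + 1) e)},
      forall n (x : int), (0 < n)%N -> {ae nu, forall e,
        center nu (ja n x) e =
        c n * spin_bar rho x e * spin_bar rho (x + 1) e + g n (shift x e)} &
      forall (H : R -> R) (t : R), schwartz H -> 0 < t ->
        expectation_from nu (Y := eta n) (fun w =>
          ((\int[lebesgue_measure]_(s in `[0, t])
             (n%:R `^ (a - 1) / Num.sqrt n%:R *
              L2_sumZ nu (fun x e => discrete_gradient n H x * g n (shift x e))
                (traj (eta n) (s * n%:R `^ a) w))) ^+ 2)%:E)
        @[n --> \oo] --> 0%E].

End particle_systems.

(* Main.v *)
Require Import Defs.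
From HB Require Import structures.
From mathcomp Require Import all_boot all_order all_algebra finmap.
From mathcomp Require Import all_classical all_reals all_analysis.
From mathcomp Require Import measurable_realfun.
From mathcomp Require Import lra ring zify.

(** The quantity to bound is the second moment of an additive functional of a
    stationary Markov process. Two estimates are available for the second moment of
    the integral of an observable V over [0, t]. By Cauchy-Schwarz in time and
    stationarity it is at most t^2 times the second moment of V. By the
    Kipnis-Varadhan inequality (kipnis_varadhan) it is at most 2 t K as soon as
    2 <V, f> <= K + <f, - A f> for all f in a core of the generator A. When the
    observable is a sum of two parts, each part can be treated in its own way
    (additive_functional_bound).

    Let B(x) be the product of the averages of the centered spins over three
    disjoint blocks of L sites around x, the middle one being the block
    x+1, ..., x+L of the statement. Then the observable in the statement is the sum
    of eta(x-1) eta(x) eta(x+1) - B(x) and B(x) - avg(x)^3 + xi / L^2, both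
    multiplied by v(x) and summed over x.

    The second part is handled by Cauchy-Schwarz in time. The cube of the average
    has mean xi / L^2, so the second part is centered; its variance at a single x is of
    order L^-3 because the sixth moment of a sum of L independent centered
    variables is of order L^3; and it depends on 3 L sites only, so that different x
    are correlated only at distance of order L. Hence its variance after summation is
    of order L^-2 sum v^2 (remainder_sum_sqr).

    The first part is handled by the Kipnis-Varadhan inequality. B(x) is the
    mean, over the choice of one site in each block, of a product of three spins at
    those sites. From the product at x-1, x, x+1 one reaches such a product by
    moving first the right spin, then the middle one and then the left one, so
    that a moving spin never passes through the site of one of the other two. A move
    across n bonds is a sum of n differences eta(z) - eta(z+1), each multiplied by
    the product of the two spins at rest. The difference changes sign when the values
    at z and z+1 are exchanged and the other factor does not change, so that its
    scalar product with f is, up to a sign, half a scalar product with the gradient of f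
    across the bond {z, z+1}. By ellipticity, the gradients are bounded by the
    Dirichlet form. It remains to collect the coefficients of the difference at a
    given bond: they are sums over x of v(x) times products of two spins, which are
    orthogonal for different x, so that the sum over the bonds of their second
    moments is of order n sum v^2 (transport_bound). With n of order L, and a
    generator of size n^a, K is of order L n^-a sum v^2.

    The infinite sum over x is a limit in L^2 of finite sums. It is enough to do the
    above for a finite sum that is close to the limit (cubic_decomposition),
    since an error that is small in L^2 is harmless by Cauchy-Schwarz in time. *)

Set Implicit Arguments.
Unset Strict Implicit.
Unset Printing Implicit Defensive.

Import Order.TTheory GRing.Theory Num.Theory.
Import numFieldNormedType.Exports.

Local Open Scope classical_set_scope.
Local Open Scope ring_scope.

(** * Square integrable functions *)

Section square_integrable.
Context {R : realType} {d : measure_display} {T : measurableType d}.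
Variable P : probability T R.
Implicit Types f g h : T -> R.

Definition integrableR f := P.-integrable [set: T] (EFin \o f).

Lemma eq_integrableR f g : f =1 g -> integrableR f -> integrableR g.
Proof. by move=> /funext ->. Qed.

Lemma integrableRD f g : integrableR f -> integrableR g -> integrableR (fun x => f x + g x).
Proof. by move=> If Ig; have := integrableD measurableT If Ig. Qed.

Lemma integrableRZ a f : integrableR f -> integrableR (fun x => a * f x).
Proof. by move=> If; have := integrableZl measurableT a If. Qed.

Lemma integrableR_cst a : integrableR (fun=> a).
Proof. exact: finite_measure_integrable_cst. Qed.

Lemma integrableR_meas f : integrableR f -> measurable_fun setT f.
Proof. by move=> /measurable_int /measurable_EFinP. Qed.

Lemma integrableR_le f g : measurable_fun setT f -> (forall x, `|f x| <= g x) ->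
  integrableR g -> integrableR f.
Proof.
move=> mf fg; apply: le_integrable => //; first exact/measurable_EFinP.
by move=> x _ /=; rewrite lee_fin (le_trans (fg x))// ler_norm.
Qed.

Lemma integrableR_sum (I : Type) (s : seq I) (F : I -> T -> R) :
  (forall i, integrableR (F i)) -> integrableR (fun x => \sum_(i <- s) F i x).
Proof.
move=> h; elim: s => [|i s ih].
  by under eq_fun do rewrite big_nil; exact: integrableR_cst.
by under eq_fun do rewrite big_cons; exact: integrableRD.
Qed.

Lemma Rint_sum (I : Type) (s : seq I) (F : I -> T -> R) :
  (forall i, integrableR (F i)) ->
  \int[P]_x (\sum_(i <- s) F i x) = \sum_(i <- s) \int[P]_x F i x.
Proof.
move=> h; elim: s => [|i s ih].
  rewrite big_nil; under eq_Rintegral do rewrite big_nil.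
  by rewrite Rintegral_cst// mul0r.
rewrite big_cons -ih -RintegralD//; [|exact: h|exact: integrableR_sum].
by apply: eq_Rintegral => x _; rewrite big_cons.
Qed.

Lemma Rint_cst a : \int[P]_x a = a :> R.
Proof.
rewrite Rintegral_cst//; have := congr1 fine (probability_setT P) => /= ->.
by rewrite mulr1.
Qed.

Lemma L2P f : L2 P f <-> measurable_fun setT f /\ integrableR (fun x => f x ^+ 2).
Proof.
rewrite /L2; split.
  move=> h; split; last exact: Lfun2_integrable_sqr.
  by move: h; rewrite inE => /andP[]; rewrite inE.
move=> [mf intf]; rewrite inE; apply/andP; split; rewrite inE//=.
rewrite /finite_norm unlock poweR_lty//.
have /integrableP[_] := intf; apply: le_lt_trans.
apply: ge0_le_integral => //=.
- apply/measurable_EFinP.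
  apply: (@measurableT_comp _ _ _ _ _ _ (fun x : R => x `^ 2)) => //.
  exact: measurableT_comp.
- apply/measurable_EFinP; apply: measurableT_comp => //.
  exact: measurable_funX.
- by move=> x _; rewrite lee_fin powR_mulrn// normrX.
Qed.

Lemma eq_L2 f g : f =1 g -> L2 P f -> L2 P g.
Proof. by move=> /funext ->. Qed.

Lemma L2_meas f : L2 P f -> measurable_fun setT f.
Proof. by move=> /L2P[]. Qed.

Lemma L2_sqr f : L2 P f -> integrableR (fun x => f x ^+ 2).
Proof. by move=> /L2P[]. Qed.

Lemma L2_mul f g : L2 P f -> L2 P g -> integrableR (fun x => f x * g x).
Proof.
move=> /L2P[mf f2] /L2P[mg g2].
apply: (@integrableR_le _ (fun x => f x ^+ 2 + g x ^+ 2)); last exact: integrableRD.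
  exact: measurable_funM.
move=> x; rewrite normrM -(real_normK (num_real (f x))).
rewrite -(real_normK (num_real (g x))) -subr_ge0.
set a := `|f x|; set b := `|g x|.
rewrite (_ : _ - _ = ((a - b) ^+ 2 + (a ^+ 2 + b ^+ 2)) / 2); last by field.
by rewrite divr_ge0// !addr_ge0// sqr_ge0.
Qed.

Lemma L2D f g : L2 P f -> L2 P g -> L2 P (fun x => f x + g x).
Proof.
move=> Lf Lg; apply/L2P; split.
  by apply: measurable_funD; exact: L2_meas.
have -> : (fun x => (f x + g x) ^+ 2) =
    (fun x => f x ^+ 2 + (2 * (f x * g x) + g x ^+ 2)).
  by apply/funext => x; ring.
apply: integrableRD; first exact: L2_sqr.
by apply: integrableRD; [exact/integrableRZ/L2_mul|exact: L2_sqr].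
Qed.

Lemma L2Z a f : L2 P f -> L2 P (fun x => a * f x).
Proof.
move=> Lf; apply/L2P; split; first by apply: measurable_funM => //; exact: L2_meas.
have -> : (fun x => (a * f x) ^+ 2) = (fun x => a ^+ 2 * f x ^+ 2).
  by apply/funext => x; ring.
exact/integrableRZ/L2_sqr.
Qed.

Lemma L2N f : L2 P f -> L2 P (fun x => - f x).
Proof.
by move=> Lf; under eq_fun do rewrite -mulN1r; exact: L2Z.
Qed.

Lemma L2B f g : L2 P f -> L2 P g -> L2 P (fun x => f x - g x).
Proof. by move=> Lf Lg; apply: L2D => //; exact: L2N. Qed.

Lemma L2_cst a : L2 P (fun=> a).
Proof. by apply/L2P; split => //; exact: integrableR_cst. Qed.

Lemma L2_sum (I : Type) (s : seq I) (F : I -> T -> R) :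
  (forall i, L2 P (F i)) -> L2 P (fun x => \sum_(i <- s) F i x).
Proof.
move=> h; elim: s => [|i s ih].
  by under eq_fun do rewrite big_nil; exact: L2_cst.
by under eq_fun do rewrite big_cons; exact: L2D.
Qed.

Lemma L2_integrable f : L2 P f -> integrableR f.
Proof.
move=> Lf; have := L2_mul Lf (L2_cst 1).
by under eq_fun do rewrite mulr1.
Qed.

Lemma L2_bounded f M : measurable_fun setT f -> (forall x, `|f x| <= M) ->
  L2 P f.
Proof.
move=> mf fM; apply/L2P; split => //.
apply: (@integrableR_le _ (fun=> M ^+ 2)); last exact: integrableR_cst.
  exact: measurable_funX.
move=> x; rewrite normrX lerXn2r// ?nnegrE//.
exact: le_trans (fM x).
Qed.

(** Cauchy-Schwarz with a free parameter: a bound that is linear in the two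
    squared norms can be summed over the bonds and integrated over time. *)
Lemma L2_young f g k : 0 < k -> L2 P f -> L2 P g ->
  2 * \int[P]_x (f x * g x) <=
  k^-1 * \int[P]_x (f x ^+ 2) + k * \int[P]_x (g x ^+ 2).
Proof.
move=> k0 Lf Lg; rewrite -!RintegralZl//; try exact: L2_sqr; try exact: L2_mul.
rewrite -RintegralD//; try exact/integrableRZ/L2_sqr.
apply: le_Rintegral => //; [exact/integrableRZ/L2_mul| | ].
  by apply: integrableRD; exact/integrableRZ/L2_sqr.
move=> x _; rewrite -subr_ge0.
rewrite (_ : _ - _ = k^-1 * (f x - k * g x) ^+ 2); last by field; rewrite gt_eqF.
by rewrite mulr_ge0 ?sqr_ge0// invr_ge0 ltW.
Qed.

Lemma Rint_sqr_ge0 f : 0 <= \int[P]_x (f x ^+ 2).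
Proof. by apply: Rintegral_ge0 => x _; exact: sqr_ge0. Qed.

Lemma sqr_intD f g : L2 P f -> L2 P g ->
  \int[P]_x ((f x + g x) ^+ 2) <=
  2 * \int[P]_x (f x ^+ 2) + 2 * \int[P]_x (g x ^+ 2).
Proof.
move=> Lf Lg; rewrite -!RintegralZl//; try exact: L2_sqr.
rewrite -RintegralD//; try exact/integrableRZ/L2_sqr.
apply: le_Rintegral => //; first exact/L2_sqr/L2D.
  by apply: integrableRD; exact/integrableRZ/L2_sqr.
move=> x _; rewrite -subr_ge0 (_ : _ - _ = (f x - g x) ^+ 2) ?sqr_ge0//; ring.
Qed.

Lemma L2distE f g : L2 P f -> L2 P g ->
  L2dist P f g = (Num.sqrt (\int[P]_x ((f x - g x) ^+ 2)))%:E.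
Proof.
move=> Lf Lg; rewrite /L2dist unlock.
have /integrableP[_ ioo] := L2_sqr (L2B Lf Lg).
rewrite -powR12_sqrt; last exact: Rint_sqr_ge0.
rewrite -poweR_EFin; congr (_ `^ _)%E.
rewrite /Rintegral fineK; last first.
  exact: (integrable_fin_num _ (L2_sqr (L2B Lf Lg))).
by apply: eq_integral => x _ /=; rewrite powR_mulrn// real_normK// num_real.
Qed.

Lemma L2dist_lt f g e : L2 P f -> L2 P g -> 0 < e ->
  (L2dist P f g < e%:E)%E = (\int[P]_x ((f x - g x) ^+ 2) < e ^+ 2).
Proof.
move=> Lf Lg e0; rewrite L2distE// lte_fin.
rewrite -[X in _ < X]ger0_norm ?(ltW e0)// -sqrtr_sqr ltr_sqrt//.
by rewrite exprn_gt0.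
Qed.

(** Convergence in L^2 in terms of integrals of squares, the form in which all
    the estimates below are made. *)
Lemma L2dist_cvgP (U : Type) (F : set_system U) {FF : Filter F}
    (u : U -> T -> R) (f : T -> R) :
  (\forall t \near F, L2 P (u t)) -> L2 P f ->
  L2dist P (u t) f @[t --> F] --> 0%E <->
  forall e, 0 < e -> \forall t \near F, \int[P]_x ((u t x - f x) ^+ 2) < e.
Proof.
move=> Lu Lf; split.
  move=> /fine_cvgP[_] /cvgrPdist_lt h e e0.
  have := h (Num.sqrt e); rewrite sqrtr_gt0 => /(_ e0).
  apply: filterS2 Lu => t Lut; rewrite /= sub0r normrN L2distE// /= ger0_norm ?sqrtr_ge0//.
  by rewrite ltr_sqrt.
move=> h; apply/fine_cvgP; split.
  by apply: filterS Lu => t Lut; rewrite L2distE.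
apply/cvgrPdist_lt => e e0.
have := h (e ^+ 2); rewrite exprn_gt0// => /(_ isT).
apply: filterS2 Lu => t Lut; rewrite /= sub0r normrN L2distE// /=.
rewrite ger0_norm ?sqrtr_ge0// => h'.
by rewrite -lte_fin -L2distE// L2dist_lt.
Qed.

End square_integrable.

(** * Bounded measurable functions *)

Section bounded_measurable.
Context {R : realType}.

(** On these functions all the integrals below are finite, and Fubini's theorem
    holds over bounded time intervals and probability spaces without further
    conditions. Square integrable functions are reached by truncation. *)
Definition bmeas {d} {T : measurableType d} (f : T -> R) :=
  measurable_fun setT f /\ exists M, forall x, `|f x| <= M.

Section closure.
Context {d : measure_display} {T : measurableType d}.
Implicit Types f g : T -> R.

Lemma bmeas_cst a : bmeas (fun _ : T => a).
Proof. by split=> //; exists `|a|. Qed.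

Lemma bmeasD f g : bmeas f -> bmeas g -> bmeas (fun x => f x + g x).
Proof.
move=> [mf [M fM]] [mg [N gN]]; split; first exact: measurable_funD.
by exists (M + N) => x; rewrite (le_trans (ler_normD _ _))// lerD.
Qed.

Lemma bmeasM f g : bmeas f -> bmeas g -> bmeas (fun x => f x * g x).
Proof.
move=> [mf [M fM]] [mg [N gN]]; split; first exact: measurable_funM.
by exists (M * N) => x; rewrite normrM ler_pM.
Qed.

Lemma bmeasB f g : bmeas f -> bmeas g -> bmeas (fun x => f x - g x).
Proof.
move=> bf bg; apply: bmeasD => //.
by under eq_fun do rewrite -mulN1r; apply: bmeasM => //; exact: bmeas_cst.
Qed.

Lemma bmeasX f : bmeas f -> bmeas (fun x => f x ^+ 2).
Proof. by move=> bf; exact: bmeasM. Qed.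

Lemma bmeas_indic (A : set T) : measurable A -> bmeas (\1_A : T -> R).
Proof.
move=> mA; split => //; exists 1 => x; rewrite indicE.
by case: (_ \in _); rewrite ?normr1 ?normr0.
Qed.

Lemma bmeas_integrable (mu : {measure set T -> \bar R}) (D : set T) f :
  measurable D -> (mu D < +oo)%E -> bmeas f -> mu.-integrable D (EFin \o f).
Proof.
move=> mD muD [mf [M fM]]; apply: measurable_bounded_integrable => //.
  exact: measurable_funTS.
exists M; split; first exact: num_real.
by move=> N MN x _; apply: (le_trans (fM x)); exact: ltW.
Qed.

Lemma bmeas_int (P : probability T R) f : bmeas f -> integrableR P f.
Proof.
move=> bf; apply: bmeas_integrable => //.
by rewrite (le_lt_trans (probability_le1 P measurableT))// ltry.
Qed.

Lemma bmeas_L2 (P : probability T R) f : bmeas f -> L2 P f.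
Proof. by move=> [mf [M fM]]; exact: L2_bounded fM. Qed.

Lemma bmeas_le (mu : {measure set T -> \bar R}) (D : set T) f M :
  measurable D -> (mu D < +oo)%E -> measurable_fun setT f ->
  (forall x, `|f x| <= M) ->
  `|\int[mu]_(x in D) f x| <= M * fine (mu D).
Proof.
move=> mD muD mf fM.
have bf : bmeas f by split => //; exists M.
have If := bmeas_integrable mD muD bf.
rewrite (le_trans (le_normr_Rintegral mD If))// -Rintegral_cst//.
apply: le_Rintegral => //.
  exact: integrable_norm.
by apply: (bmeas_integrable mD muD); exact: bmeas_cst.
Qed.

End closure.

Lemma bmeas_comp d1 d2 (T1 : measurableType d1) (T2 : measurableType d2)
    (phi : T1 -> T2) (f : T2 -> R) :
  measurable_fun setT phi -> bmeas f -> bmeas (fun x => f (phi x)).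
Proof.
move=> mphi [mf [M fM]]; split; last by exists M.
exact: measurableT_comp.
Qed.

Section product.
Context {d1 d2 : measure_display}.
Context {T1 : measurableType d1} {T2 : measurableType d2}.
Variables (m1 : {sigma_finite_measure set T1 -> \bar R}).
Variables (m2 : {sigma_finite_measure set T2 -> \bar R}).
Variables (D1 : set T1) (D2 : set T2).
Hypotheses (mD1 : measurable D1) (mD2 : measurable D2).
Hypotheses (fD1 : (m1 D1 < +oo)%E) (fD2 : (m2 D2 < +oo)%E).
Variable F : T1 * T2 -> R.
Hypothesis bF : bmeas F.

(** After the addition of a constant the integrand is nonnegative, and
    measurability is part of Tonelli's theorem. *)
Lemma bmeas_Rint2 : bmeas (fun x => \int[m2]_(y in D2) F (x, y)).
Proof.
have [mF [M FM]] := bF.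
have bFx x : bmeas (fun y => F (x, y)).
  split; last by exists M.
  by apply: (measurableT_comp mF); exact: measurable_pair1.
split; last first.
  exists (M * fine (m2 D2)) => x; apply: bmeas_le => //.
  by have [] := bFx x.
pose G (z : T1 * T2) : \bar R := (((F z + M) * \1_D2 z.2)%:E).
have G0 z : (0 <= G z)%E.
  rewrite lee_fin mulr_ge0// -lerBlDr sub0r.
  by have := FM z; rewrite ler_norml => /andP[].
have mG : measurable_fun setT G.
  apply/measurable_EFinP; apply: measurable_funM; first exact: measurable_funD.
  exact: measurableT_comp.
have -> : (fun x => \int[m2]_(y in D2) F (x, y)) =
    (fun x => fine (\int[m2]_y G (x, y)) - M * fine (m2 D2)).
  apply/funext => x.
  have -> : fine (\int[m2]_y G (x, y)) = \int[m2]_(y in D2) (F (x, y) + M).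
    rewrite [RHS]Rintegral_mkcond; congr fine; apply: eq_integral => y _.
    by rewrite /G /= patchE indicE; case: ifP => //; rewrite ?mulr1 ?mulr0.
  rewrite RintegralD//; last 2 first.
    - exact: bmeas_integrable.
    - by apply: bmeas_integrable => //; exact: bmeas_cst.
  by rewrite Rintegral_cst// addrK.
apply: measurable_funB => //; apply: measurableT_comp => //.
exact: (@measurable_fun_fubini_tonelli_F _ _ _ _ _ m2 G).
Qed.

Lemma bmeas_Fubini :
  \int[m1]_(x in D1) \int[m2]_(y in D2) F (x, y) =
  \int[m2]_(y in D2) \int[m1]_(x in D1) F (x, y).
Proof.
have [mF [M FM]] := bF.
have bFx x : bmeas (fun y => F (x, y)).
  split; last by exists M.
  by apply: (measurableT_comp mF); exact: measurable_pair1.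
have bFy y : bmeas (fun x => F (x, y)).
  split; last by exists M.
  by apply: (measurableT_comp mF); exact: measurable_pair2.
pose G (z : T1 * T2) : \bar R := ((F \_ (D1 `*` D2)) z)%:E.
have iG : (m1 \x m2)%E.-integrable setT G.
  rewrite /G; rewrite (_ : (fun z => _) = (EFin \o F) \_ (D1 `*` D2)).
    have mDD : measurable (D1 `*` D2) by exact: measurableX.
    apply: (integrable_mkcond _ mDD).1.
    apply: bmeas_integrable => //.
    rewrite [X in (X < _)%E](_ : _ = m1 D1 * m2 D2)%E; last exact: product_measure1E.
    by rewrite lte_mul_pinfty// ge0_fin_numE.
  by apply/funext => z; rewrite /= !patchE; case: ifP.
have := Fubini iG.
have -> : (\int[m1]_x \int[m2]_y G (x, y) =
   \int[m1]_(x in D1) (\int[m2]_(y in D2) F (x, y))%:E)%E.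
  rewrite [RHS]integral_mkcond; apply: eq_integral => x _.
  rewrite patchE; case: ifPn => xD.
    rewrite /Rintegral fineK; last first.
      by apply: integrable_fin_num => //; exact: bmeas_integrable.
    rewrite [RHS]integral_mkcond; apply: eq_integral => y _.
    rewrite /G !patchE in_setX xD /=.
    by case: ifP.
  apply: integral0_eq => y _; rewrite /G patchE in_setX (negbTE xD)/=.
  by [].
have -> : (\int[m2]_y \int[m1]_x G (x, y) =
   \int[m2]_(y in D2) (\int[m1]_(x in D1) F (x, y))%:E)%E.
  rewrite [RHS]integral_mkcond; apply: eq_integral => y _.
  rewrite patchE; case: ifPn => yD.
    rewrite /Rintegral fineK; last first.
      by apply: integrable_fin_num => //; exact: bmeas_integrable.
    rewrite [RHS]integral_mkcond; apply: eq_integral => x _.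
    rewrite /G !patchE in_setX yD andbT.
    by case: ifP.
  apply: integral0_eq => x _; rewrite /G patchE in_setX (negbTE yD) andbF.
  by [].
by move=> h; rewrite /Rintegral h.
Qed.

End product.

Local Notation mu := (@lebesgue_measure R).

Lemma lebesgue_itvy (a b : R) : (mu `[a, b] < +oo)%E.
Proof. by rewrite lebesgue_measure_itv/=; case: ifP; rewrite ?ltry// -EFinB ltry. Qed.

Lemma fine_lebesgue_itv (s : R) : 0 <= s -> fine (mu `[0, s]) = s.
Proof.
rewrite le_eqVlt => /predU1P[<-|s0]; rewrite lebesgue_measure_itv/= lte_fin.
  by rewrite ltxx.
by rewrite s0 /= subr0.
Qed.

(** Lebesgue measure is determined by the lengths of intervals, which a
    reflection preserves. *)
Lemma Rint_reflect (f : R -> R) (c a b : R) : bmeas f ->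
  \int[mu]_(r in `[a, b]) f (c - r) = \int[mu]_(r in `[c - b, c - a]) f r.
Proof.
move=> bf; have [mf _] := bf.
pose phi (r : measurableTypeR R) : measurableTypeR R := c - r.
have mphi : measurable_fun setT phi by exact: measurable_funB.
pose phi' : {mfun _ >-> _} := HB.pack phi (isMeasurableFun.Build _ _ _ _ _ mphi).
have pre_oc (x y : R) : (fun r : R => c - r) @^-1` `]x, y]%classic
    = `[c - y, c - x[%classic.
  by apply/seteqP; split => r; rewrite /= !in_itv /= => /andP[h1 h2];
    apply/andP; split; lra.
have pre_cc : (fun r : R => c - r) @^-1` `[c - b, c - a]%classic
    = `[a, b]%classic.
  by apply/seteqP; split => r; rewrite /= !in_itv /= => /andP[h1 h2];
    apply/andP; split; lra.
have E (A : set (measurableTypeR R)) : measurable A -> mu A = pushforward mu phi' A.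
  apply: lebesgue_measure_unique => _ [[x y] _ <-].
  change (mu `]x, y] = mu ((fun r : R => c - r) @^-1` `]x, y]%classic)).
  rewrite pre_oc.
  rewrite !lebesgue_measure_itv/= !lte_fin.
  rewrite ltrD2l ltrN2; case: ifP => // _; congr (_%:E); ring.
rewrite /Rintegral; congr fine.
have pre : phi' @^-1` `[c - b, c - a]%classic = `[a, b]%classic.
  exact: pre_cc.
have -> : (\int[mu]_(r in `[(c - b)%R, (c - a)%R]) (f r)%:E =
    \int[pushforward mu phi']_(r in `[(c - b)%R, (c - a)%R]) (f r)%:E)%E.
  by apply: eq_measure_integral => A mA _; exact: E.
rewrite integral_pushforward ?pre//.
  exact/measurable_EFinP.
apply: bmeas_integrable => //; first exact: lebesgue_itvy.
exact: bmeas_comp bf.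
Qed.

End bounded_measurable.

(** * Mixtures of probability kernels *)

Section measurable_induction.
Context {R : realType} {d : measure_display} {T : measurableType d}.
Local Open Scope ereal_scope.

Import HBNNSimple.

(** Functional form of the monotone class argument: a property of the
    indicators of measurable sets that is stable under positive combinations and
    increasing limits holds for all nonnegative measurable functions. *)
Lemma ge0_measurable_ind (Q : (T -> \bar R) -> Prop) :
  (forall A, measurable A -> Q (fun x => (\1_A x)%:E)) ->
  (forall (k : R) (f : T -> \bar R), (0 <= k)%R -> measurable_fun setT f ->
     (forall x, 0 <= f x) -> Q f -> Q (fun x => k%:E * f x)) ->
  (forall f g : T -> \bar R, measurable_fun setT f -> (forall x, 0 <= f x) ->
     measurable_fun setT g -> (forall x, 0 <= g x) ->
     Q f -> Q g -> Q (fun x => f x + g x)) ->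
  (forall (u : nat -> T -> \bar R) (f : T -> \bar R),
     (forall n, measurable_fun setT (u n)) ->
     (forall n x, 0 <= u n x) ->
     (forall x, {homo u ^~ x : m n / (m <= n)%N >-> m <= n}) ->
     (forall x, u n x @[n --> \oo] --> f x) ->
     (forall n, Q (u n)) -> Q f) ->
  forall f : T -> \bar R, measurable_fun setT f -> (forall x, 0 <= f x) -> Q f.
Proof.
move=> Q1 QZ QD Ql f mf f0.
pose u := nnsfun_approx measurableT mf.
apply: (Ql (fun n x => (u n x)%:E)).
- by move=> n; exact/measurable_EFinP.
- by move=> n x; rewrite lee_fin.
- by move=> x m n mn; rewrite lee_fin; exact/lefP/nd_nnsfun_approx.
- by move=> x; exact: cvg_nnsfun_approx.
move=> n; set g := u n.
have -> : (fun x => (g x)%:E) = (fun x =>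
    \sum_(k <- fset_set (range g)) (k%:E * (\1_(g @^-1` [set k]) x)%:E)).
  apply/funext => x; rewrite fimfunE fsbig_finite//= -sumEFin.
  by apply: eq_bigr => k _; rewrite -EFinM.
have gk : forall k, k \in fset_set (range g) -> (0 <= k)%R.
  by move=> k; rewrite in_fset_set// inE => -[x _ <-].
have : forall s : seq R, (forall k, k \in s -> (0 <= k)%R) ->
   Q (fun x => \sum_(k <- s) (k%:E * (\1_(g @^-1` [set k]) x)%:E)).
  elim=> [|k s ih] hs.
    under eq_fun do rewrite big_nil.
    have -> : (fun=> 0) = (fun x : T => (\1_(set0 : set T) x)%:E) :> (T -> \bar R).
      by apply/funext => x; rewrite indic0.
    exact: Q1.
  under eq_fun do rewrite big_cons.
  have k0 : (0 <= k)%R by apply: hs; rewrite mem_head.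
  have mk (c : R) : measurable_fun setT (fun x => c%:E * (\1_(g @^-1` [set c]) x)%:E).
    by apply: measurable_funeM; exact/measurable_EFinP.
  apply: QD.
  - exact: mk.
  - by move=> x; rewrite mule_ge0// lee_fin.
  - by apply: emeasurable_sum => c; exact: mk.
  - move=> x; rewrite big_seq; apply: sume_ge0 => c cs.
    by rewrite mule_ge0// lee_fin// hs// inE cs orbT.
  - by apply: QZ => //; [exact/measurable_EFinP|exact: Q1].
  - by apply: ih => c cs; apply: hs; rewrite inE cs orbT.
exact.
Qed.

End measurable_induction.

Section kernel_snd.
Context d0 d d' (T0 : measurableType d0) (S : measurableType d)
  (Z : measurableType d') (R : realType) (k : R.-pker S ~> Z).

(** A kernel as a family that also depends, trivially, on a second parameter.
    This gives measurability in time and starting point jointly. *)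
Definition ksnd (p : T0 * S) : {measure set Z -> \bar R} := k p.2.

Let measurable_ksnd U : measurable U -> measurable_fun setT (ksnd ^~ U).
Proof.
by move=> mU; apply: (measurableT_comp (measurable_kernel k U mU)).
Qed.

HB.instance Definition _ := isKernel.Build _ _ _ _ _ ksnd measurable_ksnd.

Let ksnd_prob p : ksnd p [set: Z] = 1%E.
Proof. exact: prob_kernel. Qed.

HB.instance Definition _ := Kernel_isProbability.Build _ _ _ _ _ ksnd ksnd_prob.

End kernel_snd.
Arguments ksnd {d0 d d' T0 S Z R}.

Section path_law.
Context {R : realType} {d d' : measure_display} {S : measurableType d}
  {Z : measurableType d'}.
Variables (k : R.-pker S ~> Z) (nu : probability S R).
Local Open Scope ereal_scope.

(** The law of the path when the initial point is random with law nu. *)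
Definition mixture (A : set Z) : \bar R := \int[nu]_x k x A.

Let mixture0 : mixture set0 = 0.
Proof. by rewrite /mixture; apply: integral0_eq => x _; rewrite measure0. Qed.

Let mixture_ge0 A : 0 <= mixture A.
Proof. by apply: integral_ge0 => x _. Qed.

Let mixture_sigma_additive : semi_sigma_additive mixture.
Proof.
move=> F mF tF mUF.
rewrite [X in _ --> X](_ : _ = \int[nu]_x (\sum_(n <oo) k x (F n))); last first.
  apply: eq_integral => x _.
  by apply/esym/cvg_lim => //; exact: measure_semi_sigma_additive.
apply/cvg_closeP; split.
  by apply: is_cvg_nneseries => n _ _; exact: integral_ge0.
rewrite closeE// integral_nneseries// => n.
exact: measurable_kernel.
Qed.

HB.instance Definition _ := isMeasure.Build _ _ _ mixture
  mixture0 mixture_ge0 mixture_sigma_additive.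

Let mixtureT : mixture [set: Z] = 1.
Proof.
rewrite /mixture; under eq_integral do rewrite prob_kernel.
by rewrite integral_cst// mul1e; exact: probability_setT.
Qed.

HB.instance Definition _ := Measure_isProbability.Build _ _ _ mixture mixtureT.

Lemma ge0_integral_mixture (f : Z -> \bar R) : measurable_fun setT f ->
  (forall z, 0 <= f z) ->
  \int[mixture]_z f z = \int[nu]_x \int[k x]_z f z.
Proof.
have mk g : measurable_fun setT g -> (forall z, 0 <= g z) ->
    measurable_fun setT (fun x => \int[k x]_z g z).
  by move=> mg g0; apply: measurable_fun_integral_kernel => // U; exact: measurable_kernel.
have i0 g x : (forall z, 0 <= g z) -> 0 <= \int[k x]_z g z.
  by move=> g0; exact: integral_ge0.
move: f; apply: (ge0_measurable_ind (Q := fun f =>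
  \int[mixture]_z f z = \int[nu]_x \int[k x]_z f z))
  => [A mA|a f a0 mf f0 fE|f g mf f0 mg g0 fE gE|u f mu u0 nu_ uf uE].
- rewrite integral_indic// setIT; apply: eq_integral => x _.
  by rewrite integral_indic// setIT.
- have mf' := mk f mf f0.
  transitivity (\int[nu]_x (a%:E * \int[k x]_z f z)).
    rewrite [RHS]ge0_integralZl//; last by move=> x _; exact: i0.
    by rewrite -fE [LHS]ge0_integralZl.
  by apply: eq_integral => x _; rewrite [RHS]ge0_integralZl.
- have mf' := mk f mf f0; have mg' := mk g mg g0.
  transitivity (\int[nu]_x (\int[k x]_z f z + \int[k x]_z g z)).
    rewrite [RHS]ge0_integralD//; try by move=> x _; exact: i0.
    by rewrite -fE -gE [LHS]ge0_integralD.
  by apply: eq_integral => x _; rewrite [RHS]ge0_integralD.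
- have fl z : f z = limn (u ^~ z) by apply/esym/cvg_lim.
  under eq_integral do rewrite fl.
  rewrite monotone_convergence//.
  under eq_fun do rewrite uE.
  rewrite -monotone_convergence//; first last.
  - by move=> x _ m n mn; apply: ge0_le_integral => // z _; exact: nu_.
  - by move=> n x _; exact: integral_ge0.
  - by move=> n; exact: mk.
  apply: eq_integral => x _.
  rewrite -monotone_convergence//.
  by apply: eq_integral => z _; rewrite fl.
Qed.

End path_law.

Section kernel_functionals.
Context {R : realType} {d1 d2 : measure_display} {Z : measurableType d1}
  {S : measurableType d2}.
Local Open Scope ereal_scope.

(** Two mixtures of kernels with densities that agree on sets agree on functions. With
    Dirac kernels and transition kernels this passes the Markov property from
    events to functions. *)
Lemma eq_kernel_functional (m : {measure set Z -> \bar R})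
    (rho1 rho2 : Z -> R) (k1 k2 : Z -> {measure set S -> \bar R}) :
  measurable_fun setT rho1 -> (forall z, 0 <= rho1 z)%R ->
  measurable_fun setT rho2 -> (forall z, 0 <= rho2 z)%R ->
  (forall B, measurable B -> measurable_fun setT (k1 ^~ B)) ->
  (forall B, measurable B -> measurable_fun setT (k2 ^~ B)) ->
  (forall B, measurable B ->
     \int[m]_z ((rho1 z)%:E * k1 z B) = \int[m]_z ((rho2 z)%:E * k2 z B)) ->
  forall g : S -> \bar R, measurable_fun setT g -> (forall x, 0 <= g x) ->
  \int[m]_z ((rho1 z)%:E * \int[k1 z]_x g x) = \int[m]_z ((rho2 z)%:E * \int[k2 z]_x g x).
Proof.
move=> mr1 r10 mr2 r20 mk1 mk2 E.
have i0 (k : Z -> {measure set S -> \bar R}) (g : S -> \bar R) z :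
    (forall x, 0 <= g x) -> 0 <= \int[k z]_x g x.
  by move=> g0; exact: integral_ge0.
have ri0 (r : Z -> R) (k : Z -> {measure set S -> \bar R}) (g : S -> \bar R) z :
    (forall z, 0 <= r z)%R -> (forall x, 0 <= g x) -> 0 <= (r z)%:E * \int[k z]_x g x.
  by move=> r0 g0; rewrite mule_ge0 ?lee_fin// i0.
have mk (r : Z -> R) (k : Z -> {measure set S -> \bar R}) (g : S -> \bar R) :
    measurable_fun setT r ->
    (forall B, measurable B -> measurable_fun setT (k ^~ B)) ->
    measurable_fun setT g -> (forall x, 0 <= g x) ->
    measurable_fun setT (fun z => (r z)%:E * \int[k z]_x g x).
  move=> mr mk mg g0; apply: emeasurable_funM; first exact/measurable_EFinP.
  exact: measurable_fun_integral_kernel.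
apply: (ge0_measurable_ind (Q := fun g =>
  \int[m]_z ((rho1 z)%:E * \int[k1 z]_x g x) = \int[m]_z ((rho2 z)%:E * \int[k2 z]_x g x)))
  => [A mA|a f a0 mf f0 fE|f g mf f0 mg g0 fE gE|u f mu u0 nu_ uf uE].
- have I (k : Z -> {measure set S -> \bar R}) z :
    \int[k z]_x (\1_A x)%:E = k z A by rewrite integral_indic// setIT.
  by under eq_integral do rewrite I; under [RHS]eq_integral do rewrite I; exact: E.
- have H (r : Z -> R) (k : Z -> {measure set S -> \bar R}) :
      measurable_fun setT r -> (forall z, 0 <= r z)%R ->
      (forall B, measurable B -> measurable_fun setT (k ^~ B)) ->
      \int[m]_z ((r z)%:E * \int[k z]_x (a%:E * f x)) =
      a%:E * \int[m]_z ((r z)%:E * \int[k z]_x f x).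
    move=> mr r0 mk_; rewrite -[RHS]ge0_integralZl//; first last.
    - by move=> z _; exact: ri0.
    - exact: mk.
    by apply: eq_integral => z _; rewrite ge0_integralZl// muleCA.
  by rewrite (H _ k1 mr1 r10 mk1) (H _ k2 mr2 r20 mk2) fE.
- have H (r : Z -> R) (k : Z -> {measure set S -> \bar R}) :
      measurable_fun setT r -> (forall z, 0 <= r z)%R ->
      (forall B, measurable B -> measurable_fun setT (k ^~ B)) ->
      \int[m]_z ((r z)%:E * \int[k z]_x (f x + g x)) =
      \int[m]_z ((r z)%:E * \int[k z]_x f x) + \int[m]_z ((r z)%:E * \int[k z]_x g x).
    move=> mr r0 mk_; rewrite -[RHS]ge0_integralD//; first last.
    - exact: mk.
    - by move=> z _; exact: ri0.
    - exact: mk.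
    - by move=> z _; exact: ri0.
    by apply: eq_integral => z _; rewrite ge0_integralD// ge0_muleDr// i0.
  by rewrite (H _ k1 mr1 r10 mk1) (H _ k2 mr2 r20 mk2) fE gE.
- have H (r : Z -> R) (k : Z -> {measure set S -> \bar R}) :
      measurable_fun setT r -> (forall z, 0 <= r z)%R ->
      (forall B, measurable B -> measurable_fun setT (k ^~ B)) ->
      \int[m]_z ((r z)%:E * \int[k z]_x f x) =
      limn (fun n => \int[m]_z ((r z)%:E * \int[k z]_x u n x)).
    move=> mr r0 mk_; rewrite -monotone_convergence//; first last.
    - move=> z _ n1 n2 n12; apply: lee_wpmul2l; first by rewrite lee_fin.
      by apply: ge0_le_integral => // x _; exact: nu_.
    - by move=> n z _; exact: ri0.
    - by move=> n; exact: mk.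
    apply: eq_integral => z _; apply/esym/cvg_lim => //.
    have nd : {homo (fun n => \int[k z]_x u n x) : n1 n2 / (n1 <= n2)%N >-> n1 <= n2}.
      by move=> n1 n2 n12; apply: ge0_le_integral => // x _; exact: nu_.
    have -> : \int[k z]_x f x = limn (fun n => \int[k z]_x u n x).
      rewrite -monotone_convergence//.
      by apply: eq_integral => x _; apply/esym/cvg_lim.
    have cv := ereal_nondecreasing_is_cvgn nd.
    exact: cvgeZl.
  rewrite (H _ k1 mr1 r10 mk1) (H _ k2 mr2 r20 mk2).
  have /funext -> // : (fun n => \int[m]_z ((rho1 z)%:E * \int[k1 z]_x u n x)) =1
     (fun n => \int[m]_z ((rho2 z)%:E * \int[k2 z]_x u n x)).
  by move=> n; exact: uE.
Qed.

End kernel_functionals.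

(** * The semigroup of a Markov process *)

Section push.
Context {R : realType} {d1 d2 : measure_display} {T1 : measurableType d1}
  {T2 : measurableType d2}.

(** The image measure packed with its measure structure, so that equality of
    measures can be used for it. *)
Definition push (m : {measure set T1 -> \bar R}) (f : T1 -> T2)
    (mf : measurable_fun setT f) : {measure set T2 -> \bar R} :=
  measure_function_pushforward__canonical__measure_function_Measure m mf.

Lemma Rint_push (m : {measure set T1 -> \bar R}) (P : probability T2 R)
    (f : T1 -> T2) (mf : measurable_fun setT f) (g : T2 -> R) :
  (forall B, measurable B -> m (f @^-1` B) = P B) ->
  measurable_fun setT g -> m.-integrable setT (EFin \o (g \o f)) ->
  \int[m]_x g (f x) = \int[P]_y g y.
Proof.
move=> mP mg ig; rewrite /Rintegral; congr fine.
have mg' : measurable_fun setT (EFin \o g) by exact/measurable_EFinP.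
transitivity (\int[push m mf]_y (g y)%:E)%E.
  exact/esym/(integral_pushforward mf mg' ig measurableT).
by apply: eq_measure_integral => A mA _; exact: mP.
Qed.

End push.

Section semigroup.
Context {R : realType} {d : measure_display} {S : measurableType d}.
Variable Y : markov_process R S.
Local Notation Om := (Defs.path Y).
Implicit Types f g : S -> R.

(** Freezing the path before time 0 extends the evaluation map, which is known to
    be measurable for nonnegative times, to a measurable map on the whole product. *)
Definition trajp (r : R) (w : Om) : S := traj Y (Num.max r 0) w.

Lemma trajpE r w : 0 <= r -> trajp r w = traj Y r w.
Proof. by move=> r0; rewrite /trajp max_l. Qed.

Lemma measurable_trajp :
  measurable_fun setT (fun p : R * Om => trajp p.1 p.2).
Proof.
pose g (p : R * Om) := (Num.max p.1 0, p.2).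
have mD : measurable (`[0 : R, +oo[%classic `*` [set: Om]).
  by apply: measurableX.
apply: (@measurable_comp _ _ _ _ _ _ _ (fun p : R * Om => traj Y p.1 p.2) setT g mD).
- by move=> _ [p _ <-] /=; split => //=; rewrite in_itv/= andbT le_max lexx orbT.
- exact: traj_measurable.
- apply: measurable_fun_pair => //.
  by apply: measurable_maxr => //; exact: measurable_cst.
Qed.

Lemma measurable_trajp1 r : measurable_fun setT (trajp r).
Proof.
exact: (measurable_fun_pair2 r measurable_trajp).
Qed.

Lemma measurable_traj r : 0 <= r -> measurable_fun setT (traj Y r).
Proof.
move=> r0; have := measurable_trajp1 r.
by rewrite (_ : trajp r = traj Y r)//; apply/funext => w; rewrite trajpE.
Qed.

Lemma bmeas_traj r f : 0 <= r -> bmeas f -> bmeas (fun w => f (traj Y r w)).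
Proof. by move=> r0 bf; apply: bmeas_comp => //; exact: measurable_traj. Qed.

Lemma bmeas_trajp f : bmeas f -> bmeas (fun p : R * Om => f (trajp p.1 p.2)).
Proof. by move=> bf; apply: bmeas_comp bf; exact: measurable_trajp. Qed.

Lemma law_finite x : (law Y x setT < +oo)%E.
Proof. by rewrite prob_kernel ltry. Qed.

Lemma int_law x (phi : Om -> R) : bmeas phi ->
  (law Y x).-integrable setT (EFin \o phi).
Proof. by move=> bphi; apply: bmeas_integrable => //; exact: law_finite. Qed.

Lemma Rint_law_cst x (c : R) : \int[law Y x]_w c = c.
Proof. by rewrite Rintegral_cst// prob_kernel mulr1. Qed.

(** The semigroup as a function of time and space together, for Fubini. *)
Definition evolution f (p : R * S) : R := \int[law Y p.2]_w f (trajp p.1 w).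

Lemma bmeas_evolution f : bmeas f -> bmeas (evolution f).
Proof.
move=> bf; have [mf [M fM]] := bf.
have b1 r : bmeas (fun w => f (trajp r w)).
  by apply: bmeas_comp bf; exact: measurable_trajp1.
split; last first.
  exists M => p; rewrite -[M]mulr1.
  have -> : 1 = fine (law Y p.2 setT) :> R by rewrite prob_kernel.
  by apply: bmeas_le => //; [exact: law_finite|have [] := b1 p.1].
pose G (z : (R * S) * Om) : \bar R := (f (trajp z.1.1 z.2) + M)%:E.
have G0 z : (0 <= G z)%E.
  rewrite lee_fin -lerBlDr sub0r.
  by have := fM (trajp z.1.1 z.2); rewrite ler_norml => /andP[].
have mG : measurable_fun setT G.
  apply/measurable_EFinP; apply: measurable_funD => //.
  apply: measurableT_comp => //.
  apply: (measurableT_comp measurable_trajp (g := fun z : R * S * Om => (z.1.1, z.2))).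
  apply: measurable_fun_pair => //.
  exact: measurableT_comp.
have -> : evolution f = (fun p => fine (\int[ksnd (law Y) p]_w G (p, w))%E - M).
  apply/funext => p; rewrite /evolution.
  have -> : fine (\int[ksnd (law Y) p]_w G (p, w))%E =
     \int[law Y p.2]_w (f (trajp p.1 w) + M) by [].
  rewrite RintegralD//; [|exact: int_law|exact/int_law/bmeas_cst].
  by rewrite Rint_law_cst addrK.
apply: measurable_funB => //; apply: measurableT_comp => //.
exact: measurable_fun_integral_finite_kernel.
Qed.

Lemma evolutionE f r x : 0 <= r -> evolution f (r, x) = semigroup Y r f x.
Proof.
by move=> r0; apply: eq_Rintegral => w _; rewrite trajpE.
Qed.

Lemma bmeas_semigroup r f : 0 <= r -> bmeas f -> bmeas (semigroup Y r f).
Proof.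
move=> r0 bf; rewrite (_ : semigroup Y r f = (fun x => evolution f (r, x))).
  apply: (bmeas_comp (phi := fun x => (r, x))); last exact: bmeas_evolution.
  exact: measurable_pair1.
by apply/funext => x; rewrite evolutionE.
Qed.

Lemma semigroupDcst r f c x : 0 <= r -> bmeas f ->
  semigroup Y r (fun y => f y + c) x = semigroup Y r f x + c.
Proof.
move=> r0 bf; rewrite /semigroup RintegralD//.
- by rewrite Rint_law_cst.
- exact/int_law/bmeas_traj.
- exact/int_law/bmeas_cst.
Qed.

Lemma semigroupB r f g x : 0 <= r -> bmeas f -> bmeas g ->
  semigroup Y r (fun y => f y - g y) x = semigroup Y r f x - semigroup Y r g x.
Proof.
by move=> r0 bf bg; rewrite /semigroup RintegralB//; exact/int_law/bmeas_traj.
Qed.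

Lemma semigroup0 f x : bmeas f -> semigroup Y 0 f x = f x.
Proof.
move=> bf; have [mf _] := bf; have m0 := measurable_traj (lexx 0).
rewrite /semigroup /Rintegral.
have -> : (\int[law Y x]_w (f (traj Y 0 w))%:E = \int[push (law Y x) m0]_y (f y)%:E)%E.
  have mf' : measurable_fun setT (EFin \o f) by exact/measurable_EFinP.
  apply/esym/(integral_pushforward m0 mf' _ measurableT).
  exact/int_law/bmeas_traj.
have -> : (\int[push (law Y x) m0]_y (f y)%:E = \int[\d_x]_y (f y)%:E)%E.
  apply: eq_measure_integral => A mA _; exact: law_initial.
rewrite integral_dirac//; last exact/measurable_EFinP.
by rewrite diracT mul1e.
Qed.

Section markov.
Variables (s t : R) (x : S).
Hypotheses (s0 : 0 <= s) (t0 : 0 <= t).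
Let st0 : 0 <= s + t. Proof. exact: addr_ge0. Qed.

Let Tfin g y : bmeas g ->
  (\int[law Y y]_w (g (traj Y t w))%:E = (semigroup Y t g y)%:E)%E.
Proof.
move=> bg; rewrite /semigroup /Rintegral fineK//.
by apply: integrable_fin_num => //; exact/int_law/bmeas_traj.
Qed.

Let meas_dirac r (r0 : 0 <= r) B : measurable B ->
  measurable_fun setT (fun w => \d_(traj Y r w) B : \bar R).
Proof.
move=> mB; have /= := measurableT_comp (measurable_fun_dirac mB) (measurable_traj r0).
exact.
Qed.

(** The Markov property compares, on the event that the path is in B0 at time s, the
    conditional law at time s + t with the transition law started from the
    position at time s. *)
Let markov_indic B0 g : measurable B0 -> bmeas g -> (forall y, 0 <= g y) ->
  (\int[law Y x]_w ((\1_B0 (traj Y s w))%:E * (g (traj Y (s + t) w))%:E) =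
   \int[law Y x]_w ((\1_B0 (traj Y s w))%:E * (semigroup Y t g (traj Y s w))%:E))%E.
Proof.
move=> mB0 bg g0; have [mg _] := bg; have mt := measurable_traj t0.
have ms := measurable_traj s0.
set A := traj Y s @^-1` B0.
have mA : measurable A by rewrite -[A]setTI; exact: ms.
pose k1 (w : Om) : {measure set S -> \bar R} := \d_(traj Y (s + t) w).
pose k2 (w : Om) : {measure set S -> \bar R} := push (law Y (traj Y s w)) mt.
have := @eq_kernel_functional R _ _ Om S (law Y x) (\1_A) (\1_A) k1 k2.
have mI : measurable_fun setT (\1_A : Om -> R) by exact: measurable_indic.
have I0 w : 0 <= (\1_A w : R) by [].
have mk1 B : measurable B -> measurable_fun setT (k1 ^~ B).
  by move=> mB; exact: meas_dirac.
have mk2 B : measurable B -> measurable_fun setT (k2 ^~ B).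
  move=> mB; apply: (measurableT_comp 
    (measurable_kernel (law Y) (traj Y t @^-1` B) _)) => //.
  by rewrite -[X in measurable X]setTI; exact: measurable_traj.
move=> /(_ mI I0 mI I0 mk1 mk2).
have E B : measurable B -> (\int[law Y x]_w ((\1_A w)%:E * k1 w B) =
    \int[law Y x]_w ((\1_A w)%:E * k2 w B))%E.
  move=> mB.
  have mB' : measurable (traj Y (s + t) @^-1` B).
    by rewrite -[X in measurable X]setTI; exact: measurable_traj.
  have := @law_markov _ _ _ Y x s t A B s0 t0 mB.
  have FA : <<s [set E | exists2 u : R, 0 <= u <= s &
           exists2 B' : set S, measurable B' & E = traj Y u @^-1` B'] >> A.
    by apply: sub_sigma_algebra; exists s; [rewrite s0 lexx|exists B0].
  move=> /(_ FA) H.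
  transitivity (law Y x (A `&` traj Y (s + t) @^-1` B)).
    rewrite -[in RHS](setIT (_ `&` _)) -integral_indic//; last exact: measurableI.
    apply: eq_integral => w _.
    have -> : k1 w B = (\1_(traj Y (s + t) @^-1` B) w)%:E.
      by rewrite indicE; exact: diracE.
    by rewrite -EFinM indicI.
  rewrite H integral_mkcond; apply: eq_integral => w _.
  rewrite patchE indicE; case: ifP => _; first by rewrite mul1e.
  by rewrite mul0e.
move=> /(_ E (EFin \o g)) H.
transitivity (\int[law Y x]_w ((\1_A w)%:E * \int[k1 w]_y (g y)%:E))%E.
  apply: eq_integral => w _; rewrite integral_dirac//; last exact/measurable_EFinP.
  by rewrite diracT mul1e.
rewrite H//; last exact/measurable_EFinP.
apply: eq_integral => w _; congr (_ * _)%E.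
rewrite ge0_integral_pushforward//; last 2 first.
- exact/measurable_EFinP.
- by move=> y _; rewrite /= lee_fin.
exact: Tfin.
Qed.

Let markov_ge0 f g : bmeas f -> (forall y, 0 <= f y) ->
  bmeas g -> (forall y, 0 <= g y) ->
  \int[law Y x]_w (f (traj Y s w) * g (traj Y (s + t) w)) =
  \int[law Y x]_w (f (traj Y s w) * semigroup Y t g (traj Y s w)).
Proof.
move=> bf f0 bg g0; have [mf _] := bf; have ms := measurable_traj s0.
pose k (w : Om) : {measure set S -> \bar R} := \d_(traj Y s w).
have b1 := bmeas_traj st0 bg; have b2 := bmeas_traj s0 (bmeas_semigroup t0 bg).
have T0 y : 0 <= semigroup Y t g y by apply: Rintegral_ge0.
have := @eq_kernel_functional R _ _ Om S (law Y x) _ _ k k b1.1 _ b2.1 _.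
have mk B : measurable B -> measurable_fun setT (k ^~ B).
  by move=> mB; exact: meas_dirac.
move=> /(_ (fun=> g0 _) (fun=> T0 _) mk mk).
have E B : measurable B ->
   (\int[law Y x]_w ((g (traj Y (s + t) w))%:E * k w B) =
    \int[law Y x]_w ((semigroup Y t g (traj Y s w))%:E * k w B))%E.
  move=> mB; have := markov_indic mB bg g0.
  have kE w : k w B = (\1_B (traj Y s w))%:E by rewrite indicE; exact: diracE.
  under eq_integral do rewrite muleC -kE.
  by under [in RHS]eq_integral do rewrite muleC -kE.
move=> /(_ E (EFin \o f)) H; rewrite /Rintegral; congr fine.
have kf w : (\int[k w]_y (f y)%:E = (f (traj Y s w))%:E)%E.
  rewrite integral_dirac//; last exact/measurable_EFinP.
  by rewrite diracT mul1e.
under eq_integral do rewrite mulrC EFinM -kf.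
under [RHS]eq_integral do rewrite mulrC EFinM -kf.
by apply: H => //; exact/measurable_EFinP.
Qed.

Let markov_right g : bmeas g -> \int[law Y x]_w g (traj Y (s + t) w) =
  \int[law Y x]_w semigroup Y t g (traj Y s w).
Proof.
move=> bg; have [mg [N gN]] := bg.
have g'0 y : 0 <= g y + N.
  by rewrite -lerBlDr sub0r; have := gN y; rewrite ler_norml => /andP[].
have bg' : bmeas (fun y => g y + N) by apply: bmeasD => //; exact: bmeas_cst.
have := markov_ge0 (bmeas_cst 1) (fun=> ler01) bg' g'0.
under eq_Rintegral do rewrite mul1r.
under [X in _ = X -> _]eq_Rintegral do rewrite mul1r semigroupDcst//.
have i1 := int_law x (bmeas_traj st0 bg).
have i2 := int_law x (bmeas_traj s0 (bmeas_semigroup t0 bg)).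
have iN := int_law x (bmeas_cst N).
rewrite !RintegralD// => /addIr.
exact.
Qed.

(** Both sides are bilinear in f and g, so that bounded functions reduce to
    nonnegative ones by the addition of constants. *)
Lemma markov_bmeas f g : bmeas f -> bmeas g ->
  \int[law Y x]_w (f (traj Y s w) * g (traj Y (s + t) w)) =
  \int[law Y x]_w (f (traj Y s w) * semigroup Y t g (traj Y s w)).
Proof.
move=> bf bg; have [mf [M fM]] := bf; have [mg [N gN]] := bg.
have f'0 y : 0 <= f y + M.
  by rewrite -lerBlDr sub0r; have := fM y; rewrite ler_norml => /andP[].
have g'0 y : 0 <= g y + N.
  by rewrite -lerBlDr sub0r; have := gN y; rewrite ler_norml => /andP[].
have bf' : bmeas (fun y => f y + M) by apply: bmeasD => //; exact: bmeas_cst.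
have bg' : bmeas (fun y => g y + N) by apply: bmeasD => //; exact: bmeas_cst.
have h := markov_ge0 bf' f'0 bg' g'0.
have h1 := markov_right bg.
have bfs := bmeas_traj s0 bf.
have expand (u : Om -> R) : bmeas u ->
    \int[law Y x]_w ((f (traj Y s w) + M) * (u w + N)) =
    \int[law Y x]_w (f (traj Y s w) * u w) + N * \int[law Y x]_w f (traj Y s w)
    + (M * \int[law Y x]_w u w + M * N).
  move=> bu.
  transitivity (\int[law Y x]_w ((f (traj Y s w) * u w + N * f (traj Y s w))
     + (M * u w + M * N))); first by apply: eq_Rintegral => w _; ring.
  have i1 := int_law x (bmeasM bfs bu).
  have i2 := int_law x (bmeasM (bmeas_cst N) bfs).
  have i3 := int_law x (bmeasM (bmeas_cst M) bu).
  have i4 := int_law x (bmeas_cst (M * N)).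
  rewrite RintegralD//; last 2 first.
  - exact/int_law/(bmeasD (bmeasM bfs bu) (bmeasM (bmeas_cst N) bfs)).
  - exact/int_law/(bmeasD (bmeasM (bmeas_cst M) bu) (bmeas_cst (M * N))).
  rewrite !RintegralD// Rint_law_cst !RintegralZl//; exact: int_law.
have b1 := bmeas_traj st0 bg; have b2 := bmeas_traj s0 (bmeas_semigroup t0 bg).
move: h; under [X in _ = X -> _]eq_Rintegral do rewrite semigroupDcst//.
rewrite expand// expand// h1 => /addIr /addIr.
exact.
Qed.

End markov.

(** Chapman-Kolmogorov. *)
Lemma semigroupD s t f x : 0 <= s -> 0 <= t -> bmeas f ->
  semigroup Y (s + t) f x = semigroup Y s (semigroup Y t f) x.
Proof.
move=> s0 t0 bf; have := markov_bmeas x s0 t0 (bmeas_cst 1) bf.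
under eq_Rintegral do rewrite mul1r.
by under [X in _ = X -> _]eq_Rintegral do rewrite mul1r.
Qed.

End semigroup.

(** * Integrals over time *)

Section jensen.
Context {R : realType} {d : measure_display} {T : measurableType d}.

(** Cauchy-Schwarz against the constant 1: the discriminant of the nonnegative
    polynomial in k that is the integral of (k f - I)^2, at k equal to the mass. *)
Lemma Rint_sqr_le_integrable (mu : {measure set T -> \bar R}) (D : set T)
    (f : T -> R) :
  measurable D -> (mu D < +oo)%E -> mu.-integrable D (EFin \o f) ->
  mu.-integrable D (EFin \o (fun x => f x ^+ 2)) ->
  (\int[mu]_(x in D) f x) ^+ 2 <= fine (mu D) * \int[mu]_(x in D) (f x ^+ 2).
Proof.
move=> mD muD I1 I2; set m := fine (mu D); set I := \int[mu]_(x in D) f x.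
set J := \int[mu]_(x in D) (f x ^+ 2).
have Ic c : mu.-integrable D (EFin \o (fun=> c)).
  exact: (bmeas_integrable mD muD (bmeas_cst c)).
have m0 : 0 <= m by rewrite fine_ge0.
have h k : 0 <= k ^+ 2 * J - 2 * k * I * I + I ^+ 2 * m.
  have -> : k ^+ 2 * J - 2 * k * I * I + I ^+ 2 * m =
     \int[mu]_(x in D) ((k * f x - I) ^+ 2).
    transitivity (\int[mu]_(x in D) (k ^+ 2 * f x ^+ 2 + (- (2 * k * I) * f x + I ^+ 2))).
      have J1 : mu.-integrable D (EFin \o (fun x => k ^+ 2 * f x ^+ 2)).
        by have := integrableZl mD (k ^+ 2) I2.
      have J2 : mu.-integrable D (EFin \o (fun x => - (2 * k * I) * f x)).
        by have := integrableZl mD (- (2 * k * I)) I1.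
      have J3 : mu.-integrable D (EFin \o (fun x => - (2 * k * I) * f x + I ^+ 2)).
        by have := integrableD mD J2 (Ic (I ^+ 2)).
      rewrite (RintegralD mD J1 J3) (RintegralD mD J2 (Ic _)).
      rewrite (RintegralZl _ mD I2) (RintegralZl _ mD I1) Rintegral_cst// -/m -/I -/J.
      ring.
    by apply: eq_Rintegral => x _; ring.
  by apply: Rintegral_ge0 => x _; exact: sqr_ge0.
have [m00|mn0] := eqVneq m 0.
  have /eqP : mu D = 0%E.
    by move: m00; rewrite /m => h'; rewrite -[LHS]fineK ?ge0_fin_numE// h'.
  move=> /eqP mD0.
  rewrite m00 mul0r.
  have -> : I = 0.
    rewrite /I /Rintegral null_set_integral//.
    exact: measurable_int I1.
  by rewrite expr0n.
have mp : 0 < m by rewrite lt_def mn0.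
have := h m.
rewrite (_ : _ + _ = m * (m * J - I ^+ 2)); last by ring.
by rewrite pmulr_rge0// subr_ge0.
Qed.

Lemma Rint_sqr_le (mu : {measure set T -> \bar R}) (D : set T) (f : T -> R) :
  measurable D -> (mu D < +oo)%E -> bmeas f ->
  (\int[mu]_(x in D) f x) ^+ 2 <= fine (mu D) * \int[mu]_(x in D) (f x ^+ 2).
Proof.
move=> mD muD bf; apply: Rint_sqr_le_integrable => //.
  exact: bmeas_integrable.
exact: (bmeas_integrable mD muD (bmeasX bf)).
Qed.

End jensen.

Section triangle.
Context {R : realType}.
Local Notation mu := (@lebesgue_measure R).

Lemma bmeas_itv_int (a b : R) (f : R -> R) : bmeas f ->
  mu.-integrable `[a, b] (EFin \o f).
Proof. by move=> bf; apply: bmeas_integrable => //; exact: lebesgue_itvy. Qed.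

Lemma Rint_itv_split (a c b : R) (f : R -> R) : a <= c -> c <= b -> bmeas f ->
  \int[mu]_(r in `[a, b]) f r =
  \int[mu]_(r in `[a, c]) f r + \int[mu]_(r in `[c, b]) f r.
Proof.
move=> ac cb bf.
have h := @Rintegral_itvB R f (BLeft a) (BRight b) c (bmeas_itv_int _ _ bf).
have := h _ _; rewrite !bnd_simp => /(_ ac cb).
rewrite Rintegral_itv_obnd_cbnd; last first.
  apply: integrableS (bmeas_itv_int c b bf) => //.
  by apply: subset_itvr; rewrite bnd_simp.
by move=> <-; rewrite subrKC.
Qed.

Section half_square.
Variable e : R * R -> R.
Hypothesis be : bmeas e.

(** The restriction of e to the half r <= s of the plane. It turns iterated
    integrals over a triangle into integrals over a square. *)
Definition below (p : R * R) : R := \1_[set p : R * R | p.1 <= p.2] p * e p.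

Lemma bmeas_below : bmeas below.
Proof.
apply: bmeasM be; apply: bmeas_indic.
have := measurable_fun_ler (@measurable_fst _ _ R R) (@measurable_snd _ _ R R).
by move=> /(_ measurableT [set true] Logic.I); rewrite setTI.
Qed.

Lemma below_le r s : r <= s -> below (r, s) = e (r, s).
Proof. by move=> rs; rewrite /below indicE mem_set ?mul1r. Qed.

Lemma below_gt r s : s < r -> below (r, s) = 0.
Proof. by move=> sr; rewrite /below indicE memNset ?mul0r//= leNgt sr. Qed.

Lemma Rint_below (t s : R) : 0 <= s <= t ->
  \int[mu]_(r in `[0, t]) below (r, s) = \int[mu]_(r in `[0, s]) e (r, s).
Proof.
move=> /andP[s0 st].
have bs : bmeas (fun r => below (r, s)).
  by apply: (bmeas_comp (phi := fun r => (r, s))) bmeas_below; exact: measurable_pair2.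
rewrite (Rint_itv_split s0 st)//.
have -> : \int[mu]_(r in `[0, s]) below (r, s) = \int[mu]_(r in `[0, s]) e (r, s).
  apply: eq_Rintegral => r; rewrite inE/= in_itv/= => /andP[_ rs].
  exact: below_le.
rewrite -[RHS]addr0; congr (_ + _).
rewrite -Rintegral_itv_obnd_cbnd.
  have -> : \int[mu]_(r in `]s, t]) below (r, s) = \int[mu]_(r in `]s, t]) 0.
    apply: eq_Rintegral => r; rewrite inE/= in_itv/= => /andP[sr _].
    exact: below_gt.
  by rewrite Rintegral_cst// mul0r.
apply: integrableS (bmeas_itv_int s t bs) => //.
by apply: subset_itvr; rewrite bnd_simp.
Qed.

Lemma Rint_above (t s : R) : 0 <= s <= t ->
  \int[mu]_(r in `[0, t]) below (s, r) = \int[mu]_(r in `[s, t]) e (s, r).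
Proof.
move=> /andP[s0 st].
have bs : bmeas (fun r => below (s, r)).
  by apply: (bmeas_comp (phi := fun r => (s, r))) bmeas_below; exact: measurable_pair1.
rewrite (Rint_itv_split s0 st)// -[RHS]add0r; congr (_ + _).
  rewrite -Rintegral_itv_bndo_bndc.
    have -> : \int[mu]_(r in `[0, s[) below (s, r) = \int[mu]_(r in `[0, s[) 0.
      apply: eq_Rintegral => r; rewrite inE/= in_itv/= => /andP[_ rs].
      exact: below_gt.
    by rewrite Rintegral_cst// mul0r.
  apply: integrableS (bmeas_itv_int 0 s bs) => //.
  by apply: subset_itvl; rewrite bnd_simp.
apply: eq_Rintegral => r; rewrite inE/= in_itv/= => /andP[sr _].
exact: below_le.
Qed.

Lemma integrable_triangle (t : R) :
  mu.-integrable `[0, t] (EFin \o (fun s => \int[mu]_(r in `[0, s]) e (r, s))).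
Proof.
have bb : bmeas (fun p : R * R => below (p.2, p.1)).
  by apply: bmeas_comp bmeas_below; exact: measurable_fun_pair.
have bI := bmeas_Rint2 (m2 := mu) _ (lebesgue_itvy 0 t) bb.
apply: eq_integrable (bmeas_itv_int 0 t (bI _)) => // s.
by rewrite inE/= in_itv/= => hs; rewrite /= Rint_below.
Qed.

End half_square.

(** A symmetric kernel has the same integral over both halves of a square. *)
Lemma Rint_triangle (t : R) (e : R * R -> R) : 0 <= t -> bmeas e ->
  (forall r s, 0 <= r -> 0 <= s -> e (r, s) = e (s, r)) ->
  \int[mu]_(s in `[0, t]) \int[mu]_(r in `[0, t]) e (r, s) =
  2 * \int[mu]_(s in `[0, t]) \int[mu]_(r in `[0, s]) e (r, s).
Proof.
move=> t0 be sym.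
have be' := bmeas_below be.
have mi : measurable (`[0, t] : set R) by [].
have bfl (f : R * R -> R) : bmeas f -> bmeas (fun p : R * R => f (p.2, p.1)).
  by move=> bf; apply: bmeas_comp bf; exact: measurable_fun_pair.
have I (f : R * R -> R) : bmeas f ->
    mu.-integrable `[0, t] (EFin \o (fun s => \int[mu]_(r in `[0, t]) f (r, s))).
  move=> bf; apply: bmeas_itv_int.
  exact: (bmeas_Rint2 (m2 := mu) mi (lebesgue_itvy 0 t) (bfl _ bf)).
have T1 : \int[mu]_(s in `[0, t]) \int[mu]_(r in `[0, s]) e (r, s) =
   \int[mu]_(s in `[0, t]) \int[mu]_(r in `[0, t]) below e (r, s).
  by apply: eq_Rintegral => s; rewrite inE/= in_itv/= => hs; rewrite Rint_below.
have T2 : \int[mu]_(s in `[0, t]) \int[mu]_(r in `[0, t]) below e (r, s) =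
   \int[mu]_(s in `[0, t]) \int[mu]_(r in `[0, t]) below e (s, r).
  exact: (bmeas_Fubini (m1 := mu) (m2 := mu) mi mi (lebesgue_itvy 0 t)
    (lebesgue_itvy 0 t) (bfl _ be')).
rewrite mulr_natl mulr2n {1}T1 T2 T1; clear T1 T2.
rewrite -(RintegralD _ (I _ (bfl _ be')) (I _ be'))//.
apply: eq_Rintegral => s; rewrite inE/= in_itv/= => hs.
rewrite (Rint_above be hs) (Rint_below be hs).
have bs : bmeas (fun r => e (r, s)).
  by apply: (bmeas_comp (phi := fun r => (r, s))) be; exact: measurable_pair2.
move: (hs) => /andP[s0 st]; rewrite (Rint_itv_split s0 st bs) addrC.
congr (_ + _); apply: eq_Rintegral => r; rewrite inE/= in_itv/= => /andP[sr _].
by apply: sym => //; exact: le_trans sr.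
Qed.

End triangle.

Section time_integrals.
Context {R : realType}.
Local Notation mu := (@lebesgue_measure R).

(** A translation is the composition of two reflections. *)
Lemma Rint_translate (h a b : R) (g : R -> R) : bmeas g ->
  \int[mu]_(r in `[a, b]) g (h + r) = \int[mu]_(r in `[h + a, h + b]) g r.
Proof.
move=> bg.
have bg' : bmeas (fun q : R => g (h - q)).
  by apply: (bmeas_comp (phi := fun q : R => h - q)) bg; exact: measurable_funB.
have := Rint_reflect 0 a b bg'.
rewrite !sub0r; under eq_Rintegral do rewrite sub0r opprK.
by move=> ->; rewrite (Rint_reflect h (- b) (- a) bg) !opprK.
Qed.

Lemma Rint_timeZl (k a b : R) (f : R -> R) : bmeas f ->
  \int[mu]_(r in `[a, b]) (k * f r) = k * \int[mu]_(r in `[a, b]) f r.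
Proof. by move=> bf; rewrite RintegralZl//; exact: bmeas_itv_int. Qed.

Lemma Rint_timeZr (k a b : R) (f : R -> R) : bmeas f ->
  \int[mu]_(r in `[a, b]) (f r * k) = \int[mu]_(r in `[a, b]) f r * k.
Proof. by move=> bf; rewrite RintegralZr//; exact: bmeas_itv_int. Qed.

Lemma Rint_time_le (a b : R) (f g : R -> R) :
  mu.-integrable `[a, b] (EFin \o f) -> mu.-integrable `[a, b] (EFin \o g) ->
  (forall r, a <= r <= b -> f r <= g r) ->
  \int[mu]_(r in `[a, b]) f r <= \int[mu]_(r in `[a, b]) g r.
Proof.
by move=> i1 i2 h; apply: (le_Rintegral _ i1 i2) => // r /=; rewrite in_itv/=; exact: h.
Qed.

Lemma Rint_timeD (a b : R) (f g : R -> R) :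
  mu.-integrable `[a, b] (EFin \o f) -> mu.-integrable `[a, b] (EFin \o g) ->
  mu.-integrable `[a, b] (EFin \o (fun r => f r + g r)) /\
  \int[mu]_(r in `[a, b]) (f r + g r) =
  \int[mu]_(r in `[a, b]) f r + \int[mu]_(r in `[a, b]) g r.
Proof.
move=> i1 i2; split; last by rewrite (RintegralD _ i1 i2).
by have := integrableD _ i1 i2; apply.
Qed.

Context {d : measure_display} {T : measurableType d}.

Lemma bmeas_time (a b : R) (F : R * T -> R) : bmeas F ->
  bmeas (fun x => \int[mu]_(r in `[a, b]) F (r, x)).
Proof.
move=> bF.
have bF' : bmeas (fun p : T * R => F (p.2, p.1)).
  by apply: bmeas_comp bF; exact: measurable_fun_pair.
exact: (bmeas_Rint2 _ (lebesgue_itvy a b) bF').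
Qed.

Lemma bmeas_fst (F : R * T -> R) x : bmeas F -> bmeas (fun r => F (r, x)).
Proof.
by move=> bF; apply: (bmeas_comp (phi := fun r => (r, x))) bF; exact: measurable_pair2.
Qed.

Lemma bmeas_snd (F : R * T -> R) r : bmeas F -> bmeas (fun x => F (r, x)).
Proof.
by move=> bF; apply: (bmeas_comp (phi := fun x => (r, x))) bF; exact: measurable_pair1.
Qed.

Variable P : probability T R.

Lemma prob_fin : (P setT < +oo)%E.
Proof. by rewrite (le_lt_trans (probability_le1 P measurableT))// ltry. Qed.

Lemma bmeas_space (F : R * T -> R) : bmeas F ->
  bmeas (fun r => \int[P]_x F (r, x)).
Proof. by move=> bF; exact: (bmeas_Rint2 _ prob_fin bF). Qed.

Lemma time_Fubini (a b : R) (F : R * T -> R) : bmeas F ->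
  \int[P]_x \int[mu]_(r in `[a, b]) F (r, x) =
  \int[mu]_(r in `[a, b]) \int[P]_x F (r, x).
Proof.
move=> bF.
have mi : measurable (`[a, b] : set R) by [].
by have := bmeas_Fubini (m1 := mu) (m2 := P) mi measurableT (lebesgue_itvy a b) prob_fin bF.
Qed.

Lemma prob_sqr_le (f : T -> R) : bmeas f ->
  (\int[P]_x f x) ^+ 2 <= \int[P]_x (f x ^+ 2).
Proof.
move=> bf; have := Rint_sqr_le measurableT prob_fin bf.
by have /(congr1 fine) /= -> := probability_setT P; rewrite mul1r.
Qed.

Lemma itv_length (a b : R) : a <= b -> fine (mu `[a, b]) = b - a.
Proof.
rewrite le_eqVlt => /predU1P[<-|ab]; rewrite lebesgue_measure_itv/= lte_fin.
  by rewrite ltxx subrr.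
by rewrite ab.
Qed.

Lemma time_sqr_le (a b : R) (f : R -> R) : a <= b -> bmeas f ->
  (\int[mu]_(r in `[a, b]) f r) ^+ 2 <=
  (b - a) * \int[mu]_(r in `[a, b]) (f r ^+ 2).
Proof.
move=> ab bf.
have mi : measurable (`[a, b] : set R) by [].
have := Rint_sqr_le (mu := mu) mi (lebesgue_itvy a b) bf.
by rewrite itv_length.
Qed.

Lemma time_le_cst (a b c : R) (f : R -> R) : a <= b -> bmeas f ->
  (forall r, a <= r <= b -> f r <= c) ->
  \int[mu]_(r in `[a, b]) f r <= (b - a) * c.
Proof.
move=> ab bf fc.
have E : \int[mu]_(r in `[a, b]) c = (b - a) * c.
  by rewrite Rintegral_cst// mulrC; congr (_ * _); exact: itv_length.
have i1 := bmeas_itv_int a b bf.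
have i2 := bmeas_itv_int a b (bmeas_cst c).
rewrite -E; exact: (le_Rintegral _ i1 i2).
Qed.

End time_integrals.

(** * The stationary process *)

Section fiber.
Context {d d' : measure_display} {S : measurableType d} {Z : measurableType d'}
  {R : realType}.
Variables (k : R.-pker S ~> Z) (x : S).

(** The law of the process started from x with its structure of probability
    measure, so that Fubini and Jensen apply to it. *)
Definition fiber : set Z -> \bar R := k x.
HB.instance Definition _ := Measure.on fiber.
Let fiberT : fiber [set: Z] = 1%E.
Proof. exact: prob_kernel. Qed.
HB.instance Definition _ := Measure_isProbability.Build _ _ _ fiber fiberT.

End fiber.

Arguments bmeas_traj {R d S Y r f}.
Arguments bmeas_semigroup {R d S Y r f}.
Arguments bmeas_evolution {R d S Y f}.
Arguments measurable_traj {R d S Y r}.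

Section stationary.
Context {R : realType} {d : measure_display} {S : measurableType d}.
Variables (Y : markov_process R S) (nu : probability S R).
Hypothesis inv : Defs.invariant nu Y.
Local Notation Om := (Defs.path Y).
Local Notation mu := (@lebesgue_measure R).
Implicit Types f g W : S -> R.

Definition plaw : probability Om R := mixture (law Y) nu.

Lemma bmeas_kernel_int (phi : Om -> R) : bmeas phi ->
  bmeas (fun x => \int[law Y x]_w phi w).
Proof.
move=> [mphi [M phiM]].
split; last first.
  exists M => x; rewrite -[M]mulr1.
  have -> : 1 = fine (law Y x setT) :> R by rewrite prob_kernel.
  by apply: bmeas_le => //; exact: law_finite.
have -> : (fun x => \int[law Y x]_w phi w) =
    (fun x => fine (\int[law Y x]_w (phi w + M)%:E)%E - M).
  apply/funext => x.
  have bphi : bmeas phi by split => //; exists M.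
  have -> : fine (\int[law Y x]_w (phi w + M)%:E)%E = \int[law Y x]_w (phi w + M) by [].
  rewrite RintegralD//; [|exact: int_law|exact/int_law/bmeas_cst].
  by rewrite Rint_law_cst addrK.
apply: measurable_funB => //; apply: measurableT_comp => //.
apply: measurable_fun_integral_kernel.
- by move=> U; exact: measurable_kernel.
- move=> w; rewrite lee_fin -lerBlDr sub0r.
  by have := phiM w; rewrite ler_norml => /andP[].
- by apply/measurable_EFinP; apply: measurable_funD.
Qed.

Lemma plawE (phi : Om -> R) : bmeas phi ->
  \int[plaw]_w phi w = \int[nu]_x \int[law Y x]_w phi w.
Proof.
move=> bphi; have [mphi [M phiM]] := bphi.
have p0 w : (0 <= (phi w + M)%:E)%E.
  rewrite lee_fin -lerBlDr sub0r.
  by have := phiM w; rewrite ler_norml => /andP[].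
have mp : measurable_fun setT (fun w => (phi w + M)%:E).
  by apply/measurable_EFinP; apply: measurable_funD.
have := ge0_integral_mixture (law Y) nu mp p0.
have E x : (\int[law Y x]_w (phi w + M)%:E = (\int[law Y x]_w phi w + M)%:E)%E.
  rewrite -[LHS]fineK; last first.
    apply: integrable_fin_num => //; apply: int_law.
    by apply: bmeasD => //; exact: bmeas_cst.
  congr (_%:E); transitivity (\int[law Y x]_w (phi w + M)); first by [].
  have i1 := int_law x bphi; have i2 := int_law (Y := Y) x (bmeas_cst M).
  by rewrite (RintegralD _ i1 i2)// Rint_law_cst.
under [X in _ = X -> _]eq_integral do rewrite E.
move=> /(congr1 fine) h.
have {h} : \int[plaw]_w (phi w + M) = \int[nu]_x (\int[law Y x]_w phi w + M).
  exact: h.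
rewrite RintegralD//; [|exact: bmeas_int|exact: integrableR_cst].
rewrite RintegralD//; [|exact/bmeas_int/bmeas_kernel_int|exact: integrableR_cst].
by rewrite !Rint_cst => /addIr.
Qed.

Lemma stationary t f : 0 <= t -> bmeas f ->
  \int[plaw]_w f (traj Y t w) = \int[nu]_x f x.
Proof.
move=> t0 bf; have [mf _] := bf.
apply: (Rint_push (measurable_traj t0)) => //.
- by move=> B mB; exact: inv.
- exact/bmeas_int/bmeas_traj.
Qed.

(** Stationarity and the Markov property: time correlations depend on the
    lag only. *)
Lemma correlation s t f g : 0 <= s -> 0 <= t -> bmeas f -> bmeas g ->
  \int[plaw]_w (f (traj Y s w) * g (traj Y (s + t) w)) =
  \int[nu]_x (f x * semigroup Y t g x).
Proof.
move=> s0 t0 bf bg.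
have st0 : 0 <= s + t by exact: addr_ge0.
rewrite plawE; last by apply: bmeasM; exact: bmeas_traj.
under eq_Rintegral do rewrite markov_bmeas//.
have bh : bmeas (fun y => f y * semigroup Y t g y).
  by apply: bmeasM => //; exact: bmeas_semigroup.
by rewrite -(stationary s0 bh) (plawE (bmeas_traj s0 bh)).
Qed.

Lemma semigroup_stationary t f : 0 <= t -> bmeas f ->
  \int[nu]_x semigroup Y t f x = \int[nu]_x f x.
Proof.
move=> t0 bf; by rewrite -(stationary t0 bf) (plawE (bmeas_traj t0 bf)).
Qed.

(** Jensen and stationarity. *)
Lemma semigroup_contraction t f : 0 <= t -> bmeas f ->
  \int[nu]_x (semigroup Y t f x ^+ 2) <= \int[nu]_x (f x ^+ 2).
Proof.
move=> t0 bf.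
rewrite -(semigroup_stationary t0 (bmeasX bf)).
have bT := bmeas_semigroup t0 bf.
apply: le_Rintegral => //; [exact/bmeas_int/bmeasX| |].
  exact/bmeas_int/bmeas_semigroup/bmeasX.
move=> x _; exact: (prob_sqr_le (fiber (law Y) x) (bmeas_traj t0 bf)).
Qed.

Section occupation.
Variable W : S -> R.
Hypothesis bW : bmeas W.
Local Notation ev := (evolution Y W).

Let bev : bmeas ev. Proof. exact: bmeas_evolution. Qed.

(** The expected time integral of W over [0, s]. It solves the equation
    A u = T_s W - W and replaces the resolvent in the proof of the Kipnis-Varadhan
    inequality. *)
Definition occupation (s : R) (x : S) : R := \int[mu]_(r in `[0, s]) ev (r, x).

Lemma bmeas_occupation s : bmeas (occupation s).
Proof. exact: bmeas_time. Qed.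

Lemma semigroup_occupation h s x : 0 <= h -> 0 <= s ->
  semigroup Y h (occupation s) x = \int[mu]_(r in `[h, h + s]) ev (r, x).
Proof.
move=> h0 s0.
have bF : bmeas (fun p : R * Om => ev (p.1, traj Y h p.2)).
  apply: bmeas_comp bev; apply: measurable_fun_pair => //.
  by apply: measurableT_comp => //; exact: measurable_traj.
transitivity (\int[fiber (law Y) x]_w \int[mu]_(r in `[0, s]) ev (r, traj Y h w)).
  by [].
rewrite (time_Fubini (fiber (law Y) x) 0 s bF).
transitivity (\int[mu]_(r in `[0, s]) ev (h + r, x)).
  apply: eq_Rintegral => r; rewrite inE/= in_itv/= => /andP[r0 _].
  rewrite evolutionE; last exact: addr_ge0.
  rewrite (semigroupD Y x h0 r0 bW).
  by apply: eq_Rintegral => w _; rewrite evolutionE.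
by rewrite (Rint_translate h 0 s (bmeas_fst x bev)) addr0.
Qed.

Hypothesis cW : L2dist nu (semigroup Y t W) W @[t --> 0^'+] --> 0%E.

(** Strong continuity at 0, with the value r = 0 included. *)
Let near0 e : 0 < e -> exists2 dl, 0 < dl & forall r, 0 <= r -> r < dl ->
  \int[nu]_x ((semigroup Y r W x - W x) ^+ 2) <= e.
Proof.
move=> e0; have LW := bmeas_L2 nu bW.
have nL : \forall t \near 0^'+, L2 nu (semigroup Y t W).
  apply: filterS (nbhs_right_ge 0) => t t0.
  exact/bmeas_L2/bmeas_semigroup.
have [near0' _] := L2dist_cvgP nL LW.
have := near0' cW e e0; rewrite near_withinE => -[dl /= dl0 H]; exists dl => // r.
rewrite le_eqVlt => /predU1P[<-|r0] rdl.
  have -> : \int[nu]_x ((semigroup Y 0 W x - W x) ^+ 2) = \int[nu]_x 0.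
    by apply: eq_Rintegral => x _; rewrite semigroup0// subrr expr0n.
  by rewrite Rint_cst ltW.
by apply/ltW/H => //=; rewrite sub0r normrN gtr0_norm.
Qed.

(** The semigroup is a contraction, so the continuity modulus at 0 is valid at
    every time a; then Jensen for the time average. *)
Let average_cvg a h e : 0 <= a -> 0 < h ->
  (forall r, 0 <= r -> r <= h ->
     \int[nu]_x ((semigroup Y r W x - W x) ^+ 2) <= e) ->
  \int[nu]_x ((h^-1 * (\int[mu]_(r in `[a, a + h]) ev (r, x)) - ev (a, x)) ^+ 2)
  <= e.
Proof.
move=> a0 h0 He.
pose F (p : R * S) := ev p - ev (a, p.2).
have bF : bmeas F.
  apply: bmeasB bev _; apply: (bmeas_comp (phi := fun p : R * S => (a, p.2))) bev.
  exact: measurable_fun_pair.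
have aah : a <= a + h by rewrite lerDl ltW.
have E x : h^-1 * (\int[mu]_(r in `[a, a + h]) ev (r, x)) - ev (a, x) =
    h^-1 * \int[mu]_(r in `[a, a + h]) F (r, x).
  rewrite /F/= RintegralB//; last 2 first.
  - exact/bmeas_itv_int/bmeas_fst.
  - exact/bmeas_itv_int/bmeas_cst.
  rewrite Rintegral_cst//.
  have -> : fine (mu `[a, (a + h)]) = h by rewrite itv_length// addrC addKr.
  by field; rewrite gt_eqF.
under eq_Rintegral do rewrite E exprMn.
have bI : bmeas (fun x => \int[mu]_(r in `[a, a + h]) F (r, x)) by exact: bmeas_time.
have bI2 : bmeas (fun x => \int[mu]_(r in `[a, a + h]) (F (r, x) ^+ 2)).
  exact: (bmeas_time a (a + h) (bmeasX bF)).
rewrite RintegralZl//; last exact/bmeas_int/bmeasX.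
rewrite exprVn ler_pdivrMl ?exprn_gt0//.
have := time_Fubini nu a (a + h) (bmeasX bF).
set J := \int[mu]_(r in _) _ => HJ.
apply: (@le_trans _ _ (h * J)).
  rewrite -HJ -(RintegralZl _ measurableT (bmeas_int nu bI2)).
  apply: (le_Rintegral measurableT (bmeas_int nu (bmeasX bI))
    (bmeas_int nu (bmeasM (bmeas_cst h) bI2))).
  move=> x _; have := time_sqr_le aah (bmeas_fst x bF).
  by rewrite (_ : a + h - a = h)//; ring.
rewrite expr2 -mulrA ler_pM2l//.
have := time_le_cst (c := e) aah (bmeas_space nu (bmeasX bF)).
rewrite (_ : a + h - a = h); last by ring.
apply => r /andP[ar rah].
have ra : 0 <= r - a by rewrite subr_ge0.
have rE : r = a + (r - a) by rewrite subrKC.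
have bD : bmeas (fun y => semigroup Y (r - a) W y - W y).
  by apply: bmeasB => //; exact: bmeas_semigroup.
apply: le_trans (He (r - a) ra _); last by rewrite lerBlDl.
apply: le_trans (semigroup_contraction a0 bD).
rewrite le_eqVlt; apply/orP; left; apply/eqP; apply: eq_Rintegral => x _.
congr (_ ^+ 2); rewrite /F /= !evolutionE//; last exact: le_trans ar.
by rewrite semigroupB//; [rewrite -semigroupD// subrKC|exact: bmeas_semigroup].
Qed.

(** Integrating over time regularizes: W is only bounded and measurable, but
    T_h u - u is the difference of the integrals of T_r W over [s, s + h] and over
    [0, h], and each of them divided by h converges by strong continuity. *)
Lemma occupation_generator s : 0 <= s ->
  infinitesimal_generator nu (semigroup Y) (occupation s)
    (fun x => semigroup Y s W x - W x).
Proof.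
move=> s0; have bu := bmeas_occupation s; have bT := bmeas_semigroup s0 bW.
have bg : bmeas (fun x => semigroup Y s W x - W x) by exact: bmeasB.
split; [exact: bmeas_L2|exact: bmeas_L2|].
have nL : \forall t \near 0^'+, L2 nu
    (fun x => t^-1 * (semigroup Y t (occupation s) x - occupation s x)).
  apply: filterS (nbhs_right_ge 0) => t t0.
  apply/bmeas_L2/bmeasM; first exact: bmeas_cst.
  by apply: bmeasB => //; exact: bmeas_semigroup.
have [_ gencvg] := L2dist_cvgP nL (bmeas_L2 nu bg).
apply: gencvg => e e0.
have e80 : 0 < e / 8 by rewrite divr_gt0.
have [dl dl0 H] := near0 e80.
near=> h.
have h0 : 0 < h by near: h; exact: nbhs_right_gt.
have hdl : h < dl by near: h; exact: nbhs_right_lt.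
have He r : 0 <= r -> r <= h -> \int[nu]_x ((semigroup Y r W x - W x) ^+ 2) <= e / 8.
  by move=> r0 rh; apply: H => //; exact: le_lt_trans hdl.
pose f1 x := h^-1 * (\int[mu]_(r in `[s, s + h]) ev (r, x)) - ev (s, x).
pose f2 x := h^-1 * (\int[mu]_(r in `[0, 0 + h]) ev (r, x)) - ev (0, x).
have A1 : \int[nu]_x (f1 x ^+ 2) <= e / 8 := average_cvg s0 h0 He.
have A2 : \int[nu]_x (f2 x ^+ 2) <= e / 8 := average_cvg (lexx 0) h0 He.
have bf (a b : R) : bmeas (fun x => h^-1 * (\int[mu]_(r in `[a, b]) ev (r, x)) - ev (a, x)).
  apply: bmeasB; last exact: (bmeas_snd a bev).
  by apply: bmeasM; [exact: bmeas_cst|exact: bmeas_time].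
have L1 : L2 nu f1 := bmeas_L2 nu (bf _ _).
have L2' : L2 nu f2 := bmeas_L2 nu (bf _ _).
have E x : h^-1 * (semigroup Y h (occupation s) x - occupation s x)
    - (semigroup Y s W x - W x) = f1 x + - f2 x.
  rewrite /f1 /f2 add0r !evolutionE// semigroup0// (semigroup_occupation _ (ltW h0) s0).
  have bx := bmeas_fst x bev.
  have S1 := Rint_itv_split s0 (_ : s <= s + h) bx.
  have S2 := Rint_itv_split (ltW h0) (_ : h <= s + h) bx.
  have {S1} := S1 _; rewrite lerDl (ltW h0) => /(_ isT) S1.
  have {S2} := S2 _; rewrite lerDr s0 => /(_ isT) S2.
  rewrite (addrC h s) /occupation.
  move: S1; rewrite S2.
  set I1 := \int[mu]_(r in `[h, s + h]) _; set I2 := \int[mu]_(r in `[0, s]) _.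
  set I3 := \int[mu]_(r in `[0, h]) _; set I4 := \int[mu]_(r in `[s, s + h]) _.
  move=> I; have -> : I1 = I2 + I4 - I3 by rewrite -I; ring.
  ring.
under eq_Rintegral do rewrite E.
have := sqr_intD L1 (L2N L2').
have -> : \int[nu]_x ((- f2 x) ^+ 2) = \int[nu]_x (f2 x ^+ 2).
  by apply: eq_Rintegral => x _; rewrite sqrrN.
move: A1 A2; clear - e0.
move: (\int[nu]_x (f1 x ^+ 2)) (\int[nu]_x (f2 x ^+ 2)) => p q.
move: (\int[nu]_x ((f1 x + - f2 x) ^+ 2)) => c; lra.
Unshelve. all: by end_near. Qed.

End occupation.

End stationary.

(** * The Kipnis-Varadhan inequality *)

Section square_time.
Context {R : realType} {d : measure_display} {T : measurableType d}.
Variables (P : probability T R) (F : R * T -> R).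
Hypothesis bF : bmeas F.
Local Notation mu := (@lebesgue_measure R).

Definition covar (p : R * R) : R := \int[P]_x (F (p.1, x) * F (p.2, x)).

Lemma bmeas_covar : bmeas covar.
Proof.
have bG : bmeas (fun q : (R * R) * T => F (q.1.1, q.2) * F (q.1.2, q.2)).
  apply: bmeasM.
    apply: (bmeas_comp (phi := fun q : (R * R) * T => (q.1.1, q.2))) bF.
    by apply: measurable_fun_pair => //; exact: measurableT_comp.
  apply: (bmeas_comp (phi := fun q : (R * R) * T => (q.1.2, q.2))) bF.
  by apply: measurable_fun_pair => //; exact: measurableT_comp.
exact: (bmeas_Rint2 _ (prob_fin P) bG).
Qed.

Lemma Rint_time_mul (a b s : R) :
  \int[P]_x ((\int[mu]_(r in `[a, b]) F (r, x)) * F (s, x)) =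
  \int[mu]_(r in `[a, b]) covar (r, s).
Proof.
have bG : bmeas (fun p : R * T => F p * F (s, p.2)).
  apply: bmeasM => //.
  apply: (bmeas_comp (phi := fun q : R * T => (s, q.2))) bF.
  exact: measurable_fun_pair.
rewrite -(time_Fubini P a b bG); apply: eq_Rintegral => x _.
by rewrite /= -(Rint_timeZr _ _ _ (bmeas_fst x bF)).
Qed.

(** The square of a time integral as an ordered double integral. *)
Lemma Rint_time_sqr (t : R) : 0 <= t ->
  \int[P]_x ((\int[mu]_(r in `[0, t]) F (r, x)) ^+ 2) =
  2 * \int[mu]_(s in `[0, t]) \int[mu]_(r in `[0, s]) covar (r, s).
Proof.
move=> t0; rewrite -(Rint_triangle t0 bmeas_covar); last first.
  by move=> r s _ _; apply: eq_Rintegral => x _; rewrite mulrC.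
have bG : bmeas (fun p : R * T => (\int[mu]_(r in `[0, t]) F (r, p.2)) * F p).
  apply: bmeasM => //.
  exact: (bmeas_comp (phi := snd)) (bmeas_time 0 t bF).
transitivity (\int[P]_x \int[mu]_(s in `[0, t])
    ((\int[mu]_(r in `[0, t]) F (r, x)) * F (s, x))).
  apply: eq_Rintegral => x _;
  by rewrite /= (Rint_timeZl _ _ _ (bmeas_fst x bF)).
rewrite (time_Fubini P 0 t bG); apply: eq_Rintegral => s _.
exact: Rint_time_mul.
Qed.

End square_time.

Section kipnis_varadhan.
Context {R : realType} {d : measure_display} {S : measurableType d}.
Variables (Y : markov_process R S) (nu : probability S R).
Hypothesis inv : Defs.invariant nu Y.
Variables (Dom : set (S -> R)) (A : (S -> R) -> S -> R).
Hypothesis gen : generated_by nu (semigroup Y) Dom A.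
Local Notation mu := (@lebesgue_measure R).
Variables (W : S -> R) (K lam : R).
Hypotheses (bW : bmeas W) (lam0 : 0 <= lam).
Hypothesis hW : forall f, Dom f ->
  2 * \int[nu]_x (W x * f x) <=
  K - \int[nu]_x (f x * A f x) + lam * \int[nu]_x (f x ^+ 2).

Let le_small (x y C : R) :
  (forall e, 0 < e -> e <= 1 -> x <= y + e * C) -> x <= y.
Proof.
move=> h; apply/ler_addgt0Pr => e e0.
set D := `|C| + 1; have D0 : 0 < D by rewrite ltr_wpDl.
set m := Num.min 1 (e / D).
have m0 : 0 < m by rewrite lt_min ltr01 divr_gt0.
have m1 : m <= 1 by rewrite ge_min lexx.
have mD : m <= e / D by rewrite ge_min lexx orbT.
apply: (le_trans (h m m0 m1)); rewrite lerD2l.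
apply: (@le_trans _ _ (m * D)).
  by rewrite ler_pM2l// /D (le_trans (ler_norm C))// lerDl.
by rewrite -ler_pdivlMr.
Qed.

(** All terms are continuous for the graph norm of the generator, so the
    hypothesis passes from the core to the whole domain. *)
Lemma core_bound u g : infinitesimal_generator nu (semigroup Y) u g ->
  2 * \int[nu]_x (W x * u x) <=
  K - \int[nu]_x (u x * g x) + lam * \int[nu]_x (u x ^+ 2).
Proof.
move=> ug; have [Lu Lg _] := ug; have [_ core dense] := gen.
have LW := bmeas_L2 nu bW.
set w2 := \int[nu]_x (W x ^+ 2); set u2 := \int[nu]_x (u x ^+ 2).
set g2 := \int[nu]_x (g x ^+ 2).
apply: (@le_small _ _ (w2 + 1 + (u2 + 1) + (g2 + 1) + 1 + lam * (u2 + 1) + lam)).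
move=> e e0 e1.
have [h Dh [uh gh]] := dense u g ug e e0.
have [Lh LAh _] := core h Dh.
pose a x := h x - u x; pose b x := A h x - g x.
have La : L2 nu a by exact: L2B. have Lb : L2 nu b by exact: L2B.
have a2 : \int[nu]_x (a x ^+ 2) <= e ^+ 2.
  move: uh; rewrite L2dist_lt// => /ltW; apply: le_trans.
  rewrite le_eqVlt; apply/orP; left; apply/eqP.
  by apply: eq_Rintegral => x _; rewrite /a -sqrrN opprB.
have b2 : \int[nu]_x (b x ^+ 2) <= e ^+ 2.
  move: gh; rewrite L2dist_lt// => /ltW; apply: le_trans.
  rewrite le_eqVlt; apply/orP; left; apply/eqP.
  by apply: eq_Rintegral => x _; rewrite /b -sqrrN opprB.
have hE x : h x = u x + a x by rewrite /a; ring.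
have AhE x : A h x = g x + b x by rewrite /b; ring.
have young f k : L2 nu f -> L2 nu k -> \int[nu]_x (k x ^+ 2) <= e ^+ 2 ->
    `|2 * \int[nu]_x (f x * k x)| <= e * \int[nu]_x (f x ^+ 2) + e.
  move=> Lf Lk k2.
  have ei : 0 < e^-1 by rewrite invr_gt0.
  have k2' : e^-1 * \int[nu]_x (k x ^+ 2) <= e.
    by rewrite ler_pdivrMl// -expr2.
  rewrite ler_norml; apply/andP; split.
    have := L2_young ei (L2N Lf) Lk; rewrite invrK.
    have -> : \int[nu]_x (- f x * k x) = - \int[nu]_x (f x * k x).
      rewrite -mulN1r -(RintegralZl _ measurableT (L2_mul Lf Lk)).
      by apply: eq_Rintegral => x _; ring.
    have -> : \int[nu]_x ((- f x) ^+ 2) = \int[nu]_x (f x ^+ 2).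
      by apply: eq_Rintegral => x _; rewrite sqrrN.
    move: k2'; move: (e^-1 * _) (\int[nu]_x (f x * k x)) (e * _) => p q r; lra.
  have := L2_young ei Lf Lk; rewrite invrK.
  move: k2'; move: (e^-1 * _) (2 * _) (e * _) => p q r; lra.
have yWa := young _ _ LW La a2.
have yub := young _ _ Lu Lb b2.
have yga := young _ _ Lg La a2.
have yua := young _ _ Lu La a2.
have yab : `|2 * \int[nu]_x (a x * b x)| <= e * e ^+ 2 + e.
  by apply: (le_trans (young _ _ La Lb b2)); rewrite lerD2r ler_pM2l.
have E1 : \int[nu]_x (W x * h x) = \int[nu]_x (W x * u x) + \int[nu]_x (W x * a x).
  rewrite -(RintegralD measurableT (L2_mul LW Lu) (L2_mul LW La)).
  by apply: eq_Rintegral => x _; rewrite hE; ring.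
have E2 : \int[nu]_x (h x * A h x) = \int[nu]_x (u x * g x) +
   (\int[nu]_x (u x * b x) + (\int[nu]_x (g x * a x) + \int[nu]_x (a x * b x))).
  rewrite -(RintegralD measurableT (L2_mul Lg La) (L2_mul La Lb)).
  rewrite -(RintegralD measurableT (L2_mul Lu Lb)
    (integrableRD (L2_mul Lg La) (L2_mul La Lb))).
  rewrite -(RintegralD measurableT (L2_mul Lu Lg)
    (integrableRD (L2_mul Lu Lb) (integrableRD (L2_mul Lg La) (L2_mul La Lb)))).
  by apply: eq_Rintegral => x _; rewrite hE AhE; ring.
have E3 : \int[nu]_x (h x ^+ 2) = u2 +
   (2 * \int[nu]_x (u x * a x) + \int[nu]_x (a x ^+ 2)).
  rewrite -(RintegralZl _ measurableT (L2_mul Lu La)).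
  rewrite -(RintegralD measurableT (integrableRZ 2 (L2_mul Lu La)) (L2_sqr La)).
  rewrite -(RintegralD measurableT (L2_sqr Lu)
     (integrableRD (integrableRZ 2 (L2_mul Lu La)) (L2_sqr La))).
  by apply: eq_Rintegral => x _; rewrite hE; ring.
have := hW Dh; rewrite E1 E2 E3.
have u20 : 0 <= u2 by exact: Rint_sqr_ge0.
have g20 : 0 <= g2 by exact: Rint_sqr_ge0.
rewrite -/w2 -/u2 -/g2 in yWa yub yga yua.
move: yWa yub yga yua yab a2 e0 e1 u20 g20 lam0; clear.
move: (\int[nu]_x (W x * u x)) (\int[nu]_x (W x * a x)) (\int[nu]_x (u x * g x))
  (\int[nu]_x (u x * b x)) (\int[nu]_x (g x * a x)) (\int[nu]_x (a x * b x))
  (\int[nu]_x (u x * a x)) (\int[nu]_x (a x ^+ 2)) => Wu Wa ug ub ga ab ua aa.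
move=> /ler_normlP[y1 _] /ler_normlP[y2 _] /ler_normlP[y3 _] /ler_normlP[_ y4].
move=> /ler_normlP[y5 _] aae e0 e1 u20 g20 l0 H.
have e2e : e ^+ 2 <= e by rewrite expr2 ler_piMl// ltW.
have e3e : e * e ^+ 2 <= e by apply: ler_piMr; [exact: ltW|exact: le_trans e2e e1].
have Lua : lam * (2 * ua) <= lam * (e * u2 + e) by exact: ler_wpM2l.
have Laa : lam * aa <= lam * e by apply: ler_wpM2l => //; exact: le_trans e2e.
have eu : 0 <= e * u2 by rewrite mulr_ge0// ltW.
have eg : 0 <= e * g2 by rewrite mulr_ge0// ltW.
have HE : lam * (u2 + (2 * ua + aa)) = lam * u2 + lam * (2 * ua) + lam * aa by ring.
rewrite HE in H.
have -> : e * (w2 + 1 + (u2 + 1) + (g2 + 1) + 1 + lam * (u2 + 1) + lam) =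
  e * w2 + e + e * u2 + e + e * g2 + e + e + lam * (e * u2 + e) + lam * e by ring.
lra.
Qed.

(** Write u s for the occupation function, so that the generator sends u s to
    T_s W - W. The hypothesis at u s reads
    <W, u s> + <u s, T_s W> <= K + lam |u s|^2. Integrated over s in [0, t], the first
    term gives half of the second moment of the additive functional, and the second
    gives |u t|^2 / 2 >= 0. The term lam is the price of a truncation. *)
Theorem kipnis_varadhan (t : R) : 0 <= t ->
  \int[plaw Y nu]_w ((\int[mu]_(s in `[0, t]) W (traj Y s w)) ^+ 2) <=
  2 * t * K + 2 * lam * t ^+ 3 * \int[nu]_x (W x ^+ 2).
Proof.
move=> t0; have [cont _ _] := gen.
have cW := cont W (bmeas_L2 nu bW).
set w2 := \int[nu]_x (W x ^+ 2).
have bev : bmeas (evolution Y W) by exact: bmeas_evolution.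
have bFp : bmeas (fun p => W (trajp (Y := Y) p.1 p.2)) by exact: bmeas_trajp.
pose c q := \int[nu]_x (W x * evolution Y W (q, x)).
have bWev : bmeas (fun p : R * S => W p.2 * evolution Y W p).
  by apply: bmeasM bev; exact: (bmeas_comp (phi := snd)) bW.
have bc : bmeas c by exact: (bmeas_space nu bWev).
have covE r s : 0 <= r -> r <= s ->
    covar (plaw Y nu) (fun p => W (trajp p.1 p.2)) (r, s) = c (s - r).
  move=> r0 rs; have sr : 0 <= s - r by rewrite subr_ge0.
  rewrite /c; under [RHS]eq_Rintegral do rewrite evolutionE//.
  rewrite -(correlation inv r0 sr bW bW) subrKC.
  apply: eq_Rintegral => w _; rewrite /= !trajpE//; exact: le_trans rs.
have I1 s : 0 <= s ->
    \int[mu]_(r in `[0, s]) covar (plaw Y nu) (fun p => W (trajp p.1 p.2)) (r, s) =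
    \int[nu]_x (W x * occupation Y W s x).
  move=> s0; transitivity (\int[mu]_(r in `[0, s]) c (s - r)).
    by apply: eq_Rintegral => r; rewrite inE/= in_itv/= => /andP[r0 rs]; exact: covE.
  rewrite (Rint_reflect s 0 s bc) subrr subr0 -(time_Fubini nu 0 s bWev).
  apply: eq_Rintegral => x _;
  by rewrite /= (Rint_timeZl _ _ _ (bmeas_fst x bev)).
have I2 s : 0 <= s -> \int[mu]_(r in `[0, s]) covar nu (evolution Y W) (r, s) =
    \int[nu]_x (occupation Y W s x * semigroup Y s W x).
  move=> s0; rewrite -(Rint_time_mul nu bev).
  by apply: eq_Rintegral => x _; rewrite evolutionE.
have u2 s : 0 <= s -> s <= t -> \int[nu]_x (occupation Y W s x ^+ 2) <= t ^+ 2 * w2.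
  move=> s0 st.
  have bu := bmeas_occupation Y bW s.
  have be2 := bmeasX bev.
  have h1 : \int[nu]_x (occupation Y W s x ^+ 2) <=
      s * \int[mu]_(r in `[0, s]) \int[nu]_x (evolution Y W (r, x) ^+ 2).
    rewrite -(time_Fubini nu 0 s be2).
    have bI := bmeas_time 0 s be2.
    rewrite -(RintegralZl _ measurableT (bmeas_int nu bI)).
    apply: (le_Rintegral measurableT (bmeas_int nu (bmeasX bu))
      (bmeas_int nu (bmeasM (bmeas_cst s) bI))) => x _.
    by have := time_sqr_le s0 (bmeas_fst x bev); rewrite subr0.
  have h2 : \int[mu]_(r in `[0, s]) \int[nu]_x (evolution Y W (r, x) ^+ 2) <= s * w2.
    have := time_le_cst (c := w2) s0 (bmeas_space nu be2); rewrite subr0; apply.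
    move=> r /andP[r0 _].
    have := semigroup_contraction inv r0 bW; apply: le_trans.
    rewrite le_eqVlt; apply/orP; left; apply/eqP.
    by apply: eq_Rintegral => x _; rewrite /= evolutionE.
  have w20 : 0 <= w2 by exact: Rint_sqr_ge0.
  apply: (le_trans h1); apply: (le_trans (ler_wpM2l s0 h2)).
  by rewrite mulrA -expr2 ler_wpM2r// lerXn2r// nnegrE.
have key s : 0 <= s <= t ->
    \int[nu]_x (W x * occupation Y W s x) +
    \int[nu]_x (occupation Y W s x * semigroup Y s W x) <= K + lam * (t ^+ 2 * w2).
  move=> /andP[s0 st].
  have Lu := bmeas_L2 nu (bmeas_occupation Y bW s).
  have bT : bmeas (semigroup Y s W) by exact: bmeas_semigroup.
  have LT := bmeas_L2 nu bT.
  have LW := bmeas_L2 nu bW.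
  have := core_bound (occupation_generator inv bW cW s0).
  have -> : \int[nu]_x (occupation Y W s x * (semigroup Y s W x - W x)) =
     \int[nu]_x (occupation Y W s x * semigroup Y s W x) -
     \int[nu]_x (W x * occupation Y W s x).
    rewrite -(RintegralB measurableT (L2_mul Lu LT) (L2_mul LW Lu)).
    by apply: eq_Rintegral => x _; ring.
  have := ler_wpM2l lam0 (u2 s s0 st).
  set p := \int[nu]_x (W x * occupation Y W s x).
  set q := \int[nu]_x (occupation Y W s x * semigroup Y s W x).
  set r := \int[nu]_x (occupation Y W s x ^+ 2).
  by clearbody p q r w2; move=> *; lra.
have EA : \int[plaw Y nu]_w ((\int[mu]_(s in `[0, t]) W (traj Y s w)) ^+ 2) =
    \int[plaw Y nu]_w ((\int[mu]_(s in `[0, t]) W (trajp s w)) ^+ 2).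
  apply: eq_Rintegral => w _; congr (_ ^+ 2).
  apply: eq_Rintegral => r; rewrite inE/= in_itv/= => /andP[r0 _].
  by rewrite trajpE.
have := Rint_time_sqr (plaw Y nu) bFp t0; rewrite -EA {EA} => EA.
have Eu := Rint_time_sqr nu bev t0.
have u0 : 0 <= \int[nu]_x (occupation Y W t x ^+ 2) by exact: Rint_sqr_ge0.
rewrite -/(occupation Y W t _) in Eu.
have i1 := integrable_triangle (bmeas_covar (plaw Y nu) bFp) t.
have i2 := integrable_triangle (bmeas_covar nu bev) t.
have ic := bmeas_itv_int 0 t (bmeas_cst (K + lam * (t ^+ 2 * w2))).
have [i12 S12] := Rint_timeD i1 i2.
have hle s : 0 <= s <= t ->
    \int[mu]_(r in `[0, s]) covar (plaw Y nu) (fun p => W (trajp p.1 p.2)) (r, s) +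
    \int[mu]_(r in `[0, s]) covar nu (evolution Y W) (r, s) <=
    K + lam * (t ^+ 2 * w2).
  by move=> hs; move: (hs) => /andP[s0 _]; rewrite I1// I2//; exact: key.
have := Rint_time_le i12 ic hle; rewrite S12.
have -> : \int[mu]_(r in `[0, t]) (K + lam * (t ^+ 2 * w2)) =
    t * (K + lam * (t ^+ 2 * w2)).
  rewrite Rintegral_cst// mulrC; congr (_ * _).
  exact: fine_lebesgue_itv.
move: EA Eu u0; clear.
move: (\int[mu]_(s in `[0, t]) \int[mu]_(r in `[0, s]) covar _ _ _) => p.
move: (\int[mu]_(s in `[0, t]) \int[mu]_(r in `[0, s]) covar _ _ _) => q.
move=> -> Eu u0 h; move: u0; rewrite Eu => u0.
have -> : 2 * t * K + 2 * lam * t ^+ 3 * w2 = 2 * (t * (K + lam * (t ^+ 2 * w2))).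
  by ring.
lra.
Qed.

End kipnis_varadhan.

(** * Additive functionals of a square integrable observable *)

Section time_change.
Context {R : realType} {d : measure_display} {S : measurableType d}.
Variables (Y : markov_process R S) (c : R).
Hypothesis c0 : 0 <= c.
Local Notation Om := (Defs.path Y).

Let traj' (r : R) (w : Om) : S := traj Y (r * c) w.

Let measurable_traj' : measurable_fun
  (`[0 : R, +oo[%classic `*` [set: Om]) (fun p : R * Om => traj' p.1 p.2).
Proof.
pose g (p : R * Om) := (p.1 * c, p.2).
have mD : measurable (`[0 : R, +oo[%classic `*` [set: Om]).
  by apply: measurableX.
apply: (@measurable_comp _ _ _ _ _ _ _ (fun p : R * Om => traj Y p.1 p.2) _ g mD).
- move=> _ [p [/= p1 _] <-] /=; split => //=.
  by move: p1; rewrite !in_itv/= !andbT => p1; rewrite mulr_ge0.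
- exact: traj_measurable.
- apply: measurable_funTS; apply: measurable_fun_pair => //.
  exact: measurable_funM.
Qed.

Let law_initial' (x : S) (B : set S) : measurable B ->
  law Y x (traj' 0 @^-1` B) = \d_x B.
Proof.
move=> mB; rewrite -(@law_initial _ _ _ Y x B mB) /traj'.
by congr (law Y x _); apply/funext => w /=; rewrite mul0r.
Qed.

Let law_markov' (x : S) (s t : R) (A : set Om) (B : set S) :
  0 <= s -> 0 <= t -> measurable B ->
  <<s [set E | exists2 u : R, 0 <= u <= s &
         exists2 B' : set S, measurable B' & E = traj' u @^-1` B'] >> A ->
  law Y x (A `&` traj' (s + t) @^-1` B) =
  (\int[law Y x]_(w in A) law Y (traj' s w) (traj' t @^-1` B))%E.
Proof.
move=> s0 t0 mB FA.
have sc0 : 0 <= s * c by rewrite mulr_ge0.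
have tc0 : 0 <= t * c by rewrite mulr_ge0.
rewrite /traj' mulrDl; apply: law_markov => //.
move: A FA; apply: sub_sigma_algebra2 => E [u /andP[u0 us] [B' mB' ->]].
by exists (u * c); [rewrite mulr_ge0//= ler_wpM2r|exists B'].
Qed.

(** A change of the speed by a factor c multiplies the generator by c. *)
Definition time_change : markov_process R S :=
  @MarkovProcess R d S _ Om (law Y) traj' measurable_traj' law_initial'
    law_markov'.

Lemma invariant_time_change (nu : probability S R) :
  Defs.invariant nu Y -> Defs.invariant nu time_change.
Proof. by move=> inv t B t0 mB; apply: inv => //; rewrite mulr_ge0. Qed.

End time_change.

Section monotone.
Context {R : realType} {d : measure_display} {T : measurableType d}.
Local Open Scope ereal_scope.

(** The integral of a nonnegative function is a supremum over the simple
    functions below it, so it is monotone on arbitrary functions. This is applied to the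
    square of a time integral, as a functional of the path. *)
Lemma ge0_le_integralT (m : {measure set T -> \bar R}) (f g : T -> \bar R) :
  (forall x, 0 <= f x) -> (forall x, f x <= g x) ->
  \int[m]_x f x <= \int[m]_x g x.
Proof.
move=> f0 fg; rewrite !ge0_integralE//; last first.
  by move=> x _; exact: le_trans (fg x).
rewrite !patch_setT; apply: le_ereal_sup => _ [h hf <-].
by exists h => // x; exact: le_trans (fg x).
Qed.

End monotone.

Section truncation.
Context {R : realType} {d : measure_display} {T : measurableType d}.
Variables (P : probability T R) (V : T -> R).
Hypothesis LV : L2 P V.

Definition truncate (m : nat) (x : T) : R := if `|V x| <= m%:R then V x else 0.

Lemma bmeas_truncate m : bmeas (truncate m).
Proof.
have mV := L2_meas LV; split.
  apply: measurable_fun_ifT => //.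
  by apply: measurable_fun_ler => //; exact: measurableT_comp.
by exists m%:R => x; rewrite /truncate; case: ifP => //; rewrite normr0.
Qed.

Lemma truncate_sqr_le m : \int[P]_x (truncate m x ^+ 2) <= \int[P]_x (V x ^+ 2).
Proof.
apply: (le_Rintegral measurableT).
- exact/bmeas_int/bmeasX/bmeas_truncate.
- exact: L2_sqr.
- by move=> x _; rewrite /truncate; case: ifP => // _; rewrite expr0n sqr_ge0.
Qed.

Lemma truncate_cvg e : 0 < e ->
  exists m, \int[P]_x ((truncate m x - V x) ^+ 2) < e.
Proof.
move=> e0; have mV := L2_meas LV.
have LD m : L2 P (fun x => truncate m x - V x).
  by apply: L2B => //; exact/bmeas_L2/bmeas_truncate.
have cvg0 : (\int[P]_x ((truncate m x - V x) ^+ 2)%:E)%E @[m --> \oo] -->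
    (\int[P]_x (cst 0%E x))%E.
  apply: (@dominated_cvg _ _ _ P setT measurableT _ _
    (fun x => (V x ^+ 2)%:E)).
  - move=> m; apply/measurable_EFinP; apply: measurable_funX.
    exact: L2_meas (LD m).
  - move=> x _; apply: (cvg_near_cst); near=> m.
    rewrite /truncate ifT ?subrr ?expr0n//.
    by near: m; exact: nbhs_infty_ger.
  - by [].
  - exact: (L2_sqr LV).
  - move=> m x _; rewrite abse_EFin lee_fin ger0_norm ?sqr_ge0// /truncate.
    case: ifP => _; first by rewrite subrr expr0n sqr_ge0.
    by rewrite sub0r sqrrN.
move: cvg0; rewrite integral0 => /fine_cvgP[_] /cvgrPdist_lt /(_ e e0)[m _ Hm].
exists m; have := Hm m (leqnn m); rewrite /= sub0r normrN ger0_norm//.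
exact: Rint_sqr_ge0.
Unshelve. all: by end_near. Qed.

End truncation.

Section additive_functional.
Context {R : realType} {d : measure_display} {S : measurableType d}.
Variables (Y : markov_process R S) (nu : probability S R).
Hypothesis inv : Defs.invariant nu Y.
Local Notation mu := (@lebesgue_measure R).
Local Notation Om := (Defs.path Y).

Lemma ge0_stationary (t : R) (f : S -> \bar R) : 0 <= t -> measurable_fun setT f ->
  (forall x, 0 <= f x)%E ->
  (\int[plaw Y nu]_w f (traj Y t w) = \int[nu]_x f x)%E.
Proof.
move=> t0 mf f0; have mt := measurable_traj (Y := Y) t0.
transitivity (\int[push (plaw Y nu) mt]_x f x)%E.
  by rewrite ge0_integral_pushforward.
by apply: eq_measure_integral => A mA _; exact: inv.
Qed.

(** The integral of H^2 along the path, with value +oo on the paths where it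
    diverges, and along which H may fail to be integrable. *)
Definition energy (t : R) (H : S -> R) (w : Om) : \bar R :=
  (\int[mu]_(s in `[0%R, t]) ((H (trajp s w)) ^+ 2)%:E)%E.

Lemma energy_ge0 t H w : (0 <= energy t H w)%E.
Proof. by apply: integral_ge0 => s _; rewrite lee_fin sqr_ge0. Qed.

Let restricted (t : R) (H : S -> R) (p : R * Om) : \bar R :=
  ((\1_(`[0, t]%classic : set R) p.1) * (H (trajp p.1 p.2)) ^+ 2)%:E.

Let restricted_ge0 t H p : (0 <= restricted t H p)%E.
Proof. by rewrite lee_fin mulr_ge0 ?sqr_ge0. Qed.

Let measurable_restricted t H : measurable_fun setT H ->
  measurable_fun setT (restricted t H).
Proof.
move=> mH; apply/measurable_EFinP; apply: measurable_funM.
  exact: measurableT_comp.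
apply: measurable_funX.
by apply: measurableT_comp => //; exact: measurable_trajp.
Qed.

Let energyE t H w : energy t H w = (\int[mu]_s restricted t H (s, w))%E.
Proof.
rewrite /energy integral_mkcond; apply: eq_integral => s _.
by rewrite patchE /restricted /= indicE; case: ifP; rewrite ?mul1r ?mul0r.
Qed.

Lemma measurable_energy t H : measurable_fun setT H ->
  measurable_fun setT (energy t H).
Proof.
move=> mH; have mr := measurable_restricted t mH.
rewrite (_ : energy t H = (fun w => \int[mu]_s restricted t H (s, w))%E); last first.
  by apply/funext => w; exact: energyE.
exact: (@measurable_fun_fubini_tonelli_G _ _ _ _ _ mu (restricted t H)).
Qed.

Lemma expected_energy t H : 0 <= t -> L2 nu H ->
  (\int[plaw Y nu]_w energy t H w = (t * \int[nu]_x (H x ^+ 2))%:E)%E.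
Proof.
move=> t0 LH; have mH := L2_meas LH; have mr := measurable_restricted t mH.
under eq_integral do rewrite energyE.
rewrite -(@fubini_tonelli _ _ _ _ _ mu (plaw Y nu) (restricted t H))//.
have E s : (\int[plaw Y nu]_w restricted t H (s, w) =
    (\1_(`[0, t]%classic : set R) s * \int[nu]_x (H x ^+ 2))%:E)%E.
  rewrite /restricted /= indicE.
  have [|hs] := boolP (s \in _); last first.
    by rewrite mul0r; apply: integral0_eq => w _; rewrite mul0r.
  rewrite inE/= in_itv/= => /andP[s0 _]; rewrite mul1r.
  transitivity (\int[plaw Y nu]_w ((H (traj Y s w)) ^+ 2)%:E)%E.
    by apply: eq_integral => w _; rewrite mul1r trajpE.
  rewrite (ge0_stationary (f := fun x => ((H x) ^+ 2)%:E) s0)//; last 2 first.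
  - by apply/measurable_EFinP; exact: measurable_funX.
  - by move=> x; rewrite lee_fin sqr_ge0.
  by rewrite /Rintegral fineK//; apply: integrable_fin_num => //; exact: (L2_sqr LH).
under eq_integral do rewrite E EFinM.
rewrite ge0_integralZr//; last by rewrite lee_fin Rint_sqr_ge0.
  rewrite integral_indic// setIT EFinM; congr (_ * _)%E.
  have h : mu `[0, t] = t%:E.
    by rewrite -[LHS]fineK ?ge0_fin_numE ?lebesgue_itvy// fine_lebesgue_itv.
  exact: h.
exact/measurable_EFinP.
Qed.

(** The decomposition of the integrand along a path. The square of the integral of
    G - W is at most t times its energy; when the energy is infinite the right-hand
    side is infinite. *)
Lemma path_split (t : R) (G W : S -> R) w : 0 < t -> bmeas W ->
  measurable_fun setT G ->
  (((\int[mu]_(s in `[0, t]) G (traj Y s w)) ^+ 2)%:E <=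
   (2 * (\int[mu]_(s in `[0, t]) W (traj Y s w)) ^+ 2)%:E +
   (2 * t)%:E * energy t (fun x => (G x - W x)%R) w)%E.
Proof.
move=> t0 bW mG; have [mW _] := bW.
have [en|eny] := eqVneq (energy t (fun x => G x - W x) w) +oo%E.
  rewrite en gt0_muley ?lte_fin ?mulr_gt0// addey ?leey//.
have mi : measurable (`[0, t] : set R) by [].
pose H s := G (trajp s w) - W (trajp s w).
have mtr : measurable_fun setT (fun s : R => trajp (Y := Y) s w).
  exact: (measurable_fun_pair1 w (@measurable_trajp _ _ _ Y)).
have mH : measurable_fun setT H.
  by apply: measurable_funB; exact: measurableT_comp.
have enE : energy t (fun x => G x - W x) w =
    (\int[mu]_(s in `[0%R, t]) ((H s) ^+ 2)%:E)%E by [].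
have iH2 : mu.-integrable `[0, t] (EFin \o (fun s => H s ^+ 2)).
  apply/integrableP; split.
    by apply/measurable_EFinP/measurable_funTS; exact: measurable_funX.
  under eq_integral do rewrite /= ger0_norm ?sqr_ge0//.
  by rewrite -enE lt_neqAle eny leey.
have iH : mu.-integrable `[0, t] (EFin \o H).
  have [i1 _] := Rint_timeD (bmeas_itv_int 0 t (bmeas_cst 1)) iH2.
  apply: (le_integrable _ _ _ i1) => //.
    by apply/measurable_EFinP/measurable_funTS.
  move=> s _ /=; rewrite lee_fin [leRHS]ger0_norm ?addr_ge0 ?sqr_ge0//.
  rewrite -(real_normK (num_real (H s))) -subr_ge0.
  set z := `|H s|.
  rewrite (_ : _ - _ = ((1 - z) ^+ 2 + (1 + z ^+ 2)) / 2); last by field.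
  by rewrite divr_ge0// !addr_ge0// sqr_ge0.
have bWt : bmeas (fun s => W (trajp (Y := Y) s w)) by exact: bmeas_comp bW.
have iW := bmeas_itv_int 0 t bWt.
have [_ sumE] := Rint_timeD iW iH.
have tE (f : S -> R) : \int[mu]_(s in `[0, t]) f (traj Y s w) =
    \int[mu]_(s in `[0, t]) f (trajp s w).
  by apply: eq_Rintegral => s; rewrite inE/= in_itv/= => /andP[s0 _]; rewrite trajpE.
rewrite !tE.
have -> : \int[mu]_(s in `[0, t]) G (trajp s w) =
    \int[mu]_(s in `[0, t]) (W (trajp s w) + H s).
  by apply: eq_Rintegral => s _; rewrite /H subrKC.
rewrite sumE.
have J := Rint_sqr_le_integrable (mu := mu) mi (lebesgue_itvy 0 t) iH iH2.
have Jt := fine_lebesgue_itv (ltW t0).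
have -> : energy t (fun x => G x - W x) w =
   (\int[mu]_(s in `[0, t]) (H s ^+ 2))%:E.
  by rewrite enE /Rintegral fineK// ; apply: integrable_fin_num iH2.
rewrite -EFinM -EFinD lee_fin.
have {}J : (\int[mu]_(s in `[0, t]) H s) ^+ 2 <= t * \int[mu]_(s in `[0, t]) (H s ^+ 2).
  by rewrite -[X in X * _]Jt.
move: J; set p := \int[mu]_(s in `[0, t]) H s.
set q := \int[mu]_(s in `[0, t]) W _; set r := \int[mu]_(s in `[0, t]) (H s ^+ 2).
move=> J; rewrite -mulrA.
have : 0 <= (q - p) ^+ 2 by exact: sqr_ge0.
move: J; clearbody p q r; rewrite !expr2; lra.
Qed.

Variables (Dom : set (S -> R)) (A : (S -> R) -> S -> R).
Hypothesis gen : generated_by nu (semigroup Y) Dom A.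
Hypothesis LDom : forall f, Dom f -> L2 nu f.

(** The part V of G is handled by the Kipnis-Varadhan inequality, after a
    truncation, and G - V by Cauchy-Schwarz in time. The truncation error W - V enters
    the hypothesis on the core by Young's inequality, with a parameter lam that is
    chosen small before the truncation level. *)
Lemma additive_functional_bound (G V : S -> R) (K M t : R) :
  L2 nu G -> L2 nu V -> 0 < t ->
  (forall f, Dom f -> 2 * \int[nu]_x (V x * f x) <= K - \int[nu]_x (f x * A f x)) ->
  \int[nu]_x ((G x - V x) ^+ 2) <= M ->
  (expectation_from nu (Y := Y)
    (fun w => ((\int[mu]_(s in `[0, t]) G (traj Y s w)) ^+ 2)%:E) <=
   (4 * t * K + 4 * t ^+ 2 * M)%:E)%E.
Proof.
move=> LG LV t0 hV GM; have mG := L2_meas LG.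
have V20 : 0 <= \int[nu]_x (V x ^+ 2) by exact: Rint_sqr_ge0.
set V2 := \int[nu]_x (V x ^+ 2) in V20.
apply/lee_addgt0Pr => e e0.
(* The term of kipnis_varadhan in lam is then at most e / 2, after the factor 2
   of path_split; V2 + 1 replaces V2 to avoid a division by 0. *)
pose lam := e / (8 * t ^+ 3 * (V2 + 1)).
have V21 : 0 < V2 + 1 by rewrite ltr_wpDl.
have lam0 : 0 < lam by rewrite divr_gt0// !mulr_gt0// exprn_gt0.
(* de is the truncation error that makes the two terms in which it occurs add up
   to e / 2. *)
pose de := e / 2 / (4 * t / lam + 4 * t ^+ 2).
have de0 : 0 < de.
  by rewrite divr_gt0 ?divr_gt0// addr_gt0// ?divr_gt0 ?mulr_gt0 ?exprn_gt0.
have [m Wd] := truncate_cvg LV de0.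
set W := truncate V m in Wd; have bW : bmeas W by exact: bmeas_truncate LV m.
have LW := bmeas_L2 nu bW.
have hW f : Dom f -> 2 * \int[nu]_x (W x * f x) <=
   (K + lam^-1 * de) - \int[nu]_x (f x * A f x) + lam * \int[nu]_x (f x ^+ 2).
  move=> Df; have Lf := LDom Df; have := hV f Df.
  have LWV := L2B LW LV.
  have := L2_young lam0 LWV Lf.
  have -> : \int[nu]_x (W x * f x) =
      \int[nu]_x (V x * f x) + \int[nu]_x ((W x - V x) * f x).
    rewrite -(RintegralD measurableT (L2_mul LV Lf) (L2_mul LWV Lf)).
    by apply: eq_Rintegral => x _; ring.
  have : lam^-1 * \int[nu]_x ((W x - V x) ^+ 2) <= lam^-1 * de.
    by rewrite ler_pM2l ?invr_gt0// ltW.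
  set p := lam^-1 * _; set p' := lam^-1 * _; set q := lam * _.
  clearbody p p' q.
  move: (\int[nu]_x (V x * f x)) (\int[nu]_x ((W x - V x) * f x)) => a b *; lra.
have KV := kipnis_varadhan inv gen bW (ltW lam0) hW (ltW t0).
have W2 : \int[nu]_x (W x ^+ 2) <= V2 by exact: truncate_sqr_le.
pose Z w : \bar R := ((2 * (\int[mu]_(s in `[0, t]) W (traj Y s w)) ^+ 2)%:E +
   (2 * t)%:E * energy t (fun x => (G x - W x)%R) w)%E.
have Z0 w : (0 <= Z w)%E.
  apply: adde_ge0; first by rewrite lee_fin mulr_ge0 ?sqr_ge0.
  by apply: mule_ge0; [rewrite lee_fin mulr_ge0// ltW|exact: energy_ge0].
have LGW : L2 nu (fun x => G x - W x) by exact: L2B.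
have bA : bmeas (fun w : Om => \int[mu]_(s in `[0, t]) W (traj Y s w)).
  rewrite (_ : (fun w => _) = (fun w => \int[mu]_(s in `[0, t]) W (trajp s w))).
    exact: (bmeas_time 0 t (bmeas_trajp Y bW)).
  apply/funext => w; apply: eq_Rintegral => s.
  by rewrite inE/= in_itv/= => /andP[s0 _]; rewrite trajpE.
have bA2 : bmeas (fun w : Om => 2 * (\int[mu]_(s in `[0, t]) W (traj Y s w)) ^+ 2).
  by apply: bmeasM; [exact: bmeas_cst|exact: bmeasX].
have mA2 : measurable_fun setT
   (fun w : Om => (2 * (\int[mu]_(s in `[0, t]) W (traj Y s w)) ^+ 2)%:E).
  by apply/measurable_EFinP; have [] := bA2.
have mE := measurable_energy t (L2_meas LGW).
have mE2 := measurable_funeM (2 * t)%:E mE.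
have mZ : measurable_fun setT Z by exact: emeasurable_funD.
apply: (@le_trans _ _ (\int[plaw Y nu]_w Z w)%E).
  rewrite (ge0_integral_mixture (law Y) nu mZ Z0) /expectation_from.
  apply: ge0_le_integralT => x.
    by apply: integral_ge0 => w _; rewrite lee_fin sqr_ge0.
  apply: ge0_le_integralT => w; first by rewrite lee_fin sqr_ge0.
  exact: path_split.
have hA0 w : setT w ->
    (0 <= (2 * (\int[mu]_(s in `[0, t]) W (traj Y s w)) ^+ 2)%:E)%E.
  by move=> _; rewrite lee_fin mulr_ge0 ?sqr_ge0.
have t20 : (0 <= (2 * t)%:E)%E by rewrite lee_fin mulr_ge0// ltW.
have hE1 w : setT w -> (0 <= energy t (fun x => (G x - W x)%R) w)%E.
  by move=> _; exact: energy_ge0.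
have hE0 w : setT w -> (0 <= (2 * t)%:E * energy t (fun x => (G x - W x)%R) w)%E.
  by move=> h; rewrite mule_ge0// hE1.
rewrite /Z (ge0_integralD _ measurableT hA0 mA2 hE0 mE2).
rewrite (ge0_integralZl _ measurableT mE hE1 t20).
rewrite (expected_energy (ltW t0) LGW).
have -> : (\int[plaw Y nu]_w (2 * (\int[mu]_(s in `[0, t]) W (traj Y s w)) ^+ 2)%:E =
   (2 * \int[plaw Y nu]_w ((\int[mu]_(s in `[0, t]) W (traj Y s w)) ^+ 2))%:E)%E.
  rewrite -(RintegralZl 2 measurableT (bmeas_int (plaw Y nu) (bmeasX bA))).
  rewrite /Rintegral fineK//; apply: integrable_fin_num => //.
  exact: (bmeas_int (plaw Y nu) bA2).
rewrite -EFinM -!EFinD lee_fin.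
have GW : \int[nu]_x ((G x - W x) ^+ 2) <= 2 * M + 2 * de.
  have := sqr_intD (L2B LG LV) (L2N (L2B LW LV)).
  have -> : \int[nu]_x ((- (W x - V x)) ^+ 2) = \int[nu]_x ((W x - V x) ^+ 2).
    by apply: eq_Rintegral => x _; rewrite sqrrN.
  have -> : \int[nu]_x ((G x - V x + - (W x - V x)) ^+ 2) =
     \int[nu]_x ((G x - W x) ^+ 2).
    by apply: eq_Rintegral => x _; congr (_ ^+ 2); ring.
  move: GM Wd; move: (\int[nu]_x _) (\int[nu]_x _) (\int[nu]_x _) => a b c *; lra.
have W2' : lam * (t ^+ 3 * \int[nu]_x (W x ^+ 2)) <= e / 8.
  apply: (@le_trans _ _ (lam * (t ^+ 3 * (V2 + 1)))).
    rewrite ler_pM2l// ler_pM2l ?exprn_gt0// (le_trans W2)// lerDl.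
    exact: ler01.
  rewrite /lam le_eqVlt; apply/orP; left; apply/eqP; field.
  by rewrite !gt_eqF// exprn_gt0.
have deE : (4 * t / lam + 4 * t ^+ 2) * de = e / 2.
  rewrite /de; field; rewrite gt_eqF//.
  rewrite (_ : _ + _ = lam * (4 * t / lam + 4 * t ^+ 2)); last first.
    by field; rewrite gt_eqF.
  by rewrite gt_eqF// mulr_gt0// addr_gt0// ?divr_gt0 ?mulr_gt0 ?exprn_gt0.
have GW' : 2 * t * (t * \int[nu]_x ((G x - W x) ^+ 2)) <=
   2 * t * (t * (2 * M + 2 * de)).
  by rewrite ler_pM2l ?mulr_gt0// ler_pM2l.
move: KV GW' W2' deE.
move: (\int[plaw Y nu]_w _) (\int[nu]_x ((G x - W x) ^+ 2)) (\int[nu]_x (W x ^+ 2))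
  => a b c KV GW' W2' deE.
have E1 : 2 * lam * t ^+ 3 * c = 2 * (lam * (t ^+ 3 * c)) by ring.
rewrite E1 in KV.
apply: (le_trans (lerD (ler_wpM2l _ KV) GW')) => //.
have -> : 2 * (2 * t * (K + lam^-1 * de) + 2 * (lam * (t ^+ 3 * c))) +
  2 * t * (t * (2 * M + 2 * de)) =
  4 * t * K + 4 * t ^+ 2 * M + (4 * t / lam + 4 * t ^+ 2) * de +
  4 * (lam * (t ^+ 3 * c)) by ring.
rewrite deE; lra.
Qed.

End additive_functional.

(** * Product measures on configurations *)

Section cylinders.
Context {d : measure_display} {X : measurableType d}.
Local Notation Omega := (config X).

Definition cylinder (s : seq int) (B : int -> set X) : set Omega :=
  [set eta | forall x, x \in s -> B x (eta x)].

Definition cylinders : set (set Omega) :=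
  [set A | exists s B, [/\ uniq s, (forall x, measurable (B x)) & A = cylinder s B]].

Lemma measurable_coord x : measurable_fun setT (fun eta : Omega => eta x).
Proof.
move=> _ B mB; rewrite setTI; apply: sub_sigma_algebra.
by exists x, B.
Qed.

Lemma measurable_cylinder s (B : int -> set X) :
  (forall x, measurable (B x)) -> measurable (cylinder s B).
Proof.
move=> mB; elim: s => [|y s ih].
  by rewrite (_ : cylinder [::] B = setT)//; apply/seteqP; split.
rewrite (_ : cylinder (y :: s) B = (fun eta : Omega => eta y) @^-1` B y `&` cylinder s B).
  apply: measurableI => //; rewrite -[X in measurable X]setTI.
  exact: measurable_coord.
apply/seteqP; split => eta /= h.
  by split => [|x xs]; apply: h; rewrite inE ?eqxx// xs orbT.
by move=> x; rewrite inE => /orP[/eqP->|xs]; [case: h|apply: h.2].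
Qed.

Lemma measurable_config {d'} {T : measurableType d'} (phi : T -> Omega) :
  (forall x, measurable_fun setT (fun t => phi t x)) -> measurable_fun setT phi.
Proof.
move=> h; apply: (@measurability d' _ T Omega setT phi (@one_site_cylinders _ X)) => //.
move=> _ [_ [x [B mB ->]] <-]; exact: (h x measurableT B mB).
Qed.

Lemma cylinders_setI : setI_closed cylinders.
Proof.
move=> _ _ [s [B [us mB ->]]] [s' [B' [us' mB' ->]]].
exists (undup (s ++ s')), (fun x => (if x \in s then B x else setT) `&`
  (if x \in s' then B' x else setT)); split.
- exact: undup_uniq.
- by move=> x; apply: measurableI; case: ifP.
- apply/seteqP; split => eta /= h.
    move=> x _; split; case: ifP => // xs; [exact: h.1|exact: h.2].
  split=> x xs; have := h x; rewrite mem_undup mem_cat xs ?orbT => /(_ isT)[].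
    by [].
  by [].
Qed.

Lemma cylinders_generate : (@measurable _ Omega) = <<s cylinders >>.
Proof.
apply/seteqP; split.
  apply: sub_sigma_algebra2 => _ [x [B mB ->]].
  exists [:: x], (fun=> B); split => //.
  apply/seteqP; split => eta /= h; last by apply: h; rewrite mem_head.
  by move=> y; rewrite inE => /eqP->.
apply: smallest_sub; first exact: sigma_algebra_measurable.
by move=> _ [s [B [us mB ->]]]; exact: measurable_cylinder.
Qed.

Context {R : realType}.

(** The cylinders form a pi-system. *)
Lemma config_measure_unique (nu : probability Omega R)
    (m : {measure set Omega -> \bar R}) :
  (forall s (B : int -> set X), uniq s -> (forall x, measurable (B x)) ->
     m (cylinder s B) = nu (cylinder s B)) ->
  forall A, measurable A -> m A = nu A.
Proof.
move=> h A mA; apply/esym.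
have cylT : cylinder [::] (fun=> setT) = setT by apply/seteqP; split.
apply: (measure_unique cylinders (fun=> setT)) => //.
- exact: cylinders_generate.
- exact: cylinders_setI.
- by move=> _; exists [::], (fun=> setT); split.
- by rewrite bigcup_const.
- by move=> _ [s [B [us mB ->]]]; rewrite h.
- by move=> _; exact: prob_fin.
Qed.

End cylinders.

Section product_law.
Context {R : realType} {d : measure_display} {X : measurableType d}.
Local Notation Omega := (config X).
Variable nu : probability Omega R.
Hypothesis hprod : product_measure nu.

Lemma cylinderE s (B : int -> set X) : uniq s -> (forall x, measurable (B x)) ->
  nu (cylinder s B) = (\big[mule/1]_(x <- s) nu [set eta | B x (eta x)])%E.
Proof. exact: hprod. Qed.

Section independence.
Variable D : pred int.

(** D' is a predicate and not a finite set, so that complements are available. *)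
Definition depends {T : Type} (D' : pred int) (f : Omega -> T) :=
  forall eta xi : Omega, (forall x, D' x -> eta x = xi x) -> f eta = f xi.

Definition glue (p : Omega * Omega) : Omega :=
  fun x => if D x then p.1 x else p.2 x.

Lemma measurable_glue : measurable_fun setT glue.
Proof.
apply: measurable_config => x; rewrite /glue; case: (D x).
  exact: (measurableT_comp (measurable_coord x) measurable_fst).
exact: (measurableT_comp (measurable_coord x) measurable_snd).
Qed.

Lemma glue_law (A : set Omega) : measurable A ->
  (nu \x nu)%E (glue @^-1` A) = nu A.
Proof.
apply: (config_measure_unique (m := push (nu \x nu)%E measurable_glue)).
move=> s B us mB; rewrite cylinderE//.
have -> : push (nu \x nu)%E measurable_glue (cylinder s B) =
   (nu \x nu)%E (cylinder (seq.filter D s) B `*` cylinder (seq.filter (predC D) s) B).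
  congr ((nu \x nu)%E _); apply/seteqP; split => -[eta xi] /=.
    move=> h; split => x; rewrite mem_filter => /andP[Dx xs]; have := h x xs.
      by rewrite /glue Dx.
    by rewrite /glue (negbTE Dx).
  move=> [h1 h2] x xs; rewrite /glue; case: ifPn => Dx.
    by apply: h1; rewrite mem_filter Dx.
  by apply: h2; rewrite mem_filter /= Dx.
rewrite product_measure1E; [|exact: measurable_cylinder|exact: measurable_cylinder].
transitivity (nu (cylinder (seq.filter D s) B) *
    nu (cylinder (seq.filter (predC D) s) B))%E.
  by [].
rewrite !cylinderE ?filter_uniq// !big_filter.
by rewrite [RHS](bigID D).
Qed.

(** Functions of disjoint sets of coordinates are independent: gluing two
    independent copies along D reproduces nu, and splits the two functions. *)
Lemma independence (f g : Omega -> R) :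
  depends D f -> depends (predC D) g -> integrableR nu f -> integrableR nu g ->
  integrableR nu (fun x => f x * g x) /\
  \int[nu]_x (f x * g x) = \int[nu]_x f x * \int[nu]_x g x.
Proof.
move=> Df Dg If Ig; have mf := integrableR_meas If; have mg := integrableR_meas Ig.
have mfg : measurable_fun setT (fun x => f x * g x) by exact: measurable_funM.
pose F (p : Omega * Omega) := f p.1 * g p.2.
have FE p : f (glue p) * g (glue p) = F p.
  congr (_ * _).
    by apply: Df => x Dx; rewrite /glue Dx.
  by apply: Dg => x /= Dx; rewrite /glue (negbTE Dx).
have mF : measurable_fun setT (EFin \o F).
  apply/measurable_EFinP; apply: measurable_funM.
    exact: (measurableT_comp mf measurable_fst).
  exact: (measurableT_comp mg measurable_snd).
have /integrableP[_ If'] := If; have /integrableP[_ Ig'] := Ig.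
have iF : (nu \x nu)%E.-integrable setT (EFin \o F).
  apply/(integrable12ltyP _ _ mF).
  rewrite (_ : (\int[nu]_x _)%E =
    ((\int[nu]_x `|(EFin \o f) x|) * (\int[nu]_x `|(EFin \o g) x|))%E).
    rewrite lte_mul_pinfty ?integral_ge0//.
    by rewrite ge0_fin_numE ?integral_ge0.
  have mag : measurable_fun setT (fun y => `|(EFin \o g) y|%E).
    by apply: measurableT_comp => //; exact/measurable_EFinP.
  have maf : measurable_fun setT (fun y => `|(EFin \o f) y|%E).
    by apply: measurableT_comp => //; exact/measurable_EFinP.
  rewrite -[RHS]ge0_integralZr//; last by rewrite integral_ge0.
  apply: eq_integral => x _; rewrite -ge0_integralZl//.
  by apply: eq_integral => y _; rewrite /F /= normrM EFinM.
have mglue := measurable_glue.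
have mE : measurable_fun setT (EFin \o (fun x => f x * g x)).
  exact/measurable_EFinP.
have iglue : (nu \x nu)%E.-integrable (glue @^-1` setT)
    ((EFin \o (fun x => f x * g x)) \o glue).
  rewrite preimage_setT; apply: eq_integrable iF => // p _.
  by rewrite /= FE.
have eqm A : measurable A -> push (nu \x nu)%E mglue A = nu A by exact: glue_law.
split.
  have := integrable_pushforward mglue mE iglue measurableT.
  move=> /integrableP[_ H]; apply/integrableP; split => //.
  rewrite (eq_measure_integral (push (nu \x nu)%E mglue))//.
  by move=> A mA _; rewrite eqm.
rewrite {1}/Rintegral.
have -> : (\int[nu]_x (f x * g x)%:E = \int[nu \x nu]_p (F p)%:E)%E.
  rewrite (eq_measure_integral (push (nu \x nu)%E mglue)); last first.
    by move=> A mA _; rewrite eqm.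
  rewrite (integral_pushforward mglue mE iglue measurableT).
  by rewrite preimage_setT; apply: eq_integral => p _; rewrite /= FE.
rewrite -(integral12_prod_meas1 iF) /fubini_F.
under eq_integral => x _.
  rewrite (_ : (fun y => _) = (fun y => (f x)%:E * (g y)%:E))%E//.
  rewrite integralZl//.
  over.
have gf : (\int[nu]_y (g y)%:E = (\int[nu]_y g y)%:E)%E.
  by rewrite /Rintegral fineK//; exact: (integrable_fin_num _ Ig).
rewrite gf integralZr// fineM//.
exact: (integrable_fin_num _ If).
Qed.

End independence.

Hypothesis htrans : translation_invariant nu.

Lemma marginal x (B : set X) : measurable B ->
  nu [set eta | B (eta x)] = nu [set eta | B (eta 0)].
Proof.
move=> mB.
have mC : measurable [set eta : Omega | B (eta 0)].
  have := measurable_coord (0 : int) (X := X) measurableT mB.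
  by rewrite setTI.
rewrite -(htrans x mC); congr (nu _).
by apply/seteqP; split => eta /=; rewrite /Defs.shift addr0.
Qed.

Section permutation.
Variable sigma : int -> int.
Hypothesis sigmaK : involutive sigma.

Definition permute (eta : Omega) : Omega := fun x => eta (sigma x).

Lemma measurable_permute : measurable_fun setT permute.
Proof. by apply: measurable_config => x; exact: measurable_coord. Qed.

(** The marginals of a translation invariant product measure are all equal, so any
    permutation of the sites preserves it. Involutions are enough: the
    exchange of two neighbours, and the reflections, which carry 0 to any site. *)
Lemma permute_law (A : set Omega) : measurable A -> nu (permute @^-1` A) = nu A.
Proof.
apply: (config_measure_unique (m := push nu measurable_permute)).
move=> s B us mB; rewrite cylinderE//.
have -> : push nu measurable_permute (cylinder s B) =
   nu (cylinder (map sigma s) (B \o sigma)).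
  congr (nu _); apply/seteqP; split => eta /= h x.
    by move=> /mapP[y ys ->]; rewrite /= sigmaK; exact: h.
  move=> xs; have := h (sigma x); rewrite /= sigmaK; apply.
  exact: map_f.
have inj : injective sigma by exact: inv_inj.
rewrite cylinderE//; [|by rewrite map_inj_uniq|by move=> x; exact: mB].
rewrite big_map; apply: eq_bigr => x _ /=.
by rewrite sigmaK marginal// [RHS]marginal.
Qed.

Lemma Rint_permute (f : Omega -> R) : measurable_fun setT f ->
  integrableR nu (fun eta => f (permute eta)) ->
  \int[nu]_eta f (permute eta) = \int[nu]_eta f eta.
Proof.
by move=> mf If; apply: (Rint_push measurable_permute) => //; exact: permute_law.
Qed.

Lemma L2_permute (f : Omega -> R) : L2 nu f -> L2 nu (fun eta => f (permute eta)).
Proof.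
move=> /L2P[mf If]; have mp := measurable_permute; apply/L2P; split.
  exact: (measurableT_comp mf mp).
have mf2 : measurable_fun setT (EFin \o (fun eta => f eta ^+ 2)).
  exact: measurable_int If.
apply/integrableP; split.
  exact: (measurableT_comp mf2 mp).
have /integrableP[_] := If.
rewrite (eq_measure_integral (push nu mp)); last first.
  by move=> A mA _; apply/esym; exact: permute_law.
by rewrite ge0_integral_pushforward//; apply: measurableT_comp.
Qed.

End permutation.

End product_law.

(** * Moments of block sums *)

Section moments.
Context {R : realType} {d : measure_display} {X : measurableType d}.
Local Notation Omega := (config X).

(** The static hypotheses on the measure, at one density. *)
Record product_field (nu : probability Omega R) (ev : X -> R) (rho : R) : Prop :=
  ProductField {
    field_product : product_measure nu ;
    field_translation : translation_invariant nu ;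
    field_measurable : measurable_fun setT ev ;
    field_mean : forall x, (\int[nu]_e (spin ev x e)%:E = rho%:E)%E ;
    field_moments : forall (x : int) (k : nat), (2 <= k <= 6)%N ->
      (\int[nu]_e (`|spin ev x e| ^+ k)%:E < +oo)%E }.

Variables (nu : probability Omega R) (ev : X -> R) (rho : R).
Hypothesis H : product_field nu ev rho.
Let hprod := field_product H.
Let htrans := field_translation H.
Let hev := field_measurable H.
Let hmean := field_mean H.
Let hmom := field_moments H.

Local Notation eta := (spin_bar ev rho).

Lemma measurable_eta x : measurable_fun setT (eta x).
Proof.
apply: measurable_funB => //; apply: measurableT_comp => //.
exact: measurable_coord.
Qed.

Lemma depends_eta x : depends (pred1 x) (eta x).
Proof. by move=> e e' h; rewrite /spin_bar /spin (h x)//= eqxx. Qed.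

Lemma depends_sub {T : Type} (D D' : pred int) (f : Omega -> T) :
  (forall x, D x -> D' x) -> depends D f -> depends D' f.
Proof. by move=> DD' Df e e' h; apply: Df => x /DD'; exact: h. Qed.

Lemma depends_comp {T U : Type} (D : pred int) (op : T -> U) (f : Omega -> T) :
  depends D f -> depends D (fun e => op (f e)).
Proof. by move=> Df e e' h; rewrite (Df _ _ h). Qed.

Lemma depends_sum (I : Type) (s : seq I) (P : pred I) (D : pred int)
    (F : I -> Omega -> R) : (forall i, P i -> depends D (F i)) ->
  depends D (fun e => \sum_(i <- s | P i) F i e).
Proof. by move=> h e e' he; apply: eq_bigr => i Pi; exact: h. Qed.

Lemma eta_int_pow x k : (k <= 6)%N -> integrableR nu (fun e => eta x e ^+ k).
Proof.
move=> k6.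
have ms : measurable_fun setT (spin ev x : Omega -> R).
  by apply: measurableT_comp => //; exact: measurable_coord.
have i6 : integrableR nu (fun e => `|spin ev x e| ^+ 6).
  apply/integrableP; split.
    by apply/measurable_EFinP; apply: measurable_funX; exact: measurableT_comp.
  under eq_integral do rewrite /= ger0_norm ?exprn_ge0//.
  exact: hmom.
apply: (@integrableR_le _ _ _ _ _
  (fun e => 1 + (64 * `|spin ev x e| ^+ 6 + 64 * `|rho| ^+ 6))).
- by apply: measurable_funX; exact: measurable_eta.
- move=> e; rewrite normrX /spin_bar.
  set a := spin ev x e; set b : R := `|a - rho|.
  have b0 : 0 <= b by exact: normr_ge0.
  have bk : b ^+ k <= 1 + b ^+ 6.
    have [b1|b1] := leP b 1.
      by rewrite (le_trans (exprn_ile1 _ b0 b1))// lerDl exprn_ge0.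
    by rewrite (le_trans (ler_weXn2l (ltW b1) k6))// lerDr.
  apply: (le_trans bk); rewrite lerD2l.
  have ha : 0 <= `|a| ^+ 6 by rewrite exprn_ge0.
  have hr : 0 <= `|rho| ^+ 6 by rewrite exprn_ge0.
  have hb : b <= `|a| + `|rho| by exact: ler_normB.
  have c64 z : b <= 2 * z -> b ^+ 6 <= 64 * z ^+ 6.
    move=> h; have -> : 64 * z ^+ 6 = (2 * z) ^+ 6 by ring.
    by apply: lerXn2r => //; rewrite nnegrE// (le_trans b0).
  have [ar|ra] := leP `|a| `|rho|.
    apply: (le_trans (c64 `|rho| _)); last by rewrite lerDr mulr_ge0.
    by apply: (le_trans hb); lra.
  apply: (le_trans (c64 `|a| _)); last by rewrite lerDl mulr_ge0.
  by apply: (le_trans hb); lra.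
- apply: integrableRD; first exact: integrableR_cst.
  by apply: integrableRD; [exact: integrableRZ|exact: integrableR_cst].
Qed.

Lemma eta_int x : integrableR nu (eta x).
Proof.
have := eta_int_pow x (isT : (1 <= 6)%N).
by rewrite (_ : (fun e => eta x e ^+ 1) = eta x)//; apply/funext => e; rewrite expr1.
Qed.

Lemma eta_L2 x : L2 nu (eta x).
Proof. by apply/L2P; split; [exact: measurable_eta|exact: eta_int_pow]. Qed.

Definition moment k := \int[nu]_e (eta 0 e ^+ k).

Lemma momentE x k : (k <= 6)%N -> \int[nu]_e (eta x e ^+ k) = moment k.
Proof.
move=> k6.
have sK : involutive (fun y : int => x - y) by move=> y; rewrite opprB addrC subrK.
have E e : eta x e ^+ k = eta 0 (permute (fun y : int => x - y) e) ^+ k.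
  by rewrite /spin_bar /spin /permute subr0.
rewrite /moment -(Rint_permute hprod htrans sK (f := fun e => eta 0 e ^+ k)).
- by apply: eq_Rintegral => e _; exact: E.
- by apply: measurable_funX; exact: measurable_eta.
- rewrite (_ : (fun e => _) = (fun e => eta x e ^+ k)); first exact: eta_int_pow.
  by apply/funext => e; rewrite -E.
Qed.

Lemma moment0 : moment 0 = 1.
Proof. by rewrite /moment; under eq_Rintegral do rewrite expr0; exact: Rint_cst. Qed.

Lemma moment1 : moment 1 = 0.
Proof.
rewrite -(momentE 0 (isT : (1 <= 6)%N)).
under eq_Rintegral do rewrite expr1.
have is_ : integrableR nu (spin ev 0 : Omega -> R).
  have := integrableRD (eta_int 0) (integrableR_cst nu rho).
  rewrite (_ : (fun e => _) = spin ev 0)//.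
  by apply/funext => e; rewrite /spin_bar subrK.
rewrite /spin_bar (RintegralB measurableT is_ (integrableR_cst nu rho)) Rint_cst.
by rewrite /Rintegral hmean /= subrr.
Qed.

Lemma Rint_eta x : \int[nu]_e eta x e = 0.
Proof.
rewrite -moment1 -(momentE x (isT : (1 <= 6)%N)).
by apply: eq_Rintegral => e _; rewrite expr1.
Qed.

Local Notation s2 := (moment 2).

Lemma s2_ge0 : 0 <= s2.
Proof. exact: Rint_sqr_ge0. Qed.

Definition partial_sum (L : nat) (x : int) (e : Omega) : R :=
  \sum_(k < L) eta (x + k%:Z + 1) e.

Lemma right_averageE L x e : right_average ev rho L x e = L%:R^-1 * partial_sum L x e.
Proof.
rewrite /right_average /partial_sum big_add1 /= big_mkord; congr (_ * _).
by apply: eq_bigr => k _; congr (spin_bar ev rho _ e); lia.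
Qed.

Lemma depends_partial L x :
  depends (fun y => (x < y) && (y <= x + L%:Z)) (partial_sum L x).
Proof.
apply: depends_sum => k _.
apply: (@depends_sub _ (pred1 (x + k%:Z + 1))); last exact: depends_eta.
move=> y /= /eqP ->.
by have := ltn_ord k; lia.
Qed.

Definition partial_moment L x k := \int[nu]_e (partial_sum L x e ^+ k).

(** Binomial expansion of the sum of L + 1 spins and independence of the last
    one. Integrability of all the lower powers and the recursion come together. *)
Lemma partial_int_step L x k :
  (forall j, (j <= 6)%N -> integrableR nu (fun e => partial_sum L x e ^+ j)) ->
  (k <= 6)%N ->
  integrableR nu (fun e => partial_sum L.+1 x e ^+ k) /\
  partial_moment L.+1 x k =
  \sum_(i < k.+1) (partial_moment L x (k - i) * moment i) *+ 'C(k, i).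
Proof.
move=> ih k6.
have split_ i : (i <= k)%N ->
   integrableR nu (fun e => partial_sum L x e ^+ (k - i) * eta (x + L%:Z + 1) e ^+ i) /\
   \int[nu]_e (partial_sum L x e ^+ (k - i) * eta (x + L%:Z + 1) e ^+ i) =
   partial_moment L x (k - i) * moment i.
  move=> ik.
  have D1 := @depends_comp _ _ _ (fun z => z ^+ (k - i)) _ (@depends_partial L x).
  have D2 : depends (predC (fun y => (x < y) && (y <= x + L%:Z)))
      (fun e => eta (x + L%:Z + 1) e ^+ i).
    apply: (@depends_comp _ _ _ (fun z => z ^+ i)).
    apply: (@depends_sub _ (pred1 (x + L%:Z + 1))); last exact: depends_eta.
    by move=> y /= /eqP ->; lia.
  have i6 : (i <= 6)%N by exact: leq_trans k6.
  have ki6 : (k - i <= 6)%N by rewrite (leq_trans _ k6)// leq_subr.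
  have := independence hprod D1 D2 (ih _ ki6) (eta_int_pow _ i6).
  by rewrite momentE.
have E e : partial_sum L.+1 x e ^+ k = \sum_(i < k.+1)
    (partial_sum L x e ^+ (k - i) * eta (x + L%:Z + 1) e ^+ i) *+ 'C(k, i).
  by rewrite /partial_sum big_ord_recr exprDn.
have I i : integrableR nu (fun e =>
   (partial_sum L x e ^+ (k - i) * eta (x + L%:Z + 1) e ^+ i) *+ 'C(k, i)).
  rewrite (_ : (fun e => _) = (fun e => 'C(k, i)%:R *
    (partial_sum L x e ^+ (k - i) * eta (x + L%:Z + 1) e ^+ i))); last first.
    by apply/funext => e; rewrite mulr_natl.
  have [ik|ki] := leqP i k; first by apply: integrableRZ; have [] := split_ i ik.
  by apply: eq_integrableR (integrableR_cst nu 0) => e; rewrite bin_small// mul0r.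
split.
  apply: eq_integrableR (fun e => esym (E e)) _.
  by apply: integrableR_sum => i; exact: I.
rewrite /partial_moment; under eq_Rintegral do rewrite E.
rewrite Rint_sum; last by move=> i; exact: I.
apply: eq_bigr => i _; have [|I1 <-] := split_ i; first by rewrite -ltnS.
rewrite -mulr_natl -(RintegralZl _ measurableT I1).
by apply: eq_Rintegral => e _; rewrite mulr_natl.
Qed.

Lemma partial_int L x k : (k <= 6)%N -> integrableR nu (fun e => partial_sum L x e ^+ k).
Proof.
elim: L k => [|L ih] k k6; last by have [] := partial_int_step ih k6.
by apply: eq_integrableR (integrableR_cst nu (0 ^+ k)) => e; rewrite /partial_sum big_ord0.
Qed.

Lemma partial_momentS L x k : (k <= 6)%N ->
  partial_moment L.+1 x k =
  \sum_(i < k.+1) (partial_moment L x (k - i) * moment i) *+ 'C(k, i).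
Proof. by move=> k6; have [] := partial_int_step (@partial_int L x) k6. Qed.

Lemma partial_moment_0 L x : partial_moment L x 0 = 1.
Proof.
by rewrite /partial_moment; under eq_Rintegral do rewrite expr0; exact: Rint_cst.
Qed.

Lemma partial_moment0 x k : (0 < k)%N -> partial_moment 0 x k = 0.
Proof.
move=> k0; rewrite /partial_moment -[RHS](Rint_cst nu); apply: eq_Rintegral => e _.
by rewrite /partial_sum big_ord0 expr0n; case: k k0.
Qed.

Section recursion.
Variables (L : nat) (x : int).
Local Notation p := (partial_moment L x).
Local Notation m := moment.

Lemma partial_momentS_1 : partial_moment L.+1 x 1 =
  p 1.
Proof.
rewrite partial_momentS// !big_ord_recl big_ord0.
change (p 1 * m 0 *+ 1 +
  (p 0 * m 1 *+ 1 + 0) =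
  p 1).
rewrite moment0 moment1 partial_moment_0; ring.
Qed.

Lemma partial_momentS_2 : partial_moment L.+1 x 2 =
  p 2 + m 2.
Proof.
rewrite partial_momentS// !big_ord_recl big_ord0.
change (p 2 * m 0 *+ 1 +
  (p 1 * m 1 *+ 2 +
  (p 0 * m 2 *+ 1 + 0)) =
  p 2 + m 2).
rewrite moment0 moment1 partial_moment_0; ring.
Qed.

Lemma partial_momentS_3 : partial_moment L.+1 x 3 =
  p 3 + 3 * (p 1 * m 2) + m 3.
Proof.
rewrite partial_momentS// !big_ord_recl big_ord0.
change (p 3 * m 0 *+ 1 +
  (p 2 * m 1 *+ 3 +
  (p 1 * m 2 *+ 3 +
  (p 0 * m 3 *+ 1 + 0))) =
  p 3 + 3 * (p 1 * m 2) + m 3).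
rewrite moment0 moment1 partial_moment_0; ring.
Qed.

Lemma partial_momentS_4 : partial_moment L.+1 x 4 =
  p 4 + 6 * (p 2 * m 2) + 4 * (p 1 * m 3) + m 4.
Proof.
rewrite partial_momentS// !big_ord_recl big_ord0.
change (p 4 * m 0 *+ 1 +
  (p 3 * m 1 *+ 4 +
  (p 2 * m 2 *+ 6 +
  (p 1 * m 3 *+ 4 +
  (p 0 * m 4 *+ 1 + 0)))) =
  p 4 + 6 * (p 2 * m 2) + 4 * (p 1 * m 3) + m 4).
rewrite moment0 moment1 partial_moment_0; ring.
Qed.

Lemma partial_momentS_6 : partial_moment L.+1 x 6 =
  p 6 + 15 * (p 4 * m 2) + 20 * (p 3 * m 3) + 15 * (p 2 * m 4) +
  6 * (p 1 * m 5) + m 6.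
Proof.
rewrite partial_momentS// !big_ord_recl big_ord0.
change (p 6 * m 0 *+ 1 +
  (p 5 * m 1 *+ 6 +
  (p 4 * m 2 *+ 15 +
  (p 3 * m 3 *+ 20 +
  (p 2 * m 4 *+ 15 +
  (p 1 * m 5 *+ 6 +
  (p 0 * m 6 *+ 1 + 0)))))) =
  p 6 + 15 * (p 4 * m 2) + 20 * (p 3 * m 3) + 15 * (p 2 * m 4) +
  6 * (p 1 * m 5) + m 6).
rewrite moment0 moment1 partial_moment_0; ring.
Qed.

End recursion.

Lemma partial_moment_1 L x : partial_moment L x 1 = 0.
Proof.
elim: L => [|L ih]; first exact: partial_moment0.
by rewrite partial_momentS_1 ih.
Qed.

Lemma partial_moment_2 L x : partial_moment L x 2 = L%:R * s2.
Proof.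
elim: L => [|L ih]; first by rewrite partial_moment0// mul0r.
rewrite partial_momentS_2 ih -(natr1 L); ring.
Qed.

Lemma partial_moment_3 L x : partial_moment L x 3 = L%:R * moment 3.
Proof.
elim: L => [|L ih]; first by rewrite partial_moment0// mul0r.
rewrite partial_momentS_3 ih partial_moment_1 -(natr1 L); ring.
Qed.

(** Only the order L^2 of the bound matters. The constant absorbs the two terms of
    the recursion that do not vanish by centering. *)
Let fourth_bound := moment 4 + 6 * s2 ^+ 2.

Let moment4_ge0 : 0 <= moment 4.
Proof. by apply: Rintegral_ge0 => e _; rewrite (exprM _ 2 2) sqr_ge0. Qed.

Let moment6_ge0 : 0 <= moment 6.
Proof. by apply: Rintegral_ge0 => e _; rewrite (exprM _ 3 2) sqr_ge0. Qed.

Let fourth_bound_ge0 : 0 <= fourth_bound.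
Proof. by rewrite addr_ge0// mulr_ge0// sqr_ge0. Qed.

Lemma partial_moment_4 L x : partial_moment L x 4 <= fourth_bound * L%:R ^+ 2.
Proof.
elim: L => [|L ih]; first by rewrite partial_moment0// mulr_ge0// sqr_ge0.
rewrite partial_momentS_4 partial_moment_1 partial_moment_2 -(natr1 L).
have L0 : 0 <= L%:R :> R by [].
have := mulr_ge0 L0 (sqr_ge0 s2); have := mulr_ge0 L0 moment4_ge0.
have := sqr_ge0 s2; move: ih moment4_ge0; rewrite /fourth_bound.
move: (L%:R) (partial_moment L x 4) (moment 4) (s2) (moment 3) => l p m4 s m3 *.
lra.
Qed.

(** Only the order L^3 of the bound matters. The constant adds up bounds
    for the terms of the recursion that do not vanish by centering. *)
Definition sixth_bound :=
  15 * (fourth_bound * s2) + 20 * moment 3 ^+ 2 + 15 * (s2 * moment 4) + moment 6.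

Lemma partial_moment_6 L x : partial_moment L x 6 <= sixth_bound * L%:R ^+ 3.
Proof.
have a0 : 0 <= fourth_bound * s2 by rewrite mulr_ge0// s2_ge0.
have b0 : 0 <= s2 * moment 4 by rewrite mulr_ge0// s2_ge0.
have d0 : 0 <= moment 3 ^+ 2 by exact: sqr_ge0.
elim: L => [|L ih].
  rewrite partial_moment0// mulr_ge0// /sixth_bound !addr_ge0// mulr_ge0//.
rewrite partial_momentS_6 partial_moment_1 partial_moment_2 partial_moment_3 -(natr1 L).
have L0 : 0 <= L%:R :> R by [].
have h4 : s2 * partial_moment L x 4 <= fourth_bound * s2 * L%:R ^+ 2.
  by rewrite mulrC -mulrA (mulrC s2) mulrA ler_wpM2r ?s2_ge0// partial_moment_4.
have := mulr_ge0 L0 a0; have := mulr_ge0 (sqr_ge0 L%:R) a0.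
have := mulr_ge0 L0 b0; have := mulr_ge0 (sqr_ge0 L%:R) b0.
have := mulr_ge0 L0 d0; have := mulr_ge0 (sqr_ge0 L%:R) d0.
have := mulr_ge0 L0 moment6_ge0; have := mulr_ge0 (sqr_ge0 L%:R) moment6_ge0.
move: ih moment6_ge0 h4 a0 b0 d0; rewrite /sixth_bound.
move: (L%:R) (partial_moment L x 4) (partial_moment L x 5) (partial_moment L x 6)
  fourth_bound (moment 4) (moment 5)
  (moment 6) (s2) (moment 3) => l p4 p5 p6 cc m4 m5 m6 s m3 *.
lra.
Qed.

End moments.

(** * Three block averages against the cube of one *)

Section almost_orthogonal.
Context {R : realType} {d : measure_display} {T : measurableType d}.
Variable P : probability T R.

Lemma Rint_sqr_sum (n : nat) (G : 'I_n -> T -> R) : (forall k, L2 P (G k)) ->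
  \int[P]_x ((\sum_(k < n) G k x) ^+ 2) =
  \sum_(k < n) \sum_(l < n) \int[P]_x (G k x * G l x).
Proof.
move=> LG.
transitivity (\int[P]_x (\sum_(k < n) \sum_(l < n) (G k x * G l x))).
  apply: eq_Rintegral => x _; rewrite expr2 mulr_suml.
  by apply: eq_bigr => k _; rewrite mulr_sumr.
rewrite Rint_sum; last first.
  by move=> k; apply: integrableR_sum => l; exact: L2_mul.
by apply: eq_bigr => k _; rewrite Rint_sum// => l; exact: L2_mul.
Qed.

Lemma count_close (n m k : nat) :
  (\sum_(l < n) ((k < l + m)%N && (l < k + m)%N) <= 2 * m)%N.
Proof.
rewrite -(big_mkord xpredT (fun l => ((k < l + m)%N && (l < k + m)%N : nat))).
rewrite -big_mkcond /= sum1_count -size_filter.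
have -> : (2 * m = size (iota (k.+1 - m) (2 * m)))%N by rewrite size_iota.
apply: uniq_leq_size; first by rewrite filter_uniq// iota_uniq.
move=> l; rewrite mem_filter !mem_iota => /andP[/andP[h1 h2] _]; lia.
Qed.

(** Schur's test for a family with finite range of dependence. *)
Lemma almost_orthogonal (F : nat -> T -> R) (v : nat -> R) (n m : nat) (M : R) :
  (forall k, L2 P (F k)) -> (forall k, \int[P]_x (F k x ^+ 2) <= M) ->
  (forall k l, (k + m <= l)%N -> \int[P]_x (F k x * F l x) = 0) ->
  \int[P]_x ((\sum_(k < n) v k * F k x) ^+ 2) <=
  (2 * m)%:R * M * \sum_(k < n) v k ^+ 2.
Proof.
move=> LF FM F0.
have LG k : L2 P (fun x => v k * F k x) by exact: L2Z.
have M0 : 0 <= M by exact: le_trans (Rint_sqr_ge0 P (F 0%N)) (FM 0%N).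
rewrite (@Rint_sqr_sum n (fun k x => v k * F k x))//.
pose c (k l : nat) : R := ((k < l + m)%N && (l < k + m)%N)%:R.
have term (k l : 'I_n) : \int[P]_x ((v k * F k x) * (v l * F l x)) <=
    c k l * (M / 2 * v k ^+ 2) + c l k * (M / 2 * v l ^+ 2).
  rewrite {2}/c andbC -/(c k l).
  have E : \int[P]_x ((v k * F k x) * (v l * F l x)) =
      v k * v l * \int[P]_x (F k x * F l x).
    rewrite -(RintegralZl _ measurableT (L2_mul (LF k) (LF l))).
    by apply: eq_Rintegral => x _; ring.
  rewrite /c; have [/andP[kl lk]|] := boolP (_ && _).
    rewrite !mul1r; have := L2_young ltr01 (LG k) (LG l).
    rewrite invr1 [1 * _]mul1r [1 * _]mul1r.
    have Ek j : \int[P]_x ((v j * F j x) ^+ 2) <= v j ^+ 2 * M.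
      have -> : \int[P]_x ((v j * F j x) ^+ 2) = v j ^+ 2 * \int[P]_x (F j x ^+ 2).
        rewrite -(RintegralZl _ measurableT (L2_sqr (LF j))).
        by apply: eq_Rintegral => x _; ring.
      by rewrite ler_wpM2l ?sqr_ge0.
    have := Ek k; have := Ek l.
    move: (\int[P]_x ((v k * F k x) * (v l * F l x))) => a.
    move: (\int[P]_x ((v k * F k x) ^+ 2)) (\int[P]_x ((v l * F l x) ^+ 2)) => p q.
    move=> *; lra.
  rewrite negb_and -!leqNgt !mul0r addr0 => /orP[lk|kl]; rewrite E.
    rewrite (_ : (fun x => _) = (fun x => F l x * F k x)); last first.
      by apply/funext => x; rewrite mulrC.
    by rewrite (F0 l k lk) mulr0.
  by rewrite (F0 k l kl) mulr0.
apply: (@le_trans _ _ (\sum_(k < n) \sum_(l < n)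
   (c k l * (M / 2 * v k ^+ 2) + c l k * (M / 2 * v l ^+ 2)))).
  by apply: ler_sum => k _; apply: ler_sum => l _; exact: term.
under eq_bigr do rewrite big_split /=.
rewrite big_split /= [X in _ + X]exchange_big /= -mulr2n -[leLHS]mulr_natl.
have S : \sum_(k < n) \sum_(l < n) c k l * (M / 2 * v k ^+ 2) <=
   \sum_(k < n) (2 * m)%:R * (M / 2 * v k ^+ 2).
  apply: ler_sum => k _; rewrite -mulr_suml; apply: ler_wpM2r.
    by rewrite mulr_ge0 ?sqr_ge0// divr_ge0.
  rewrite -natr_sum ler_nat; exact: count_close.
apply: (le_trans (ler_wpM2l (ler0n R 2) S)).
rewrite -mulr_sumr -mulr_sumr le_eqVlt; apply/orP; left; apply/eqP.
set q := (2 * m)%:R; set w := \sum_(k < n) _; clearbody q w; by field.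
Qed.

End almost_orthogonal.

Section local_fields.
Context {R : realType} {d : measure_display} {X : measurableType d}.
Local Notation Omega := (config X).
Variables (nu : probability Omega R) (ev : X -> R) (rho : R).
Hypothesis H : product_field nu ev rho.
Let hprod := field_product H.
Local Notation eta := (spin_bar ev rho).
Local Notation s2 := (moment nu ev rho 2).

(** Disjoint supports are contained in complementary ones. *)
Lemma independence_sub (D D' : pred int) (f g : Omega -> R) :
  (forall x, D x -> ~~ D' x) -> depends D f -> depends D' g ->
  integrableR nu f -> integrableR nu g ->
  integrableR nu (fun x => f x * g x) /\
  \int[nu]_x (f x * g x) = \int[nu]_x f x * \int[nu]_x g x.
Proof.
move=> DD Df Dg; apply: (independence hprod Df).
by apply: depends_sub Dg => x D'x /=; apply/negP => /DD; rewrite D'x.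
Qed.

Lemma L2_independence (D D' : pred int) (f g : Omega -> R) :
  (forall x, D x -> ~~ D' x) -> depends D f -> depends D' g ->
  L2 nu f -> L2 nu g -> L2 nu (fun x => f x * g x) /\
  \int[nu]_x ((f x * g x) ^+ 2) = \int[nu]_x (f x ^+ 2) * \int[nu]_x (g x ^+ 2).
Proof.
move=> DD Df Dg Lf Lg.
have Df2 : depends D (fun e => f e ^+ 2) by move=> e e' h; rewrite (Df _ _ h).
have Dg2 : depends D' (fun e => g e ^+ 2) by move=> e e' h; rewrite (Dg _ _ h).
have [I E] := independence_sub DD Df2 Dg2 (L2_sqr Lf) (L2_sqr Lg).
split.
  apply/L2P; split.
    by apply: measurable_funM; [exact: (L2_meas Lf)|exact: (L2_meas Lg)].
  by apply: eq_integrableR I => x; rewrite exprMn.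
by rewrite -E; apply: eq_Rintegral => x _; rewrite exprMn.
Qed.

Section averages.
Variable L : nat.
Hypothesis L0 : (0 < L)%N.
Local Notation avg := (right_average ev rho L).

Let LR0 : 0 < L%:R :> R. Proof. by rewrite ltr0n. Qed.

Lemma depends_avg x : depends (fun y => (x < y) && (y <= x + L%:Z)) (avg x).
Proof.
move=> e e' h; rewrite !right_averageE; congr (_ * _).
exact: depends_partial h.
Qed.

Lemma avg_pow x k : (k <= 6)%N -> integrableR nu (fun e => avg x e ^+ k) /\
  \int[nu]_e (avg x e ^+ k) = L%:R^-1 ^+ k * partial_moment nu ev rho L x k.
Proof.
move=> k6; have I := partial_int H L x k6.
have E e : avg x e ^+ k = L%:R^-1 ^+ k * partial_sum ev rho L x e ^+ k.
  by rewrite right_averageE exprMn.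
split; first by apply: eq_integrableR (integrableRZ _ I) => e; rewrite E.
rewrite -(RintegralZl _ measurableT I); apply: eq_Rintegral => e _; exact: E.
Qed.

Lemma avg_L2 x : L2 nu (avg x).
Proof.
have [I _] := avg_pow x (isT : (2 <= 6)%N); apply/L2P; split => //.
have [I1 _] := avg_pow x (isT : (1 <= 6)%N).
have := integrableR_meas I1.
by rewrite (_ : (fun e => avg x e ^+ 1) = avg x)//; apply/funext => e; rewrite expr1.
Qed.

Lemma Rint_avg x : \int[nu]_e avg x e = 0.
Proof.
have [_] := avg_pow x (isT : (1 <= 6)%N); rewrite (partial_moment_1 H) mulr0 => <-.
by apply: eq_Rintegral => e _; rewrite expr1.
Qed.

Lemma Rint_avg2 x : \int[nu]_e (avg x e ^+ 2) = s2 / L%:R.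
Proof.
have [_ ->] := avg_pow x (isT : (2 <= 6)%N); rewrite (partial_moment_2 H).
by field; rewrite gt_eqF.
Qed.

(** The three blocks are disjoint: one ends at x-1, the next starts at x+1 and is the
    block of the average that is cubed, and the last one follows it. *)
Definition block (x : int) (e : Omega) : R :=
  avg (x - L%:Z - 1) e * (avg x e * avg (x + L%:Z) e).

Let block_pair x : L2 nu (fun e => avg x e * avg (x + L%:Z) e) /\
  \int[nu]_e ((avg x e * avg (x + L%:Z) e) ^+ 2) = (s2 / L%:R) * (s2 / L%:R).
Proof.
have D1 := @depends_avg x. have D2 := @depends_avg (x + L%:Z).
have := L2_independence _ D1 D2 (avg_L2 x) (avg_L2 _).
by rewrite !Rint_avg2; apply => y /=; lia.
Qed.

Let depends_pair x : depends (fun y => (x < y) && (y <= x + L%:Z + L%:Z))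
  (fun e => avg x e * avg (x + L%:Z) e).
Proof.
have D1 : depends (fun y => (x < y) && (y <= x + L%:Z + L%:Z)) (avg x).
  by apply: depends_sub (@depends_avg x) => y /=; lia.
have D2 : depends (fun y => (x < y) && (y <= x + L%:Z + L%:Z)) (avg (x + L%:Z)).
  by apply: depends_sub (@depends_avg (x + L%:Z)) => y /=; lia.
by move=> e e' h; rewrite (D1 _ _ h) (D2 _ _ h).
Qed.

Lemma block_L2 x : L2 nu (block x) /\
  \int[nu]_e (block x e ^+ 2) = (s2 / L%:R) ^+ 3.
Proof.
have [Lp Ep] := block_pair x.
have D1 := @depends_avg (x - L%:Z - 1). have D2 := @depends_pair x.
have := L2_independence _ D1 D2 (avg_L2 _) Lp.
rewrite Ep Rint_avg2 => /(_ _)[|Lb Eb]; first by move=> y /=; lia.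
by split => //; rewrite Eb; ring.
Qed.

Lemma Rint_block x : \int[nu]_e block x e = 0.
Proof.
have [Lp _] := block_pair x.
have D1 := @depends_avg (x - L%:Z - 1). have D2 := @depends_pair x.
have [|_ ->] := independence_sub _ D1 D2 (L2_integrable (avg_L2 _)) (L2_integrable Lp).
  by move=> y /=; lia.
by rewrite Rint_avg mul0r.
Qed.

Definition xi := third_moment ev nu rho.

(** What is left when the cube of the average is replaced by the product of three
    averages over disjoint blocks; the constant makes it centered. *)
Definition remainder (x : int) (e : Omega) : R :=
  block x e - avg x e ^+ 3 + xi / L%:R ^+ 2.

Lemma avg3_L2 x : L2 nu (fun e => avg x e ^+ 3).
Proof.
have [I6 _] := avg_pow x (isT : (6 <= 6)%N).
have [I3 _] := avg_pow x (isT : (3 <= 6)%N).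
apply/L2P; split; first exact: (integrableR_meas I3).
by apply: eq_integrableR I6 => e; rewrite -exprM.
Qed.

(** This is where the correction xi / L^2 comes from. *)
Lemma Rint_avg3 x : \int[nu]_e (avg x e ^+ 3) = xi / L%:R ^+ 2.
Proof.
have [_ ->] := avg_pow x (isT : (3 <= 6)%N); rewrite (partial_moment_3 H) /xi.
rewrite -[third_moment _ _ _]/(moment nu ev rho 3).
by field; rewrite gt_eqF.
Qed.

Lemma remainder_L2 x : L2 nu (remainder x).
Proof.
apply: L2D; last exact: L2_cst.
by apply: L2B; [have [] := block_L2 x|exact: avg3_L2].
Qed.

Lemma Rint_remainder x : \int[nu]_e remainder x e = 0.
Proof.
have [Lb _] := block_L2 x; have L3 := avg3_L2 x.
rewrite /remainder.
rewrite (RintegralD measurableT (L2_integrable (L2B Lb L3)) (integrableR_cst nu _)).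
rewrite (RintegralB measurableT (L2_integrable Lb) (L2_integrable L3)).
by rewrite Rint_block Rint_avg3 Rint_cst sub0r addNr.
Qed.

Definition remainder_constant := 2 * s2 ^+ 3 + 2 * sixth_bound nu ev rho.

Lemma remainder_sqr x : \int[nu]_e (remainder x e ^+ 2) <= remainder_constant / L%:R ^+ 3.
Proof.
have [Lb Eb] := block_L2 x; have L3 := avg3_L2 x.
set q := xi / L%:R ^+ 2.
have Lq : L2 nu (fun e => - (avg x e ^+ 3 - q)).
  by apply/L2N/L2B => //; exact: L2_cst.
have := sqr_intD Lb Lq.
have -> : \int[nu]_e ((block x e + - (avg x e ^+ 3 - q)) ^+ 2) =
    \int[nu]_e (remainder x e ^+ 2).
  by apply: eq_Rintegral => e _; rewrite /remainder -/q; congr (_ ^+ 2); ring.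
move=> h; apply: (le_trans h); rewrite Eb.
have [I6 E6] := avg_pow x (isT : (6 <= 6)%N).
have Eq : \int[nu]_e ((- (avg x e ^+ 3 - q)) ^+ 2) =
    \int[nu]_e (avg x e ^+ 6) - q ^+ 2.
  have I1 : integrableR nu (fun e => (- (2 * q)) * avg x e ^+ 3 + q ^+ 2).
    by apply: integrableRD; [exact/integrableRZ/L2_integrable|exact: integrableR_cst].
  transitivity (\int[nu]_e (avg x e ^+ 6 + ((- (2 * q)) * avg x e ^+ 3 + q ^+ 2))).
    by apply: eq_Rintegral => e _; ring.
  rewrite (RintegralD measurableT I6 I1).
  rewrite (RintegralD measurableT (integrableRZ _ (L2_integrable L3))
    (integrableR_cst nu _)).
  rewrite (RintegralZl _ measurableT (L2_integrable L3)) Rint_avg3 Rint_cst -/q.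
  ring.
have B6 : \int[nu]_e (avg x e ^+ 6) <= sixth_bound nu ev rho / L%:R ^+ 3.
  rewrite E6; apply: (@le_trans _ _ (L%:R^-1 ^+ 6 * (sixth_bound nu ev rho * L%:R ^+ 3))).
    apply: ler_wpM2l; last exact: (partial_moment_6 H).
    by rewrite exprn_ge0// invr_ge0 ltW.
  by rewrite le_eqVlt; apply/orP; left; apply/eqP; field; rewrite gt_eqF.
rewrite Eq /remainder_constant.
have -> : (2 * s2 ^+ 3 + 2 * sixth_bound nu ev rho) / L%:R ^+ 3 =
   2 * (s2 / L%:R) ^+ 3 + 2 * (sixth_bound nu ev rho / L%:R ^+ 3).
  by field; rewrite gt_eqF.
by rewrite lerD2l ler_pM2l// (le_trans _ B6)// gerBl sqr_ge0.
Qed.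

Lemma depends_remainder x :
  depends (fun y => (x - L%:Z - 1 < y) && (y <= x + L%:Z + L%:Z)) (remainder x).
Proof.
have W (f : Omega -> R) a b : x - L%:Z - 1 <= a -> b <= x + L%:Z + L%:Z ->
   depends (fun y => (a < y) && (y <= b)) f ->
   depends (fun y => (x - L%:Z - 1 < y) && (y <= x + L%:Z + L%:Z)) f.
  by move=> ha hb; apply: depends_sub => y; lia.
have Dp := W _ _ _ _ _ (@depends_pair x).
have D1 := W _ _ _ _ _ (@depends_avg (x - L%:Z - 1)).
have D2 := W _ _ _ _ _ (@depends_avg x).
move=> e e' h; rewrite /remainder /block.
by rewrite (Dp _ _ e e' h) ?(D1 _ _ e e' h) ?(D2 _ _ e e' h)//; lia.
Qed.

Lemma remainder_orthogonal x y : x + (4 * L)%:Z <= y ->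
  \int[nu]_e (remainder x e * remainder y e) = 0.
Proof.
move=> xy.
have [|_ ->] := independence_sub _ (@depends_remainder x) (@depends_remainder y)
  (L2_integrable (remainder_L2 x)) (L2_integrable (remainder_L2 y)).
  by move=> z /=; lia.
by rewrite Rint_remainder mul0r.
Qed.

(** The remainder has mean zero, variance of order L^-3 and range of order L. *)
Lemma remainder_sum_sqr (x0 : int) (v : nat -> R) (n : nat) :
  \int[nu]_e ((\sum_(k < n) v k * remainder (k%:Z + x0) e) ^+ 2) <=
  8 * remainder_constant / L%:R ^+ 2 * \sum_(k < n) v k ^+ 2.
Proof.
have := @almost_orthogonal _ _ _ nu (fun k => remainder (k%:Z + x0)) v n (4 * L)
  (remainder_constant / L%:R ^+ 3) (fun k => remainder_L2 _) (fun k => remainder_sqr _).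
have h0 k l : (k + 4 * L <= l)%N ->
    \int[nu]_e (remainder (k%:Z + x0) e * remainder (l%:Z + x0) e) = 0.
  by move=> kl; apply: remainder_orthogonal; lia.
move=> /(_ h0) h; apply: (le_trans h); rewrite le_eqVlt; apply/orP; left; apply/eqP.
congr (_ * _); rewrite !natrM; field; rewrite gt_eqF//.
Qed.

End averages.

End local_fields.

(** * Moving a spin across the bonds *)

Section displacement.
Context {R : realType} {d : measure_display} {X : measurableType d}.
Local Notation Omega := (config X).
Variables (nu : probability Omega R) (ev : X -> R) (rho : R).
Hypothesis H : product_field nu ev rho.
Let hprod := field_product H.
Let htrans := field_translation H.
Local Notation eta := (spin_bar ev rho).
Local Notation s2 := (moment nu ev rho 2).

(** The permutation of the sites under the exchange across the bond {z, z + 1}. *)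
Definition swap (z y : int) : int :=
  if y == z then z + 1 else if y == z + 1 then z else y.

Lemma swapK z : involutive (swap z).
Proof.
move=> y; rewrite /swap; have [->|yz] := eqVneq y z.
  by rewrite eqxx; case: eqP => //; lia.
have [->|yz1] := eqVneq y (z + 1); first by rewrite eqxx.
by rewrite (negbTE yz) (negbTE yz1).
Qed.

Lemma exchangeE z (e : Omega) : Defs.exchange z (z + 1) e = permute (swap z) e.
Proof.
apply/funext => y; rewrite /Defs.exchange /permute /swap.
by case: ifP => // _; case: ifP.
Qed.

Definition gradient (z : int) (f : Omega -> R) (e : Omega) : R :=
  f (Defs.exchange z (z + 1) e) - f e.

Lemma L2_exchange z f : L2 nu f -> L2 nu (fun e => f (Defs.exchange z (z + 1) e)).
Proof.
move=> Lf; apply: eq_L2 (L2_permute hprod htrans (swapK z) Lf) => e.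
by rewrite exchangeE.
Qed.

Lemma gradient_L2 z f : L2 nu f -> L2 nu (gradient z f).
Proof. by move=> Lf; apply: L2B => //; exact: L2_exchange. Qed.

Lemma eta_pair_L2 x y : x != y -> L2 nu (fun e => eta x e * eta y e) /\
  \int[nu]_e ((eta x e * eta y e) ^+ 2) = s2 ^+ 2.
Proof.
move=> xy.
have := L2_independence H _ (@depends_eta _ _ _ ev rho x) (@depends_eta _ _ _ ev rho y)
  (eta_L2 H x) (eta_L2 H y).
rewrite !(momentE H)// -expr2; apply => z /= /eqP ->; exact: xy.
Qed.

(** A site that occurs only once makes the expectation vanish. *)
Lemma single_site x (D : pred int) (g : Omega -> R) : ~~ D x -> depends D g ->
  integrableR nu g -> \int[nu]_e (eta x e * g e) = 0.
Proof.
move=> Dx Dg Ig.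
have [|_ ->] := independence_sub H _ (@depends_eta _ _ _ ev rho x) Dg (eta_int H x) Ig.
  by move=> y /= /eqP ->.
by rewrite (Rint_eta H) mul0r.
Qed.

(** The site a occurs once in the product of the two pairs. *)
Lemma eta_pair_orthogonal a b c d' : a != b -> c != d' -> a != c -> a != d' ->
  \int[nu]_e ((eta a e * eta b e) * (eta c e * eta d' e)) = 0.
Proof.
move=> ab cd ac ad.
have [Lcd _] := eta_pair_L2 cd.
have Lb := eta_L2 H b.
have Ig : integrableR nu (fun e => eta b e * (eta c e * eta d' e)).
  exact: (L2_mul Lb Lcd).
have Dg : depends (predC (pred1 a)) (fun e => eta b e * (eta c e * eta d' e)).
  move=> e e' h; congr (_ * (_ * _)); apply: depends_eta => y /= /eqP ->;
    by apply: h; rewrite /= eq_sym.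
have na : ~~ predC (pred1 a) a by rewrite /= eqxx.
rewrite -(single_site na Dg Ig).
by apply: eq_Rintegral => e _; rewrite -mulrA.
Qed.

Section transport.
Variables (al be p x0 : int) (n N : nat) (v : nat -> R).
Hypotheses (albe : al != be) (hal : ~~ (p <= al <= p + n%:Z))
  (hbe : ~~ (p <= be <= p + n%:Z)).

Let pair (k : nat) (e : Omega) : R :=
  eta (k%:Z + x0 + al) e * eta (k%:Z + x0 + be) e.

Let pair_L2 k : L2 nu (pair k) /\ \int[nu]_e (pair k e ^+ 2) = s2 ^+ 2.
Proof. by apply: eta_pair_L2; lia. Qed.

(** Two translates of a pair of sites can share one site but not both. *)
Let pair_orth k l : k != l -> \int[nu]_e (pair k e * pair l e) = 0.
Proof.
move=> kl; rewrite /pair.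
have [kal|] := eqVneq (k%:Z + x0 + al) (l%:Z + x0 + be).
  transitivity (\int[nu]_e ((eta (l%:Z + x0 + al) e * eta (l%:Z + x0 + be) e) *
      (eta (k%:Z + x0 + al) e * eta (k%:Z + x0 + be) e))).
    by apply: eq_Rintegral => e _; ring.
  by apply: eta_pair_orthogonal; lia.
by move=> h; apply: eta_pair_orthogonal => //; lia.
Qed.

(** The spin labelled k crosses the bond labelled m. *)
Let crossed (m k : nat) : R := ((k <= m)%N && (m < k + n)%N)%:R.

Let crossed_telescope (a : nat -> R) k : (k < N)%N ->
  \sum_(m < N + n) crossed m k * (a m - a m.+1) = a k - a (k + n)%N.
Proof.
move=> kN.
rewrite -(big_mkord xpredT (fun m => crossed m k * (a m - a m.+1))).
transitivity (\sum_(k <= m < k + n) (a m - a m.+1)).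
  rewrite (@big_nat_widenl _ _ _ k 0)//.
  rewrite (@big_nat_widen _ _ _ 0 (k + n) (N + n)); last first.
    by rewrite leq_add2r ltnW.
  rewrite [RHS]big_mkcond; apply: eq_bigr => m _; rewrite /crossed /=.
  by case: ifP; rewrite ?mul1r ?mul0r.
rewrite -opprB -(telescope_sumr a (leq_addr n k)) -sumrN.
by apply: eq_bigr => m _; rewrite opprB.
Qed.

Let crossed_sum k : (k < N)%N -> \sum_(m < N + n) crossed m k = n%:R.
Proof.
move=> kN; have := crossed_telescope (fun m => - m%:R) kN.
have -> : - k%:R - - (k + n)%:R = n%:R :> R by rewrite natrD; ring.
move=> <-.
apply: eq_bigr => m _; rewrite -(natr1 m); ring.
Qed.

(** The coefficient of eta(z) - eta(z + 1) at z = site m, once the displacements of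
    all the spins have been decomposed into nearest neighbour steps. *)
Let coeff (m : nat) (e : Omega) : R := \sum_(k < N) (crossed m k * v k) * pair k e.

Let site (m : nat) : int := m%:Z + x0 + p.

Let coeff_L2 m : L2 nu (coeff m) /\
  \int[nu]_e (coeff m e ^+ 2) = s2 ^+ 2 * \sum_(k < N) crossed m k * v k ^+ 2.
Proof.
have LG k : L2 nu (fun e => (crossed m k * v k) * pair k e).
  by apply: L2Z; have [] := pair_L2 k.
split; first by apply: L2_sum => k; exact: LG.
rewrite (@Rint_sqr_sum _ _ _ nu N (fun k e => (crossed m k * v k) * pair k e))//.
rewrite mulr_sumr; apply: eq_bigr => k _.
rewrite (bigD1 k)//= [X in _ + X]big1 ?addr0; last first.
  move=> l lk.
  have [Lk _] := pair_L2 k; have [Ll _] := pair_L2 l.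
  transitivity ((crossed m k * v k * (crossed m l * v l)) *
    \int[nu]_e (pair k e * pair l e)).
    rewrite -(RintegralZl _ measurableT (L2_mul Lk Ll)).
    by apply: eq_Rintegral => e _; ring.
  by rewrite pair_orth ?mulr0// eq_sym.
have [Lk Ek] := pair_L2 k.
transitivity ((crossed m k * v k) ^+ 2 * \int[nu]_e (pair k e ^+ 2)).
  rewrite -(RintegralZl _ measurableT (L2_sqr Lk)).
  by apply: eq_Rintegral => e _; ring.
rewrite Ek /crossed; case: (_ && _); rewrite /=; ring.
Qed.

Let off (m : nat) : pred int := fun y => (y != site m) && (y != site m + 1).

(** The two spins at rest avoid the path of the moving one, in particular the
    two ends of each bond that it crosses. *)
Let coeff_depends m : depends (off m) (coeff m).
Proof.
apply: depends_sum => k _ e e' h; rewrite /crossed.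
have [/andP[km mk]|] := boolP (_ && _); last by rewrite !mul0r.
rewrite /pair; congr (_ * (_ * _)).
  by apply: depends_eta => y /= /eqP ->; apply: h; rewrite /off /site /=; lia.
by apply: depends_eta => y /= /eqP ->; apply: h; rewrite /off /site /=; lia.
Qed.

Let coeff_exchange m e : coeff m (permute (swap (site m)) e) = coeff m e.
Proof.
apply: coeff_depends => y /andP[y1 y2]; rewrite /permute /swap.
by rewrite (negbTE y1) (negbTE y2).
Qed.

Let Delta (m : nat) (e : Omega) : R := eta (site m) e - eta (site m + 1) e.

Let Delta_exchange m e : Delta m (permute (swap (site m)) e) = - Delta m e.
Proof.
rewrite /Delta /spin_bar /spin /permute /swap eqxx.
have -> : (site m + 1 == site m) = false by apply/eqP; lia.
by rewrite eqxx; ring.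
Qed.

Let Delta_L2 m : L2 nu (Delta m) /\ \int[nu]_e (Delta m e ^+ 2) = 2 * s2.
Proof.
have L1 := eta_L2 H (site m); have L2' := eta_L2 H (site m + 1).
split; first exact: L2B.
transitivity (\int[nu]_e (eta (site m) e ^+ 2 +
   (-2 * (eta (site m) e * eta (site m + 1) e) + eta (site m + 1) e ^+ 2))).
  by apply: eq_Rintegral => e _; rewrite /Delta; ring.
have I12 := L2_mul L1 L2'.
rewrite (RintegralD measurableT (L2_sqr L1)
  (integrableRD (integrableRZ _ I12) (L2_sqr L2'))).
rewrite (RintegralD measurableT (integrableRZ _ I12) (L2_sqr L2')).
rewrite (RintegralZl _ measurableT I12).
have ns : ~~ pred1 (site m + 1) (site m) by apply/eqP; lia.
rewrite (single_site ns (@depends_eta _ _ _ ev rho _) (eta_int H _)).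
by rewrite !(momentE H)//; ring.
Qed.

Let coeff_Delta_L2 m : L2 nu (fun e => coeff m e * Delta m e) /\
  \int[nu]_e ((coeff m e * Delta m e) ^+ 2) =
  2 * s2 ^+ 3 * \sum_(k < N) crossed m k * v k ^+ 2.
Proof.
have [LQ EQ] := coeff_L2 m; have [LD ED] := Delta_L2 m.
have DD : depends (fun y => (y == site m) || (y == site m + 1)) (Delta m).
  move=> e e' h; rewrite /Delta; congr (_ - _).
    by apply: depends_eta => y /= /eqP ->; apply: h; rewrite eqxx.
  by apply: depends_eta => y /= /eqP ->; apply: h; rewrite eqxx orbT.
have := L2_independence H _ (@coeff_depends m) DD LQ LD.
rewrite EQ ED => /(_ _)[|LQD ->].
  by move=> y /andP[y1 y2]; rewrite negb_or y1 y2.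
by split => //; ring.
Qed.

Let transportE e :
  \sum_(k < N) v k * (eta (k%:Z + x0 + al) e * eta (k%:Z + x0 + be) e *
    (eta (k%:Z + x0 + p) e - eta (k%:Z + x0 + p + n%:Z) e)) =
  \sum_(m < N + n) coeff m e * Delta m e.
Proof.
pose a (m : nat) := eta (site m) e.
transitivity (\sum_(k < N) \sum_(m < N + n)
    (crossed m k * v k) * pair k e * (a m - a m.+1)).
  apply: eq_bigr => k _.
  transitivity (v k * pair k e * (a k - a (k + n)%N)).
    have -> : a (k + n)%N = eta (k%:Z + x0 + p + n%:Z) e.
      by rewrite /a; congr (spin_bar ev rho _ e); rewrite /site PoszD; lia.
    by rewrite /a /site /pair mulrA.
  rewrite -(crossed_telescope a (ltn_ord k)) mulr_sumr.
  by apply: eq_bigr => m _; ring.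
rewrite exchange_big; apply: eq_bigr => m _; rewrite /coeff mulr_suml.
have -> : a m.+1 = eta (site m + 1) e.
  by rewrite /a; congr (spin_bar ev rho _ e); rewrite /site; lia.
by [].
Qed.

Lemma transport_L2 : L2 nu (fun e =>
  \sum_(k < N) v k * (eta (k%:Z + x0 + al) e * eta (k%:Z + x0 + be) e *
    (eta (k%:Z + x0 + p) e - eta (k%:Z + x0 + p + n%:Z) e))).
Proof.
apply: eq_L2 (fun e => esym (transportE e)) _.
by apply: L2_sum => m; have [] := coeff_Delta_L2 m.
Qed.

(** Moving a spin along n bonds costs n, not n^2, because the coefficient of the
    difference across a given bond is a sum of orthogonal variables. The
    exchange across a bond preserves the measure and the coefficient and changes the
    sign of the difference, which makes the gradient of f appear with a factor 1/2. *)
Lemma transport_bound (f : Omega -> R) (E kappa : R) : 0 < kappa -> L2 nu f ->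
  (forall (M : nat) (z : int),
     \sum_(m < M) \int[nu]_e (gradient (m%:Z + z) f e ^+ 2) <= E) ->
  2 * \int[nu]_e ((\sum_(k < N) v k *
     (eta (k%:Z + x0 + al) e * eta (k%:Z + x0 + be) e *
      (eta (k%:Z + x0 + p) e - eta (k%:Z + x0 + p + n%:Z) e))) * f e) <=
  n%:R * s2 ^+ 3 / kappa * (\sum_(k < N) v k ^+ 2) + kappa / 2 * E.
Proof.
move=> k0 Lf hE.
have LQD m := (coeff_Delta_L2 m).1.
have bond m : 2 * \int[nu]_e (coeff m e * Delta m e * f e) <=
    kappa^-1 * (s2 ^+ 3 * \sum_(k < N) crossed m k * v k ^+ 2) +
    kappa / 2 * \int[nu]_e (gradient (m%:Z + (x0 + p)) f e ^+ 2).
  have Em : m%:Z + (x0 + p) = site m by rewrite /site addrA.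
  rewrite Em; have Lg := gradient_L2 (site m) Lf.
  have Lfx := L2_exchange (site m) Lf.
  have IQ := L2_mul (LQD m) Lf.
  have IQx := L2_mul (LQD m) Lfx.
  have anti : \int[nu]_e (coeff m e * Delta m e * f e) =
      - \int[nu]_e (coeff m e * Delta m e * f (Defs.exchange (site m) (site m + 1) e)).
    have Ex e : coeff m (permute (swap (site m)) e) * Delta m (permute (swap (site m)) e) *
        f (permute (swap (site m)) e) =
        -1 * (coeff m e * Delta m e * f (Defs.exchange (site m) (site m + 1) e)).
      by rewrite coeff_exchange Delta_exchange exchangeE; ring.
    rewrite -(Rint_permute hprod htrans (swapK (site m))); last 2 first.
    - exact: integrableR_meas IQ.
    - exact: eq_integrableR (fun e => esym (Ex e)) (integrableRZ _ IQx).
    rewrite -[RHS]mulN1r -(RintegralZl _ measurableT IQx).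
    by apply: eq_Rintegral => e _; exact: Ex.
  have E2 : 2 * \int[nu]_e (coeff m e * Delta m e * f e) =
      \int[nu]_e ((- (coeff m e * Delta m e)) * gradient (site m) f e).
    rewrite mulr_natl mulr2n {1}anti addrC -(RintegralB measurableT IQ IQx).
    by apply: eq_Rintegral => e _; rewrite /gradient; ring.
  have := L2_young k0 (L2N (LQD m)) Lg; rewrite -E2.
  have -> : \int[nu]_e ((- (coeff m e * Delta m e)) ^+ 2) =
     2 * s2 ^+ 3 * \sum_(k < N) crossed m k * v k ^+ 2.
    rewrite -(coeff_Delta_L2 m).2.
    by apply: eq_Rintegral => e _; rewrite sqrrN.
  move: (\int[nu]_e (coeff m e * Delta m e * f e)) (\int[nu]_e (gradient _ _ _ ^+ 2)).
  move: (\sum_(k < N) crossed m k * v k ^+ 2) (s2 ^+ 3) => s c a b h.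
  rewrite -(ler_pM2l (ltr0Sn R 1)).
  apply: (le_trans h); rewrite le_eqVlt; apply/orP; left; apply/eqP; field.
  by rewrite gt_eqF.
have -> : \int[nu]_e ((\sum_(k < N) v k *
     (eta (k%:Z + x0 + al) e * eta (k%:Z + x0 + be) e *
      (eta (k%:Z + x0 + p) e - eta (k%:Z + x0 + p + n%:Z) e))) * f e) =
   \sum_(m < N + n) \int[nu]_e (coeff m e * Delta m e * f e).
  rewrite -(@Rint_sum _ _ _ nu _ _
    (fun (m : 'I_(N + n)) e => coeff m e * Delta m e * f e)); last first.
    by move=> m; exact: L2_mul.
  by apply: eq_Rintegral => e _; rewrite transportE mulr_suml.
rewrite mulr_sumr.
apply: (le_trans (y := \sum_(m < N + n)
    (kappa^-1 * (s2 ^+ 3 * \sum_(k < N) crossed m k * v k ^+ 2) +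
     kappa / 2 * \int[nu]_e (gradient (m%:Z + (x0 + p)) f e ^+ 2)))).
  by apply: ler_sum => m _; exact: bond.
rewrite big_split /= -!mulr_sumr; apply: lerD; last first.
  apply: ler_wpM2l; last exact: hE.
  by rewrite divr_ge0// ltW.
rewrite le_eqVlt; apply/orP; left; apply/eqP.
(* Each spin crosses exactly n bonds. *)
have -> : \sum_(m < N + n) \sum_(k < N) crossed m k * v k ^+ 2 =
    n%:R * \sum_(k < N) v k ^+ 2.
  rewrite exchange_big mulr_sumr; apply: eq_bigr => k _.
  by rewrite -mulr_suml crossed_sum.
by ring.
Qed.

End transport.

End displacement.

(** * From three neighbouring spins to three block averages *)

Section statics.
Context {R : realType} {d : measure_display} {X : measurableType d}.
Local Notation Omega := (config X).
Variables (nu : probability Omega R) (ev : X -> R) (rho : R).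
Hypothesis H : product_field nu ev rho.
Local Notation eta := (spin_bar ev rho).
Local Notation s2 := (moment nu ev rho 2).
Variable L : nat.
Hypothesis L0 : (0 < L)%N.
Local Notation avg := (right_average ev rho L).

Definition triple (x : int) (e : Omega) : R := eta (x - 1) e * eta x e * eta (x + 1) e.

(** The product of three block averages is the mean of these products over the
    choice of one site in each block. *)
Let target (t : 'I_L * 'I_L * 'I_L) (x : int) (e : Omega) : R :=
  eta (x - L%:Z + t.1.1%:Z) e * eta (x + 1 + t.1.2%:Z) e *
  eta (x + L%:Z + 1 + t.2%:Z) e.

Let blockE x e : block ev rho L x e = (L%:R ^+ 3)^-1 * \sum_t target t x e.
Proof.
rewrite /block !right_averageE.
have -> : \sum_t target t x e =
    partial_sum ev rho L (x - L%:Z - 1) e * partial_sum ev rho L x e *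
    partial_sum ev rho L (x + L%:Z) e.
  rewrite /target -(pair_bigA _ (fun (p : 'I_L * 'I_L) (k : 'I_L) =>
    eta (x - L%:Z + p.1%:Z) e *
    eta (x + 1 + p.2%:Z) e * eta (x + L%:Z + 1 + k%:Z) e))/=.
  rewrite -(pair_bigA _ (fun i j : 'I_L => \sum_(k < L) eta (x - L%:Z + i%:Z) e *
    eta (x + 1 + j%:Z) e * eta (x + L%:Z + 1 + k%:Z) e))/=.
  rewrite /partial_sum big_distrlr/= mulr_suml; apply: eq_bigr => i _.
  rewrite mulr_suml; apply: eq_bigr => j _.
  rewrite mulr_sumr; apply: eq_bigr => k _.
  by congr (spin_bar ev rho _ e * spin_bar ev rho _ e * spin_bar ev rho _ e); lia.
have : L%:R != 0 :> R by rewrite pnatr_eq0 -lt0n.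
by move=> ?; field.
Qed.

Variables (x0 : int) (N : nat) (v : nat -> R).

(** One displacement, in the form of transport_bound. *)
Let leg (al be p : int) (n : nat) (w : nat -> R) (e : Omega) : R :=
  \sum_(k < N) w k * (eta (k%:Z + x0 + al) e * eta (k%:Z + x0 + be) e *
    (eta (k%:Z + x0 + p) e - eta (k%:Z + x0 + p + n%:Z) e)).

(** The right spin moves first, then the middle one and then the left one, so that
    each path is disjoint from the two sites at rest. *)
Let legs t e : \sum_(k < N) v k * (triple (k%:Z + x0) e - target t (k%:Z + x0) e) =
  leg (-1) 0 1 (L + t.2) v e +
  (leg (-1) (L%:Z + 1 + t.2%:Z) 0 (1 + t.1.2) v e +
   leg (1 + t.1.2%:Z) (L%:Z + 1 + t.2%:Z) (- L%:Z + t.1.1%:Z) (L - 1 - t.1.1)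
     (fun k => - v k) e).
Proof.
case: t => [[i j] k]; rewrite /leg -!big_split /=; apply: eq_bigr => m _.
set y := m%:Z + x0; rewrite /triple /target /=.
have hi := ltn_ord i.
have -> : y + 1 + (L + k)%N%:Z = y + L%:Z + 1 + k%:Z by rewrite PoszD; lia.
have -> : y + (L%:Z + 1 + k%:Z) = y + L%:Z + 1 + k%:Z by lia.
have -> : y + 0 + (1 + j)%N%:Z = y + 1 + j%:Z by rewrite PoszD; lia.
have -> : y + (1 + j%:Z) = y + 1 + j%:Z by lia.
have -> : y + (- L%:Z + i%:Z) + (L - 1 - i)%N%:Z = y - 1 by lia.
have -> : y + (- L%:Z + i%:Z) = y - L%:Z + i%:Z by lia.
by rewrite addr0; ring.
Qed.

Let legs_L2 (t : 'I_L * 'I_L * 'I_L) : [/\ L2 nu (leg (-1) 0 1 (L + t.2) v),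
  L2 nu (leg (-1) (L%:Z + 1 + t.2%:Z) 0 (1 + t.1.2) v) &
  L2 nu (leg (1 + t.1.2%:Z) (L%:Z + 1 + t.2%:Z) (- L%:Z + t.1.1%:Z) (L - 1 - t.1.1)
     (fun k => - v k))].
Proof.
case: t => [[i j] k]/=.
have hi := ltn_ord i. have hj := ltn_ord j.
by split; apply: (transport_L2 H); lia.
Qed.

(** The three displacements have total length at most 4 L. *)
Let target_bound (t : 'I_L * 'I_L * 'I_L) (f : Omega -> R) (E kappa : R) :
  0 < kappa -> L2 nu f ->
  (forall (M : nat) (z : int),
     \sum_(m < M) \int[nu]_e (gradient (m%:Z + z) f e ^+ 2) <= E) ->
  2 * \int[nu]_e ((\sum_(k < N) v k *
    (triple (k%:Z + x0) e - target t (k%:Z + x0) e)) * f e) <=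
  4 * L%:R * s2 ^+ 3 / kappa * (\sum_(k < N) v k ^+ 2) + 3 * (kappa / 2 * E).
Proof.
move=> k0 Lf hE; have [L1 L2' L3] := legs_L2 t.
have -> : \int[nu]_e ((\sum_(k < N) v k *
    (triple (k%:Z + x0) e - target t (k%:Z + x0) e)) * f e) =
  \int[nu]_e (leg (-1) 0 1 (L + t.2) v e * f e) +
  (\int[nu]_e (leg (-1) (L%:Z + 1 + t.2%:Z) 0 (1 + t.1.2) v e * f e) +
   \int[nu]_e (leg (1 + t.1.2%:Z) (L%:Z + 1 + t.2%:Z) (- L%:Z + t.1.1%:Z)
     (L - 1 - t.1.1) (fun k => - v k) e * f e)).
  rewrite -(RintegralD measurableT (L2_mul L2' Lf) (L2_mul L3 Lf)).
  rewrite -(RintegralD measurableT (L2_mul L1 Lf)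
    (integrableRD (L2_mul L2' Lf) (L2_mul L3 Lf))).
  by apply: eq_Rintegral => e _; rewrite legs; ring.
case: t L1 L2' L3 => [[i j] k] /= _ _ _.
have hi := ltn_ord i. have hj := ltn_ord j. have hk := ltn_ord k.
have := @transport_bound _ _ _ nu ev rho H (-1) 0 1 x0 (L + k) N v _ _ _ f E kappa
  k0 Lf hE.
have := @transport_bound _ _ _ nu ev rho H (-1) (L%:Z + 1 + k%:Z) 0 x0 (1 + j) N v
  _ _ _ f E kappa k0 Lf hE.
have := @transport_bound _ _ _ nu ev rho H (1 + j%:Z) (L%:Z + 1 + k%:Z)
  (- L%:Z + i%:Z) x0 (L - 1 - i) N (fun k => - v k) _ _ _ f E kappa k0 Lf hE.
move=> /(_ ltac:(lia) ltac:(lia) ltac:(lia)) b3.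
move=> /(_ ltac:(lia) ltac:(lia) ltac:(lia)) b2.
move=> /(_ ltac:(lia) ltac:(lia) ltac:(lia)) b1.
rewrite !mulrDr; apply: (le_trans (lerD b1 (lerD b2 b3))).
have -> : \sum_(k < N) (- v k) ^+ 2 = \sum_(k < N) v k ^+ 2.
  by apply: eq_bigr => m _; rewrite sqrrN.
set S := \sum_(k < N) v k ^+ 2; set q := s2 ^+ 3 / kappa * S.
have q0 : 0 <= q.
  apply: mulr_ge0; last by apply: sumr_ge0 => m _; exact: sqr_ge0.
  by apply: divr_ge0; [apply: exprn_ge0; exact: s2_ge0|exact: ltW].
have h4 : (L + k)%:R + ((1 + j)%:R + (L - 1 - i)%:R) <= 4 * L%:R :> R.
  by rewrite -!natrD -natrM ler_nat; lia.
have := ler_wpM2r q0 h4.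
rewrite (_ : 4 * L%:R * s2 ^+ 3 / kappa * S = 4 * L%:R * q); last by rewrite /q; ring.
move=> hq; apply: (le_trans _ (lerD hq (lexx _))); rewrite le_eqVlt; apply/orP; left.
by apply/eqP; rewrite /q; ring.
Qed.

Let target_L2 t : L2 nu (fun e => \sum_(k < N) v k *
  (triple (k%:Z + x0) e - target t (k%:Z + x0) e)).
Proof.
apply: eq_L2 (fun e => esym (legs t e)) _; have [? ? ?] := legs_L2 t.
by apply: L2D => //; exact: L2D.
Qed.

Let triplesE : \sum_(t : 'I_L * 'I_L * 'I_L) (1 : R) = L%:R ^+ 3.
Proof. by rewrite sumr_const !card_prod !card_ord !natrM; ring. Qed.

Let block_meanE e :
  \sum_(k < N) v k * (triple (k%:Z + x0) e - block ev rho L (k%:Z + x0) e) =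
  (L%:R ^+ 3)^-1 * \sum_t \sum_(k < N) v k *
    (triple (k%:Z + x0) e - target t (k%:Z + x0) e).
Proof.
rewrite exchange_big mulr_sumr; apply: eq_bigr => k _ /=.
rewrite -mulr_sumr sumrB blockE.
have -> : \sum_(t : 'I_L * 'I_L * 'I_L) triple (k%:Z + x0) e =
    L%:R ^+ 3 * triple (k%:Z + x0) e.
  by rewrite -triplesE mulr_suml; apply: eq_bigr => t _; rewrite mul1r.
by field; rewrite pnatr_eq0 -lt0n.
Qed.

Lemma block_diff_L2 : L2 nu (fun e =>
  \sum_(k < N) v k * (triple (k%:Z + x0) e - block ev rho L (k%:Z + x0) e)).
Proof.
apply: eq_L2 (fun e => esym (block_meanE e)) _; apply: L2Z.
by apply: L2_sum => t; exact: target_L2.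
Qed.

(** The product of block averages is the mean of the targets, so the bound for a
    single target is inherited by linearity. *)
Lemma block_bound (f : Omega -> R) (E kappa : R) :
  0 < kappa -> L2 nu f ->
  (forall (M : nat) (z : int),
     \sum_(m < M) \int[nu]_e (gradient (m%:Z + z) f e ^+ 2) <= E) ->
  2 * \int[nu]_e ((\sum_(k < N) v k *
    (triple (k%:Z + x0) e - block ev rho L (k%:Z + x0) e)) * f e) <=
  4 * L%:R * s2 ^+ 3 / kappa * (\sum_(k < N) v k ^+ 2) + 3 * (kappa / 2 * E).
Proof.
move=> k0 Lf hE.
set B := (X in _ <= X).
have -> : \int[nu]_e ((\sum_(k < N) v k *
    (triple (k%:Z + x0) e - block ev rho L (k%:Z + x0) e)) * f e) =
  (L%:R ^+ 3)^-1 * \sum_t \int[nu]_e ((\sum_(k < N) v k *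
    (triple (k%:Z + x0) e - target t (k%:Z + x0) e)) * f e).
  have I t := L2_mul (target_L2 t) Lf.
  rewrite -(Rint_sum _ I) -(RintegralZl _ measurableT (integrableR_sum _ I)).
  apply: eq_Rintegral => e _; rewrite -mulr_suml mulrA; congr (_ * _).
  exact: block_meanE.
rewrite mulrCA mulr_sumr.
have L3 : 0 < L%:R ^+ 3 :> R by rewrite exprn_gt0 ?ltr0n.
rewrite mulrC ler_pdivrMr//.
rewrite -triplesE mulr_sumr; apply: ler_sum => t _; rewrite mulr1.
exact: target_bound.
Qed.

End statics.

(** * Series over the sites and the Dirichlet form *)

Section series.
Context {R : realType}.

Lemma esum_ge_partial (f : int -> \bar R) (x0 : int) (n : nat) :
  (forall z, 0 <= f z)%E ->
  (\sum_(k < n) f (k%:Z + x0)%R <= \esum_(z in [set: int]) f z)%E.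
Proof.
move=> f0; pose s := [seq k%:Z + x0 | k <- iota 0 n].
have us : uniq s by rewrite map_inj_uniq ?iota_uniq// => i j; lia.
apply: esum_ge; exists [set` s]; first by split => //; exact: finite_seq.
rewrite -fsbig_seq// /s big_map -(big_mkord xpredT (fun k => f (k%:Z + x0))).
by rewrite /index_iota subn0.
Qed.

Lemma ell2_partial (v : int -> R) (x0 : int) (n : nat) : ell2 v ->
  \sum_(k < n) v (k%:Z + x0) ^+ 2 <=
  fine (\esum_(x in [set: int]) ((v x) ^+ 2)%:E)%E.
Proof.
move=> vfin; rewrite -lee_fin fineK; last first.
  by rewrite ge0_fin_numE// esum_ge0// => x _; rewrite lee_fin sqr_ge0.
rewrite -sumEFin; apply: (@esum_ge_partial (fun x => ((v x) ^+ 2)%:E) x0 n) => z.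
by rewrite lee_fin sqr_ge0.
Qed.

Context {d : measure_display} {S : measurableType d} (nu : probability S R).

(** A divergent series has sum 0 by convention, whence the alternative; both cases
    obey the final bound. *)
Lemma L2_sumZ_approx (F : int -> S -> R) :
  (forall N, L2 nu (fun x => \sum_(k < N.*2.+1) F (k%:Z - N%:Z) x)) ->
  L2 nu (L2_sumZ nu F) /\ (L2_sumZ nu F = cst 0 \/
  forall e : R, 0 < e -> exists N, \int[nu]_x
    ((L2_sumZ nu F x - \sum_(k < N.*2.+1) F (k%:Z - N%:Z) x) ^+ 2) < e).
Proof.
move=> LF; rewrite /L2_sumZ; case: xgetP => [G _ [LG cvG]|_]; last first.
  by split; [exact: L2_cst|left].
split => //; right => e e0.
have cvG' : L2dist nu (fun x => \sum_(k < N.*2.+1) F (k%:Z - N%:Z) x) G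
    @[N --> \oo] --> 0%E.
  apply: cvg_trans cvG; apply: near_eq_cvg; near=> N.
  rewrite !L2distE//; congr (Num.sqrt _)%:E.
  by apply: eq_Rintegral => x _; rewrite -sqrrN opprB.
have [h _] := @L2dist_cvgP _ _ _ nu _ \oo _
  (fun N x => \sum_(k < N.*2.+1) F (k%:Z - N%:Z) x) G (nearW _ LF) LG.
have [N _ hN] := h cvG' e e0.
exists N; have := hN N (leqnn N); rewrite /= => {}hN.
apply: le_lt_trans hN; rewrite le_eqVlt; apply/orP; left; apply/eqP.
by apply: eq_Rintegral => x _; rewrite -sqrrN opprB.
Unshelve. all: by end_near. Qed.

End series.

Section dirichlet.
Context {R : realType} {d : measure_display} {X : measurableType d}.
Local Notation Omega := (config X).
Variables (nu : probability Omega R) (ev : X -> R) (rho : R).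
Hypothesis H : product_field nu ev rho.

Lemma measurable_shift (z : int) : measurable_fun setT (Defs.shift z : Omega -> Omega).
Proof. by apply: measurable_config => x; exact: measurable_coord. Qed.

(** Ellipticity and positivity of the terms of the Dirichlet form. *)
Lemma gradients_le_dirichlet (zeta : Omega -> R) (delta D : R) (f : Omega -> R) :
  0 < delta -> measurable_fun setT zeta ->
  (forall e, delta <= zeta e) -> L2 nu f ->
  D%:E = (\esum_(z in [set: int]) bond_form nu zeta z f)%E ->
  forall (M : nat) (z : int),
    \sum_(m < M) \int[nu]_e (gradient (m%:Z + z) f e ^+ 2) <= D / delta.
Proof.
move=> d0 mzeta zetad Lf DE M z.
have Lg y : L2 nu (gradient y f) by exact: (gradient_L2 H).
have bond y : ((delta * \int[nu]_e (gradient y f e ^+ 2))%:E <=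
    bond_form nu zeta y f)%E.
  rewrite -(RintegralZl _ measurableT (L2_sqr (Lg y))) /Rintegral fineK; last first.
    exact: integrable_fin_num (integrableRZ _ (L2_sqr (Lg y))).
  apply: ge0_le_integral => //.
  - by move=> e _; rewrite lee_fin mulr_ge0// ?sqr_ge0// ltW.
  - by apply/measurable_EFinP; exact: integrableR_meas (integrableRZ _ (L2_sqr (Lg y))).
  - apply/measurable_EFinP; apply: measurable_funM.
      by apply: measurableT_comp => //; exact: measurable_shift.
    exact: integrableR_meas (L2_sqr (Lg y)).
  - by move=> e _; rewrite lee_fin; apply: ler_wpM2r => //; exact: sqr_ge0.
rewrite ler_pdivlMr// mulrC mulr_sumr -lee_fin DE -sumEFin.
apply: (@le_trans _ _ (\sum_(m < M) bond_form nu zeta (m%:Z + z) f)%E).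
  by apply: lee_sum => m _; exact: bond.
apply: (@esum_ge_partial _ (fun y => bond_form nu zeta y f)) => y.
apply: integral_ge0 => e _; rewrite lee_fin mulr_ge0 ?sqr_ge0//.
by rewrite (le_trans (ltW d0)).
Qed.

End dirichlet.

(** * The third-order Boltzmann-Gibbs principle *)

Section cubic_field.
Context {R : realType} {d : measure_display} {X : measurableType d}.
Local Notation Omega := (config X).
Variables (nu : probability Omega R) (ev : X -> R) (rho : R).
Hypothesis H : product_field nu ev rho.
Local Notation s2 := (moment nu ev rho 2).
Variable L : nat.
Hypothesis L0 : (0 < L)%N.

Lemma remainder_constant_ge0 : 0 <= remainder_constant nu ev rho.
Proof.
have L3 : 0 < (L%:R ^+ 3)^-1 :> R by rewrite invr_gt0 exprn_gt0// ltr0n.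
rewrite -(pmulr_lge0 _ L3); apply: le_trans (remainder_sqr H L0 0).
exact: Rint_sqr_ge0.
Qed.

Definition cubic (v : int -> R) (x : int) (e : Omega) : R :=
  v x * (spin_bar ev rho (x - 1) e * spin_bar ev rho x e
           * spin_bar ev rho (x + 1) e
         - right_average ev rho L x e ^+ 3
         + third_moment ev nu rho / L%:R ^+ 2).

Variable v : int -> R.
Hypothesis ell2v : ell2 v.
Let S := fine (\esum_(x in [set: int]) ((v x) ^+ 2)%:E)%E.

Let V1 (N : nat) (e : Omega) := \sum_(k < N.*2.+1) v (k%:Z - N%:Z) *
  (triple ev rho (k%:Z - N%:Z) e - block ev rho L (k%:Z - N%:Z) e).

Let V2 (N : nat) (e : Omega) := \sum_(k < N.*2.+1) v (k%:Z - N%:Z) *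
  remainder nu ev rho L (k%:Z - N%:Z) e.

Let V1_L2 N : L2 nu (V1 N).
Proof. exact: (block_diff_L2 H L0 (- N%:Z) N.*2.+1 (fun k => v (k%:Z - N%:Z))). Qed.

Let V2_L2 N : L2 nu (V2 N).
Proof. by apply: L2_sum => k; apply: L2Z; exact: (remainder_L2 H L0). Qed.

Let cubic_split N e : \sum_(k < N.*2.+1) cubic v (k%:Z - N%:Z) e = V1 N e + V2 N e.
Proof.
rewrite -big_split/=; apply: eq_bigr => k _.
by rewrite /cubic /remainder /triple /xi; ring.
Qed.

Let cubic_L2 N : L2 nu (fun e => \sum_(k < N.*2.+1) cubic v (k%:Z - N%:Z) e).
Proof. by apply: eq_L2 (fun e => esym (cubic_split N e)) _; exact: L2D. Qed.

Lemma cubic_sum_L2 : L2 nu (L2_sumZ nu (cubic v)).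
Proof. exact: (L2_sumZ_approx cubic_L2).1. Qed.

(** Up to an arbitrarily small error in L^2, the field splits into a part V that
    the gradients control and a part of small variance. When the series diverges
    its sum is 0, and V = 0 will do. *)
Lemma cubic_decomposition (e0 : R) : 0 < e0 -> exists V : Omega -> R,
  [/\ L2 nu V,
      \int[nu]_e ((L2_sumZ nu (cubic v) e - V e) ^+ 2) <=
        16 * remainder_constant nu ev rho / L%:R ^+ 2 * S + e0 &
      forall (f : Omega -> R) (E kappa : R), 0 < kappa -> L2 nu f ->
        (forall (M : nat) (z : int),
           \sum_(m < M) \int[nu]_e (gradient (m%:Z + z) f e ^+ 2) <= E) ->
        2 * \int[nu]_e (V e * f e) <=
        4 * L%:R * s2 ^+ 3 / kappa * S + 3 * (kappa / 2 * E)].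
Proof.
move=> e00.
have L2r : 0 <= L%:R ^+ 2 :> R by rewrite exprn_ge0.
have partialS N : \sum_(k < N.*2.+1) v (k%:Z - N%:Z) ^+ 2 <= S by exact: ell2_partial.
have S0 : 0 <= S by apply: le_trans (partialS 0); apply: sumr_ge0 => k _; exact: sqr_ge0.
have s20 : 0 <= 4 * L%:R * s2 ^+ 3.
  by apply: mulr_ge0; [rewrite mulr_ge0|apply: exprn_ge0; exact: s2_ge0].
have C0 := remainder_constant_ge0.
have [LG [G0|approx]] := L2_sumZ_approx cubic_L2.
  exists (cst 0); split; first exact: L2_cst.
    rewrite G0 /= subrr expr0n/= Rint_cst addr_ge0 ?(ltW e00)//.
    by apply: mulr_ge0 => //; apply: divr_ge0 => //; exact: mulr_ge0.
  move=> f E kappa k0 Lf hE.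
  rewrite [X in 2 * X](_ : _ = 0); last first.
    by rewrite -[RHS](Rint_cst nu); apply: eq_Rintegral => e _; rewrite /= mul0r.
  have E0 : 0 <= E by have := hE 0%N 0; rewrite big_ord0.
  have k0' := ltW k0; rewrite mulr0 addr_ge0//.
    by apply: mulr_ge0 => //; exact: divr_ge0.
  by apply: mulr_ge0 => //; apply: mulr_ge0 => //; exact: divr_ge0.
have e20 : 0 < e0 / 2 by rewrite divr_gt0.
have [N hN] := approx _ e20.
exists (V1 N); split; first exact: V1_L2.
  have Lrest : L2 nu (fun e => L2_sumZ nu (cubic v) e -
      \sum_(k < N.*2.+1) cubic v (k%:Z - N%:Z) e) by exact: L2B.
  have := sqr_intD Lrest (V2_L2 N).
  have -> : \int[nu]_e ((L2_sumZ nu (cubic v) e -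
      \sum_(k < N.*2.+1) cubic v (k%:Z - N%:Z) e + V2 N e) ^+ 2) =
    \int[nu]_e ((L2_sumZ nu (cubic v) e - V1 N e) ^+ 2).
    by apply: eq_Rintegral => e _; rewrite cubic_split; congr (_ ^+ 2); ring.
  move=> h; apply: (le_trans h); rewrite addrC; apply: lerD; last first.
    by rewrite mulrC -ler_pdivlMr// ltW.
  have := remainder_sum_sqr H L0 (- N%:Z) (fun k => v (k%:Z - N%:Z)) N.*2.+1.
  move=> h2; rewrite -[X in _ <= X](@mulfVK _ 2)// [X in _ <= X]mulrC ler_pM2l//.
  apply: (le_trans h2).
  have -> : 16 * remainder_constant nu ev rho / L%:R ^+ 2 * S / 2 =
    8 * remainder_constant nu ev rho / L%:R ^+ 2 * S by field; rewrite pnatr_eq0 -lt0n.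
  by apply: ler_wpM2l; [rewrite divr_ge0// mulr_ge0|exact: partialS].
move=> f E kappa k0 Lf hE.
apply: (le_trans (block_bound H L0 (- N%:Z) N.*2.+1 (fun k => v (k%:Z - N%:Z))
  k0 Lf hE)).
by rewrite lerD2r; apply: ler_wpM2l; [rewrite divr_ge0// ltW|exact: partialS].
Qed.

End cubic_field.

Theorem theorem5 (R : realType) (d : measure_display) (X : measurableType d)
  (ev : X -> R) (hev : measurable_fun setT ev) (hev_inj : injective ev)
  (a : R) (ha : 0 < a)
  (eta : nat -> markov_process R (config X))
  (I : set R) (nu : R -> probability (config X) R)
  (hA1 : assumption_A1 ev I nu eta)
  (rho : R) (hrho : I rho)
  (Dom : nat -> set (config X -> R))
  (Ln Lnstar : nat -> (config X -> R) -> config X -> R)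
  (hdyn : markov_dynamics a (nu rho) eta Dom Ln Lnstar)
  (js ja : nat -> int -> config X -> R)
  (hcur : are_currents ev (nu rho) Dom Ln Lnstar js ja)
  (hA2 : assumption_A2 (nu rho) Dom Ln)
  (hA3 : assumption_A3 ev a rho (nu rho) eta js ja) :
  exists2 C : R, 0 < C &
  forall (n L : nat) (t : R) (v : int -> R),
    (0 < n)%N -> (0 < L)%N -> 0 < t -> ell2 v ->
    (expectation_from (nu rho) (Y := eta n) (fun w =>
       ((\int[lebesgue_measure]_(s in `[0, t])
          L2_sumZ (nu rho)
            (fun x e => v x *
               (spin_bar ev rho (x - 1) e * spin_bar ev rho x e
                  * spin_bar ev rho (x + 1) e
                - right_average ev rho L x e ^+ 3
                + third_moment ev (nu rho) rho / L%:R ^+ 2))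
            (traj (eta n) (s * n%:R `^ a) w)) ^+ 2)%:E)
     <= (C * t * (L%:R / n%:R `^ (a - 1) + t * n%:R / L%:R ^+ 2)
         * sqnorm2n n v)%:E)%E.
Proof.
have [inv prod trans mean mom] := hA1 _ hrho.
have H : product_field (nu rho) ev rho by split.
have [delta d0 [zeta hzeta]] := hA2.
pose s2 := moment (nu rho) ev rho 2; pose Cr := remainder_constant (nu rho) ev rho.
have s20 : 0 <= s2 ^+ 3 by apply: exprn_ge0; exact: s2_ge0.
have Cr0 : 0 <= Cr by exact: (remainder_constant_ge0 H (isT : (0 < 1)%N)).
pose C := 24 * s2 ^+ 3 / delta + 64 * Cr + 1.
have Cs : 24 * s2 ^+ 3 / delta <= C.
  by rewrite /C -addrA lerDl addr_ge0// mulr_ge0.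
have s2d : 0 <= 24 * s2 ^+ 3 / delta by apply: divr_ge0; [exact: mulr_ge0|exact: ltW].
have Cc : 64 * Cr <= C by rewrite /C -addrA addrCA lerDl addr_ge0.
exists C; first by rewrite /C ltr_wpDl// addr_ge0// mulr_ge0.
move=> n L t v n0 L0 t0 ell2v.
pose S := fine (\esum_(x in [set: int]) ((v x) ^+ 2)%:E)%E.
have S0 : 0 <= S.
  by apply: fine_ge0; apply: esum_ge0 => x _; rewrite lee_fin sqr_ge0.
have [dom gen _] := hdyn n n0; have [local_dom _ _] := dom.
have [mzeta zetab DE] := hzeta n n0.
pose c := n%:R `^ a; have c0 : 0 < c by rewrite powR_gt0// ltr0n.
have LR0 : 0 < L%:R :> R by rewrite ltr0n.
have nR0 : 0 < n%:R :> R by rewrite ltr0n.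
(* n^(a-1) from the bound and n from the norm of v combine into n^a. *)
have -> : C * t * (L%:R / n%:R `^ (a - 1) + t * n%:R / L%:R ^+ 2) * sqnorm2n n v =
    C * t * L%:R * S / c + C * t ^+ 2 * S / L%:R ^+ 2.
  rewrite /sqnorm2n -/S /c -(mulr_powRB1 (ltW nR0) ha).
  have : n%:R `^ (a - 1) != 0 :> R by rewrite gt_eqF// powR_gt0.
  move: (n%:R `^ (a - 1)) => p p0; field.
  by rewrite p0 !gt_eqF.
apply/lee_addgt0Pr => e e0.
(* The error in L^2 is multiplied by 4 t^2 in additive_functional_bound. *)
have e80 : 0 < e / (4 * t ^+ 2) by rewrite divr_gt0// mulr_gt0// exprn_gt0.
have [V [LV GV hV]] := cubic_decomposition H L0 ell2v e80.
have Ldom f : Dom n f -> L2 (nu rho) f by move=> /local_dom[].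
(* The choice of kappa makes the gradient term exactly n^a times the
   Dirichlet form. *)
pose kappa := 2 * delta * c / 3.
have k0 : 0 < kappa by rewrite divr_gt0// !mulr_gt0.
have Vf f : Dom n f -> 2 * \int[nu rho]_x (V x * f x) <=
    6 * L%:R * s2 ^+ 3 * S / (delta * c) -
    \int[nu rho]_x (f x * (c * Ln n f x)).
  move=> Df; have Lf := Ldom _ Df; have [_ gen2 _] := gen.
  have [_ LA _] := gen2 _ Df.
  have LLf : L2 (nu rho) (Ln n f).
    apply: eq_L2 (L2Z c^-1 LA) => x /=.
    by rewrite mulrA mulVf ?mul1r// gt_eqF.
  have -> : \int[nu rho]_x (f x * (c * Ln n f x)) =
      - (c * dirichlet_form (nu rho) (Ln n) f).
    rewrite /dirichlet_form mulrN opprK -(RintegralZl _ measurableT (L2_mul Lf LLf)).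
    by apply: eq_Rintegral => x _; rewrite mulrCA.
  have zd x : delta <= zeta n x by have /andP[] := zetab x.
  have := hV f _ kappa k0 Lf (gradients_le_dirichlet H d0 mzeta zd Lf (DE f Df)).
  move=> h; apply: (le_trans h); rewrite -/S -/s2 le_eqVlt; apply/orP; left.
  by apply/eqP; rewrite /kappa; field; rewrite !gt_eqF.
have := additive_functional_bound
  (invariant_time_change (ltW c0) (inv n n0)) (gen : generated_by (nu rho)
    (semigroup (time_change (eta n) (ltW c0))) (Dom n) (fun f e => c * Ln n f e))
  Ldom (cubic_sum_L2 H L0 v) LV t0 Vf GV.
move=> h; apply: (le_trans h); rewrite -/Cr -/S -EFinD lee_fin.
have -> : 4 * t * (6 * L%:R * s2 ^+ 3 * S / (delta * c)) +
    4 * t ^+ 2 * (16 * Cr / L%:R ^+ 2 * S + e / (4 * t ^+ 2)) =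
  24 * s2 ^+ 3 / delta * (t * L%:R * S / c) + 64 * Cr * (t ^+ 2 * S / L%:R ^+ 2) + e.
  by field; rewrite !gt_eqF.
rewrite lerD2r.
have -> : C * t * L%:R * S / c + C * t ^+ 2 * S / L%:R ^+ 2 =
  C * (t * L%:R * S / c) + C * (t ^+ 2 * S / L%:R ^+ 2).
  by field; rewrite !gt_eqF.
apply: lerD; apply: ler_wpM2r => //; apply: divr_ge0.
- by rewrite !mulr_ge0// ltW.
- exact: ltW.
- by rewrite mulr_ge0// exprn_ge0// ltW.
- by rewrite exprn_ge0// ltW.
Qed.
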